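(* Let $N\geq 2$ and $1\leq k<N$ be integers. Let $g:[0,+\infty)\to\mathbb R$ be bounded, and define, for $t>0$ and $r\in\mathbb R$, $$\psi(t,r):=\frac{1}{(4\pi t)^{k/2}}\int_{\mathbb R^k}e^{-\frac{\vert r\omega-y\vert^2}{4t}}\,g(\vert y\vert)\,dy,$$ where $\omega$ is any unit vector of $\mathbb R^k$ (the value does not depend on the choice of $\omega$). Assume that $$\partial_{rr}\psi(t,r)\geq \frac 1 r\,\partial_r\psi(t,r)\quad\text{for all } t>0,\ r>0.$$ Then the solution of the Cauchy problem $$\partial_t u=\mathcal P_k^+ u \ \text{ in } (0,+\infty)\times\mathbb R^N,\qquad u(0,x)=g(\vert x\vert),$$ is $$u(t,x)=\psi(t,\vert x\vert)=\frac{1}{(4\pi t)^{k/2}}\int_{\mathbb R^k}e^{-\frac{\vert \,\vert x\vert\omega-y\vert^2}{4t}}\,g(\vert y\vert)\,dy,\quad t>0,\ x\in\mathbb R^N.$$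
   Context: For a function $u:\mathbb R^N\to\mathbb R$, let $\lambda_1(D^2u)\leq\cdots\leq\lambda_N(D^2u)$ denote the eigenvalues of the Hessian matrix $D^2u$, and define the fully nonlinear degenerate elliptic operator $\mathcal P_k^+ u:=\sum_{i=N-k+1}^N\lambda_i(D^2u)$ (sum of the $k$ largest eigenvalues). Solutions of the Cauchy problem are understood in the viscosity sense; $\vert\cdot\vert$ is the Euclidean norm. Note that $x\in\mathbb R^N$ while the integration variable $y$ ranges over $\mathbb R^k$.
   Formalization: g is additionally assumed continuous on [0,+∞) (for g the indicator of {0}, ψ=0 does not attain the initial datum), and ''the solution'' means a viscosity solution continuous up to t=0, unique among bounded ones. *)

(* Defs.v *)
From HB Require Import structures.
From mathcomp Require Import all_boot all_order all_algebra.
From mathcomp Require Import all_classical all_reals all_analysis.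
Set Implicit Arguments. Unset Strict Implicit. Unset Printing Implicit Defensive.
Import Order.TTheory GRing.Theory Num.Theory.
Import numFieldNormedType.Exports.
Local Open Scope classical_set_scope.
Local Open Scope ring_scope.

Section Defs.
Variable R : realType.

(* Euclidean norm on R^n, represented as row vectors 'rV[R]_n.
   (The library norm on matrices is the sup norm, so we define it.) *)
Definition enorm (n : nat) (x : 'rV[R]_n) : R :=
  Num.sqrt (\sum_(i < n) x ord0 i ^+ 2).

Definition ebasis (n : nat) (i : 'I_n) : 'rV[R]_n := delta_mx ord0 i.

Definition partial (n : nat) (i : 'I_n) (f : 'rV[R]_n -> R) (x : 'rV[R]_n) : R :=
  'D_(ebasis i) f x.

Definition hessian (n : nat) (f : 'rV[R]_n -> R) (x : 'rV[R]_n) : 'M[R]_n :=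
  \matrix_(i, j) partial i (partial j f) x.

(* The eigenvalues of A (with multiplicity) in nondecreasing order:
   lambda_1 <= ... <= lambda_n, i.e. a sorted sequence s of length n with
   char_poly A = prod_{a in s} (X - a).  This exists (and is unique) for
   real symmetric matrices, in particular for Hessians of C^2 functions.
   (Junk value [::] otherwise.) *)
Definition is_sorted_spectrum (n : nat) (A : 'M[R]_n) (s : seq R) : Prop :=
  [/\ size s = n, sorted <=%R s & char_poly A = \prod_(a <- s) ('X - a%:P)].

Definition sorted_eigenvalues (n : nat) (A : 'M[R]_n) : seq R :=
  match pselect (exists s, is_sorted_spectrum A s) with
  | left h => projT1 (cid h)
  | right _ => [::]
  end.

Definition Pkplus (n k : nat) (A : 'M[R]_n) : R :=
  \sum_(n - k <= i < n) nth 0 (sorted_eigenvalues A) i.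

Definition joint (N : nat) (u : R -> 'rV[R]_N -> R) : R * 'rV[R]_N -> R :=
  fun p => u p.1 p.2.

Definition dt (N : nat) (u : R -> 'rV[R]_N -> R) (t : R) (x : 'rV[R]_N) : R :=
  'D_1 (fun s => u s x) t.

Definition C12 (N : nat) (phi : R -> 'rV[R]_N -> R) : Prop :=
  forall (t : R) (x : 'rV[R]_N), 0 < t ->
  [/\ derivable (fun s => phi s x) t 1,
      (forall i, derivable (phi t) x (ebasis i)) &
      (forall i j, derivable (partial j (phi t)) x (ebasis i))] /\
  [/\ {for (t, x), continuous (joint phi)},
      {for (t, x), continuous (joint (dt phi))},
      (forall i, {for (t, x), continuous (joint (fun s y => partial i (phi s) y))}) &
      (forall i j, {for (t, x),
         continuous (joint (fun s y => partial i (partial j (phi s)) y))})].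

Definition visc_sub (N k : nat) (u : R -> 'rV[R]_N -> R) : Prop :=
  forall (phi : R -> 'rV[R]_N -> R) (t0 : R) (x0 : 'rV[R]_N),
    C12 phi -> 0 < t0 ->
    (\forall p \near (t0, x0), u p.1 p.2 - phi p.1 p.2 <= u t0 x0 - phi t0 x0) ->
    dt phi t0 x0 <= Pkplus k (hessian (phi t0) x0).

Definition visc_super (N k : nat) (u : R -> 'rV[R]_N -> R) : Prop :=
  forall (phi : R -> 'rV[R]_N -> R) (t0 : R) (x0 : 'rV[R]_N),
    C12 phi -> 0 < t0 ->
    (\forall p \near (t0, x0), u t0 x0 - phi t0 x0 <= u p.1 p.2 - phi p.1 p.2) ->
    Pkplus k (hessian (phi t0) x0) <= dt phi t0 x0.

Definition cauchy_solution (N k : nat) (g : R -> R) (u : R -> 'rV[R]_N -> R) : Prop :=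
  [/\ {within [set p : R * 'rV[R]_N | 0 <= p.1], continuous (joint u)},
      (forall x, u 0 x = g (enorm x)),
      visc_sub k u & visc_super k u].

Fixpoint iint (n : nat) : ('rV[R]_n -> R) -> R :=
  match n with
  | 0 => fun f => f 0
  | m.+1 => fun f =>
      Rintegral lebesgue_measure setT
        (fun s : R => iint (fun v : 'rV[R]_m => f (row_mx (s%:M : 'rV[R]_1) v)))
  end.

Definition omega (k : nat) : 'rV[R]_k := \row_(j < k) (if (j : nat) == 0%N then 1 else 0).

Definition psi (k : nat) (g : R -> R) (t r : R) : R :=
  (4 * pi * t) `^ (- (k%:R / 2)) *
  iint (fun y : 'rV[R]_k =>
          expR (- (enorm (r *: omega k - y) ^+ 2 / (4 * t))) * g (enorm y)).

End Defs.

(* Main.v *)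
Require Import Defs.
From HB Require Import structures.
From mathcomp Require Import all_boot all_order all_algebra.
From mathcomp Require Import all_classical all_reals all_analysis.
From mathcomp Require Import measurable_realfun.
From mathcomp Require Import ring lra.
Set Implicit Arguments. Unset Strict Implicit. Unset Printing Implicit Defensive.
Import Order.TTheory GRing.Theory Num.Theory.
Import numFieldNormedType.Exports.
From mathcomp Require Import spectral sesquilinear complex zify.
Local Open Scope classical_set_scope.
Local Open Scope ring_scope.

(* A radial function [W t x = Psi t |x|] has at [x] the Hessian
   [p I + (prr - p) v^T v], where [v = x / |x|], [p = pr / r] and [pr], [prr] are
   the derivatives of [Psi t] at [r = |x|].  When [p <= prr], the sum of its [k]
   largest eigenvalues is [prr + (k - 1) p], the radial Laplacian of dimension
   [k].  As [psi k g] is the heat evolution of the radial datum [g (|y|)] in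
   dimension [k], the function [U] is a classical solution.  It is a viscosity
   solution since, where [W - phi] is locally maximal or minimal, the Hessians of
   [W] and [phi] are comparable.  For uniqueness, a bounded solution [u] is compared
   with [W] perturbed by [e (|x|^2 + (2 k + 1) t)], a strict super- or subsolution
   that is itself a test function: if [u] and [W] differed at a positive time, the
   penalized difference would have a positive maximum, attained at a positive time,
   and the definition of viscosity solution would fail there.

   Integrating over [q = |y|^2] and one coordinate [s], the kernel of [psi] is the
   exponential family [exp (a s - b q)] with [a = r / 2 t], [b = 1 / 4 t], whose
   moments are differentiable in [(b, a)] with no regularity of [g] beyond
   continuity; the heat equation becomes the moment identity
   [a M(q - s^2) = (k - 1) M(s)]. *)

(** * Continuity and derivation rules *)

(** One of the two functions compared in the uniqueness argument is of class C^{1,2}, so the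
    definition of viscosity solution can be tested directly at the maximum, without doubling the
    variables. The origin is the delicate place: |x| is not differentiable there, pr / r has the
    form 0 / 0, and the radial equation contains 1 / r. Hence [psi] is treated as a function of
    every real r whose derivative vanishes at r = 0, the equation is kept multiplied by r, and its
    value at r = 0 is recovered by differentiating that product. A second obstacle is that g has no
    derivative. Integrations by parts are therefore made on the tail primitive, in the variable q,
    of g times a Gaussian, and all domination is by explicit Gaussians, each estimate giving up a
    definite fraction of the rate. The formula of [psi] is also singular at t = 0; a rescaled
    integral that is regular at t = 0 provides the initial trace and the uniform bound. *)

Section Continuity.
Variables (R : realType) (T : topologicalType).
Implicit Types (f g : T -> R) (x : T).

Lemma cts_cst (U : topologicalType) (c : U) x : continuous_at x (fun _ : T => c).
Proof. exact: cvg_cst. Qed.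

Lemma cts_id x : continuous_at x (fun y : T => y).
Proof. exact: cvg_id. Qed.

Lemma ctsD f g x : continuous_at x f -> continuous_at x g ->
  continuous_at x (fun y => f y + g y).
Proof. by move=> cf cg; apply: cvgD. Qed.

Lemma ctsN f x : continuous_at x f -> continuous_at x (fun y => - f y).
Proof. by move=> cf; apply: cvgN. Qed.

Lemma ctsM f g x : continuous_at x f -> continuous_at x g ->
  continuous_at x (fun y => f y * g y).
Proof. by move=> cf cg; apply: cvgM. Qed.

Lemma ctsX f n x : continuous_at x f -> continuous_at x (fun y => f y ^+ n).
Proof.
by move=> cf; apply: (@continuous_comp _ _ _ f (fun z : R => z ^+ n)) => //;
  exact: exprn_continuous.
Qed.

Lemma ctsV f x : f x != 0 -> continuous_at x f ->
  continuous_at x (fun y => (f y)^-1).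
Proof. by move=> f0 cf; apply: cvgV. Qed.

Lemma cts_comp (U V : topologicalType) (h : U -> V) (k : T -> U) x :
  continuous_at x k -> continuous_at (k x) h ->
  continuous_at x (fun y => h (k y)).
Proof. by move=> ck ch; apply: (@continuous_comp _ _ _ k h). Qed.

Lemma cts_app (U V : topologicalType) (h : U -> V) (k : T -> U) x : continuous h ->
  continuous_at x k -> continuous_at x (fun y => h (k y)).
Proof. by move=> ch ck; apply: cts_comp => //; exact: ch. Qed.

Lemma cts_exp f x : continuous_at x f -> continuous_at x (fun y => expR (f y)).
Proof. by move=> cf; apply: (@cts_comp _ _ expR f) => //; exact: continuous_expR. Qed.

Lemma cts_sqrt f x : continuous_at x f ->
  continuous_at x (fun y => Num.sqrt (f y)).
Proof. by move=> cf; apply: (@cts_comp _ _ Num.sqrt f) => //; exact: sqrt_continuous. Qed.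

Lemma cts_norm f x : continuous_at x f -> continuous_at x (fun y => `|f y|).
Proof. by move=> cf; apply: cvg_norm. Qed.

Lemma cts_pair (U V : topologicalType) (h : T -> U) (k : T -> V) x :
  continuous_at x h -> continuous_at x k ->
  continuous_at x (fun y => (h y, k y)).
Proof. by move=> ch ck; apply: (cvg_pair ch ck). Qed.

Lemma cts_fst (U V : topologicalType) (h : T -> U * V) x :
  continuous_at x h -> continuous_at x (fun y => (h y).1).
Proof. by move=> ch; apply: (@cts_comp _ _ fst h) => //; exact: cvg_fst. Qed.

Lemma cts_snd (U V : topologicalType) (h : T -> U * V) x :
  continuous_at x h -> continuous_at x (fun y => (h y).2).
Proof. by move=> ch; apply: (@cts_comp _ _ snd h) => //; exact: cvg_snd. Qed.

Lemma cts_sum n (F : 'I_n -> T -> R) x : (forall i, continuous_at x (F i)) ->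
  continuous_at x (fun y => \sum_(i < n) F i y).
Proof.
move=> cF; elim: n F cF => [|n IH] F cF.
  have -> : (fun y => \sum_(i < 0) F i y) = (fun=> 0) by apply/funext => y; rewrite big_ord0.
  exact: cts_cst.
have -> : (fun y => \sum_(i < n.+1) F i y) =
    (fun y => \sum_(i < n) F (widen_ord (leqnSn n) i) y + F ord_max y).
  by apply/funext => y; rewrite big_ord_recr.
by apply: ctsD => //; apply: IH.
Qed.

End Continuity.

(* Higher-order unification leaves eta-reduced functions such as [pair a] or [expR]. *)
Ltac cts_eta := lazymatch goal with
  | |- continuous_at _ (fun _ => _) => idtac
  | |- continuous_at ?x ?f => change (continuous_at x (fun y => f y))
  end.

(** The constant case comes first: it closes at once any subterm free of the variable, such as
    division by a fixed number. An inverse that depends on the variable requires a nonvanishing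
    condition and is expected among the hypotheses. *)
Ltac cts_step := cts_eta; lazymatch goal with
  | |- continuous_at _ (fun _ => ?c) => exact: cts_cst
  | |- continuous_at _ (fun y => y) => exact: cts_id
  | |- continuous_at _ (fun y => @Algebra.add _ (@?f y) (@?g y)) => apply: (@ctsD _ _ f g)
  | |- continuous_at _ (fun y => @Algebra.opp _ (@?f y)) => apply: (@ctsN _ _ f)
  | |- continuous_at _ (fun y => @GRing.mul _ (@?f y) (@?g y)) => apply: (@ctsM _ _ f g)
  | |- continuous_at _ (fun y => @GRing.exp _ (@?f y) ?n) => apply: (@ctsX _ _ f)
  | |- continuous_at _ (fun y => expR (@?f y)) => apply: (@cts_exp _ _ f)
  | |- continuous_at _ (fun y => Num.sqrt (@?f y)) => apply: (@cts_sqrt _ _ f)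
  | |- continuous_at _ (fun y => Num.norm (@?f y)) => apply: (@cts_norm _ _ f)
  | |- continuous_at _ (fun y => (@?f y, @?g y)) => apply: (@cts_pair _ _ _ f g)
  | |- continuous_at _ (fun y => fst (@?f y)) => apply: (@cts_fst _ _ _ f)
  | |- continuous_at _ (fun y => snd (@?f y)) => apply: (@cts_snd _ _ _ f)
  | |- continuous_at _ (fun y => \sum_(i < _) _) => apply: cts_sum => ?
  | H : continuous ?h |- continuous_at _ (fun y => ?h (@?f y)) => apply: (@cts_app _ _ _ h f _ H)
  | |- continuous_at _ _ => assumption
  end.

Ltac cts :=
  lazymatch goal with
  | |- continuous_at _ _ => idtac
  | |- {for ?x, continuous ?f} => change (continuous_at x f)
  | |- _ => let x := fresh "x" in intro x
  end; repeat cts_step.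

Section DerivativeRules.
Variable R : realType.
Implicit Types (f g : R -> R) (x a b : R).

Lemma dv_eq f x a b : is_derive x 1 f a -> a = b -> is_derive x 1 f b.
Proof. by move=> h <-. Qed.

Lemma dv_cst (c x : R) : is_derive x 1 (fun _ : R => c) (0 : R).
Proof. exact: is_derive_cst. Qed.

Lemma dv_id x : is_derive x 1 (fun y : R => y) (1 : R).
Proof. exact: is_derive_id. Qed.

Lemma dvD f g x a b : is_derive x 1 f a -> is_derive x 1 g b ->
  is_derive x 1 (fun y => f y + g y) (a + b).
Proof. by move=> df dg; exact: is_deriveD. Qed.

Lemma dvN f x a : is_derive x 1 f a -> is_derive x 1 (fun y => - f y) (- a).
Proof. by move=> df; exact: is_deriveN. Qed.

Lemma dvM f g x a b : is_derive x 1 f a -> is_derive x 1 g b ->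
  is_derive x 1 (fun y => f y * g y) (f x * b + a * g x).
Proof.
move=> df dg; apply: dv_eq (is_deriveM df dg) _.
by rewrite -[f x *: b]/(f x * b) -[g x *: a]/(g x * a) (mulrC a).
Qed.

Lemma dv_comp f g x a b : is_derive x 1 f a -> is_derive (f x) 1 g b ->
  is_derive x 1 (fun y => g (f y)) (b * a).
Proof. by move=> df dg; exact: is_derive1_comp. Qed.

Lemma dv_exp f x a : is_derive x 1 f a ->
  is_derive x 1 (fun y => expR (f y)) (expR (f x) * a).
Proof. by move=> df; apply: (@dv_comp f expR). Qed.

Lemma dvX f n x a : is_derive x 1 f a ->
  is_derive x 1 (fun y => f y ^+ n.+1) (n.+1%:R * f x ^+ n * a).
Proof.
move=> df; elim: n => [|n IH].
  by rewrite expr0 !mulr1n mulr1 mul1r; under eq_fun do rewrite expr1.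
under eq_fun do rewrite exprS.
apply: dv_eq (dvM df IH) _; rewrite [in RHS]mulrS [f x ^+ n.+1]exprS; ring.
Qed.

Lemma dvV f x a : f x != 0 -> is_derive x 1 f a ->
  is_derive x 1 (fun y => (f y)^-1) (- (a / f x ^+ 2)).
Proof.
move=> f0 df; apply: dv_eq (is_deriveV f0 df) _.
by rewrite -[LHS]/(- (f x ^- 2) * a) mulNr mulrC.
Qed.

Lemma dv_sqrt f x a : 0 < f x -> is_derive x 1 f a ->
  is_derive x 1 (fun y => Num.sqrt (f y)) (a / (2 * Num.sqrt (f x))).
Proof.
move=> f0 df; apply: dv_eq (dv_comp df (is_derive1_sqrt f0)) _.
by rewrite mulrC.
Qed.

Lemma is_derive_continuous f x a : is_derive x 1 f a -> {for x, continuous f}.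
Proof.
by move=> h; apply: differentiable_continuous; apply/derivable1_diffP; apply: ex_derive.
Qed.

End DerivativeRules.

Ltac dv_eta := lazymatch goal with
  | |- is_derive _ _ (fun _ => _) _ => idtac
  | |- is_derive ?x ?v ?f ?l => change (is_derive x v (fun y => f y) l)
  end.

(* [is_derive] is a class: type class resolution would fill in derivatives of its own. *)
Ltac dv_step := dv_eta; lazymatch goal with
  | |- is_derive _ _ (fun _ => ?c) _ => notypeclasses refine (@dv_cst _ _ _)
  | |- is_derive _ _ (fun y => y) _ => notypeclasses refine (@dv_id _ _)
  | |- is_derive _ _ (fun y => @Algebra.add _ (@?f y) (@?g y)) _ =>
      notypeclasses refine (@dvD _ f g _ _ _ _ _)
  | |- is_derive _ _ (fun y => @Algebra.opp _ (@?f y)) _ =>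
      notypeclasses refine (@dvN _ f _ _ _)
  | |- is_derive _ _ (fun y => @GRing.mul _ (@?f y) (@?g y)) _ =>
      notypeclasses refine (@dvM _ f g _ _ _ _ _)
  | |- is_derive _ _ (fun y => @GRing.exp _ (@?f y) (S ?n)) _ =>
      notypeclasses refine (@dvX _ f n _ _ _)
  | |- is_derive _ _ (fun y => expR (@?f y)) _ => notypeclasses refine (@dv_exp _ f _ _ _)
  | H : forall x, is_derive x _ ?h _ |- is_derive _ _ (fun y => ?h (@?f y)) _ =>
      notypeclasses refine (@dv_comp _ f h _ _ _ _ (H _))
  | |- is_derive _ _ _ _ => eassumption
  end.

(* What [dv] leaves to prove is that the computed derivative is the expected one. *)
Ltac dv := notypeclasses refine (@dv_eq _ _ _ _ _ _ _); [repeat dv_step | rewrite /=].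

(** * Integrals dominated by Gaussians *)

Section GaussianIntegrals.
Variable R : realType.
Local Notation mu := (@lebesgue_measure R).
Local Notation intR := (Rintegral (@lebesgue_measure R) setT).

Definition gauss_bound (c C : R) (f : R -> R) :=
  forall s, `|f s| <= C * expR (- (c * s ^+ 2)).

Lemma continuous_measurable_EFin (f : R -> R) :
  continuous f -> measurable_fun setT (EFin \o f).
Proof. by move=> cf; apply/measurable_EFinP; exact: continuous_measurable_fun. Qed.

Lemma continuous_gauss (c : R) : continuous (fun s : R => expR (- (c * s ^+ 2))).
Proof.
move=> x; apply: (@continuous_comp _ _ _ (fun x : R => - (c * x ^+ 2)) expR).
  by apply: cvgN; apply: cvgM; [exact: cvg_cst|exact: exprn_continuous].
exact: continuous_expR.
Qed.

Lemma integral_affine (a b : R) (G : R -> R) : 0 < b -> continuous G ->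
  (forall x, 0 <= G x) ->
  (\int[mu]_x (G x)%:E = \int[mu]_x (G (a + b * x) * b)%:E)%E.
Proof.
move=> b0 cG G0.
have dF (x : R) : is_derive x 1 (fun x : R => a + b * x) b.
  by apply: is_derive_eq; rewrite add0r mul1r; exact: mulr1.
have F'E : derive1 (fun x : R => a + b * x) = cst b.
  by apply/funext => x; rewrite derive1E derive_val.
rewrite (@increasing_ge0_integration_by_substitutionT R (fun x => a + b * x) G) ?F'E //.
- by move=> x y xy /=; rewrite ltrD2l ltr_pM2l.
- exact: cst_continuous.
- exact: is_cvg_cst.
- exact: is_cvg_cst.
- apply/cvgrNyPle => A.
  by near=> x; rewrite -lerBrDl mulrC -ler_pdivlMr.
- apply/cvgryPge => A.
  by near=> x; rewrite -lerBlDl mulrC -ler_pdivrMr.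
Unshelve. all: end_near. Qed.

Lemma integrable_gauss (c : R) : 0 < c ->
  mu.-integrable setT (EFin \o (fun s => expR (- (c * s ^+ 2)))).
Proof.
move=> c0; apply/integrableP; split.
  by apply: continuous_measurable_EFin; exact: continuous_gauss.
have sc0 : 0 < Num.sqrt c by rewrite sqrtr_gt0.
have := @integral_affine 0 (Num.sqrt c) gauss_fun sc0 (@continuous_gauss_fun R)
  (@gauss_fun_ge0 R).
rewrite integralT_gauss => E.
have -> : (\int[mu]_x `|(EFin \o (fun s => expR (- (c * s ^+ 2)))) x| =
  \int[mu]_x ((Num.sqrt c)^-1%:E * (gauss_fun (0 + Num.sqrt c * x) * Num.sqrt c)%:E))%E.
  apply: eq_integral => x _ /=; rewrite ger0_norm ?expR_ge0 // -EFinM.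
  by rewrite (mulrC (gauss_fun _)) mulKf ?gt_eqF // /gauss_fun add0r exprMn sqr_sqrtr // ltW.
rewrite ge0_integralZl //=.
- by rewrite -E -EFinM ltry.
- apply: continuous_measurable_EFin => x.
  apply: cvgM; last exact: cvg_cst.
  apply: (@continuous_comp _ _ _ (fun x : R => 0 + Num.sqrt c * x) gauss_fun).
    by apply: cvgD; [exact: cvg_cst|apply: cvgM; [exact: cvg_cst|exact: cvg_id]].
  exact: continuous_gauss_fun.
- by move=> x _; rewrite lee_fin mulr_ge0 ?gauss_fun_ge0 // ltW.
Qed.

Lemma integrable_bound (c C : R) (f : R -> R) : 0 < c -> continuous f -> gauss_bound c C f ->
  mu.-integrable setT (EFin \o f).
Proof.
move=> c0 cf fb.
have : mu.-integrable setT (fun x => (C%:E * (EFin \o (fun s => expR (- (c * s ^+ 2)))) x)%E).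
  by apply: integrableZl => //; exact: integrable_gauss.
apply: le_integrable => //.
  exact: continuous_measurable_EFin.
by move=> x _ /=; rewrite lee_fin; apply: le_trans (fb x) _; exact: ler_norm.
Qed.

(** [integral_affine] is for nonnegative functions, so it is applied to [f + e] and to [e], where
    [e] is the Gaussian majorant of [f], and the results are subtracted. *)
Lemma intR_affine (c C a b : R) (f : R -> R) : 0 < c -> 0 < b -> continuous f -> gauss_bound c C f ->
  intR f = b * intR (fun s => f (a + b * s)).
Proof.
move=> c0 b0 cf fb.
pose e s := C * expR (- (c * s ^+ 2)).
have ce : continuous e by move=> x; apply: cvgM; [exact: cvg_cst|exact: continuous_gauss].
have fe0 x : 0 <= f x + e x by have := fb x; rewrite ler_norml -/(e x) => /andP[]; lra.
have e0 x : 0 <= e x by apply: le_trans (fb x).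
have ife : mu.-integrable setT (EFin \o (fun x => f x + e x)).
  apply: (@integrable_bound c (C + C)) => // [x|x].
    by apply: cvgD; [exact: cf|exact: ce].
  by rewrite mulrDl (le_trans (ler_normD _ _)) // lerD // ger0_norm.
have ie : mu.-integrable setT (EFin \o e).
  by apply: (@integrable_bound c C) => // x; rewrite ger0_norm.
(* Integrability after the substitution is read off from the rule itself: [b] times the new integral
   is finite. *)
have aff (G : R -> R) : continuous G -> (forall x : R, 0 <= G x) -> mu.-integrable setT (EFin \o G) ->
    mu.-integrable setT (EFin \o (fun s => G (a + b * s))) /\
    intR G = b * intR (fun s => G (a + b * s)).
  move=> cG G0 /integrableP[mG iG].
  have cGa : continuous (fun s => G (a + b * s)).
    move=> x; apply: (@continuous_comp _ _ _ (fun x : R => a + b * x) G); last exact: cG.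
    by apply: cvgD; [exact: cvg_cst|apply: cvgM; [exact: cvg_cst|exact: cvg_id]].
  have mGa : measurable_fun setT (EFin \o (fun s => G (a + b * s))).
    exact: continuous_measurable_EFin.
  have E : (\int[mu]_x (G x)%:E = b%:E * \int[mu]_x (G (a + b * x))%:E)%E.
    rewrite (integral_affine a b0) // -ge0_integralZl //=.
    - by apply: eq_integral => x _; rewrite -EFinM mulrC.
    - by move=> x _; rewrite lee_fin.
    - by rewrite lee_fin ltW.
  have iGa : mu.-integrable setT (EFin \o (fun s => G (a + b * s))).
    apply/integrableP; split => //=.
    under eq_integral do rewrite ger0_norm //.
    have : (\int[mu]_x (G x)%:E < +oo)%E.
      by move: iG; under eq_integral do rewrite /= ger0_norm //.
    rewrite E; case: (\int[mu]_x (G (a + b * x))%:E)%E => [r||]; rewrite ?ltry ?ltNyr //.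
    by rewrite gt0_muley.
  by split=> //; rewrite /Rintegral E fineM // integrable_fin_num.
have [iFa EF] := aff _ (fun x => cvgD (cf x) (ce x)) fe0 ife.
have [ iea Ee] := aff _ ce e0 ie.
have -> : intR f = intR (fun x => f x + e x) - intR e.
  by rewrite -RintegralB //; apply: eq_Rintegral => x _; rewrite addrK.
rewrite EF Ee -mulrBr -RintegralB //; congr (_ * _).
by apply: eq_Rintegral => x _; rewrite addrK.
Qed.

Lemma intR_gauss1 : intR (fun s => expR (- s ^+ 2)) = Num.sqrt pi.
Proof. by have /= := congr1 fine (@integralT_gauss R). Qed.

Definition gmass (c : R) := intR (fun s => expR (- (c * s ^+ 2))).

Lemma gmass_ge0 c : 0 <= gmass c.
Proof. by apply: Rintegral_ge0 => x _; exact: expR_ge0. Qed.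

Lemma intR_le (c C : R) (f : R -> R) : 0 < c -> continuous f -> gauss_bound c C f ->
  `|intR f| <= C * gmass c.
Proof.
move=> c0 cf fb.
have i_f := integrable_bound c0 cf fb.
apply: le_trans (le_normr_Rintegral _ i_f) _ => //.
rewrite /gmass -RintegralZl //; last exact: integrable_gauss.
apply: le_Rintegral => //; first exact: integrable_norm i_f.
  apply: (@integrable_bound c `|C|) => // [x|x].
    by apply: cvgM; [exact: cvg_cst|exact: continuous_gauss].
  by rewrite normrM (ger0_norm (expR_ge0 _)).
Qed.

(** Reduces continuity in a parameter to sequences, the setting of dominated convergence. If
    continuity fails, a bad point in each ball of radius 1/(n+1) gives a sequence contradicting the
    hypothesis. *)
Lemma cvg_seq_metric (T : pseudoMetricType R) (f : T -> R) (p : T) :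
  (forall u : nat -> T, u n @[n --> \oo] --> p -> f (u n) @[n --> \oo] --> f p) ->
  {for p, continuous f}.
Proof.
move=> H; apply: contrapT => /cvgrPdist_lt nc.
have [e e0 ne] : exists2 e, 0 < e & ~ \forall x \near p, `|f p - f x| < e.
  apply: contrapT => h; apply: nc => e e0; apply: contrapT => h'; apply: h; by exists e.
have /choice [u up] : forall n : nat, exists x, ball p n.+1%:R^-1 x /\ e <= `|f p - f x|.
  move=> n; apply: contrapT => h; apply: ne.
  apply: filterS (nbhsx_ballx p _ (_ : 0 < n.+1%:R^-1)); last by rewrite invr_gt0.
  by move=> x px; rewrite ltNge; apply/negP => h'; apply: h; exists x.
have /H /cvgrPdist_lt /(_ _ e0) : u n @[n --> \oo] --> p.
  apply/cvg_ballP => d d0.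
  near=> n; have [] := up n => + _; apply: le_ball.
  rewrite -[leRHS]invrK lef_pV2 ?posrE ?invr_gt0 //.
  apply: (@le_trans _ _ n%:R); last by rewrite ler_nat.
  by near: n; exact: nbhs_infty_ger.
by move=> [N _ /(_ N (leqnn _))] /=; have [_] := up N; rewrite leNgt => /negP.
Unshelve. all: end_near. Qed.

Lemma intR_cvg_dominated (c C : R) (F : nat -> R -> R) (f : R -> R) : 0 < c ->
  (forall n, continuous (F n)) -> continuous f ->
  (forall s, F n s @[n --> \oo] --> f s) ->
  (forall n, gauss_bound c C (F n)) ->
  intR (F n) @[n --> \oo] --> intR f.
Proof.
move=> c0 cF cf Ff Fb.
have ig : mu.-integrable setT (EFin \o (fun s => C * expR (- (c * s ^+ 2)))).
  apply: (@integrable_bound c `|C|) => // [x|x].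
    by apply: cvgM; [exact: cvg_cst|exact: continuous_gauss].
  by rewrite normrM (ger0_norm (expR_ge0 _)).
have h1 : {ae mu, forall s, setT s -> (F n s)%:E @[n --> \oo] --> (f s)%:E}.
  by apply: aeW => s _; apply: cvg_EFin; [exact: nearW|exact: Ff].
have h2 : {ae mu, forall s n, setT s -> (`|(F n s)%:E| <= (C * expR (- (c * s ^+ 2)))%:E)%E}.
  by apply: aeW => s n _; rewrite lee_fin; exact: Fb.
have [i_f _ h] := @dominated_convergence _ _ _ mu setT measurableT
  (fun n => EFin \o F n) (EFin \o f) (EFin \o (fun s => C * expR (- (c * s ^+ 2))))
  (fun n => continuous_measurable_EFin (cF n)) (continuous_measurable_EFin cf) h1 ig h2.
apply: fine_cvg; rewrite fineK; first exact: h.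
exact: integrable_fin_num.
Qed.

Lemma continuous_intR (T : pseudoMetricType R) (c C : R) (F : T * R -> R) : 0 < c ->
  continuous F -> (forall x, gauss_bound c C (fun s => F (x, s))) ->
  continuous (fun x => intR (fun s => F (x, s))).
Proof.
move=> c0 cF Fb p; apply: cvg_seq_metric => u up.
apply: (@intR_cvg_dominated c C (fun n s => F (u n, s)) (fun s => F (p, s))) => //.
- by move=> n; cts.
- by cts.
- move=> s; apply: (@cvg_comp _ _ _ (fun n => (u n, s)) F); last exact: cF.
  exact: (cvg_pair up (cvg_cst s)).
Qed.

(* The integral of [F' = lim_n n (F(. + 1/n) - F)] vanishes by translation invariance. *)
Lemma intR_derive_eq0 (c C : R) (F f : R -> R) : 0 < c ->
  (forall x : R, is_derive x 1 F (f x)) -> continuous f ->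
  gauss_bound c C F -> gauss_bound c C f -> intR f = 0.
Proof.
move=> c0 dF cf Fb fb.
have cF : continuous F by move=> x; exact: (is_derive_continuous (dF x)).
have C0 : 0 <= C by have := le_trans (normr_ge0 _) (Fb 0); rewrite pmulr_lge0 ?expR_gt0.
(* A shift by at most 1 costs half of the rate: (s + d)^2 + 1 - s^2 / 2 = (s + 2 d)^2 / 2 + 1 - d^2
   >= 0. *)
have shiftb (d s : R) : 0 <= d <= 1 ->
    C * expR (- (c * (s + d) ^+ 2)) <= C * expR c * expR (- (c / 2 * s ^+ 2)).
  move=> /andP[d0 d1]; rewrite -mulrA -expRD ler_wpM2l // ler_expR.
  suff : 0 <= c * ((s + d) ^+ 2 + 1 - s ^+ 2 / 2) by lra.
  apply: mulr_ge0; first lra.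
  have : d * d <= 1 by nra.
  by have := sqr_ge0 (s + 2 * d); lra.
pose D n (s : R) : R := n.+1%:R * (F (s + n.+1%:R^-1) - F s).
have n1 n : 0 <= (n.+1%:R^-1 : R) <= 1.
  by rewrite invr_ge0 ler0n invf_le1 ?ltr0n // ler1n.
have cD n : continuous (D n).
  by rewrite /D; cts.
have D0 n : intR (D n) = 0.
  have iF : mu.-integrable setT (EFin \o F) by exact: integrable_bound c0 cF Fb.
  have c2 : 0 < c / 2 by lra.
  have iFs : mu.-integrable setT (EFin \o (fun s => F (s + n.+1%:R^-1))).
    apply: (@integrable_bound (c / 2) (C * expR c)) => // [s|s].
      by cts.
    by apply: le_trans (Fb _) _; exact: shiftb.
  have iB : mu.-integrable setT (EFin \o (fun s => F (s + n.+1%:R^-1) - F s)).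
    by have := integrableB measurableT iFs iF; apply.
  rewrite RintegralZl // RintegralB // [X in _ - X](intR_affine (n.+1%:R^-1) c0 ltr01 cF Fb).
  rewrite mul1r; under [X in _ - X]eq_Rintegral do rewrite mul1r addrC.
  by rewrite subrr mulr0.
(* By the mean value theorem the quotient is a value of [f] at distance at most 1/(n+1); this gives
   both the pointwise limit and a majorant uniform in n. *)
have DE n s : exists2 x, s <= x <= s + n.+1%:R^-1 & D n s = f x.
  have [||x] := @MVT_segment R F f s (s + n.+1%:R^-1) _ (fun x _ => dF x).
  - by rewrite lerDl; have /andP[] := n1 n.
  - exact: continuous_subspaceT.
  rewrite in_itv /= => xs E; exists x => //.
  by rewrite /D E mulrC -mulrA (addrC s) addrK mulVf ?mulr1 // pnatr_eq0.
have : intR (D n) @[n --> \oo] --> intR f.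
  apply: (@intR_cvg_dominated (c / 2) (C * expR c)) => //; first lra.
  - move=> s; apply/cvgrPdist_lt => e e0.
    have /cvgrPdist_lt /(_ _ e0) /nbhs_ballP[d /= d0 hd] := cf s.
    near=> n; have [x /andP[sx xs] ->] := DE n s; apply: hd.
    rewrite /ball /= ler0_norm; last lra.
    suff : n.+1%:R^-1 < d by move: xs; set h := n.+1%:R^-1; lra.
    by near: n; exact: near_infty_natSinv_lt (PosNum d0).
  - move=> n s; have [x /andP[sx xs] ->] := DE n s.
    apply: le_trans (fb x) _; rewrite -[x](subrKC s).
    by apply: shiftb; move: xs (n1 n); set h := n.+1%:R^-1; lra.
rewrite (_ : (fun n => intR (D n)) = fun=> 0); last by apply/funext.
by move=> h; have := cvg_unique _ h (cvg_cst 0); apply.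
Unshelve. all: end_near. Qed.

End GaussianIntegrals.

(** * Integrals of radial and axial functions *)

Section RadialIntegrals.
Variable R : realType.
Local Notation mu := (@lebesgue_measure R).
Local Notation intR := (Rintegral (@lebesgue_measure R) setT).

(* [rint m h] is the integral over R^m of [h (|v|^2)]. *)
Fixpoint rint (m : nat) (h : R -> R) : R :=
  match m with
  | 0 => h 0
  | n.+1 => intR (fun v => rint n (fun p => h (v ^+ 2 + p)))
  end.

(** [rint] evaluates its argument only at squared norms, hence the restriction to p >= 0. *)
Definition exp_bound (c C : R) (h : R -> R) :=
  forall p, 0 <= p -> `|h p| <= C * expR (- (c * p)).

Lemma eq_rint m (h1 h2 : R -> R) : (forall p, 0 <= p -> h1 p = h2 p) ->
  rint m h1 = rint m h2.
Proof.
elim: m h1 h2 => [|m IH] h1 h2 E /=; first exact: E.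
apply: eq_Rintegral => v _; apply: IH => p p0; apply: E.
by rewrite addr_ge0 // sqr_ge0.
Qed.

Lemma exp_bound_ge0 c C h : exp_bound c C h -> 0 <= C.
Proof.
by move=> /(_ 0 (lexx _)) /(le_trans (normr_ge0 _)); rewrite pmulr_lge0 ?expR_gt0.
Qed.

Lemma exp_bound_shift c C h q : 0 <= q -> exp_bound c C h ->
  exp_bound c (C * expR (- (c * q))) (fun p => h (q + p)).
Proof.
move=> q0 hb p p0; apply: le_trans (hb _ (addr_ge0 q0 p0)) _.
by rewrite -mulrA -expRD mulrDr opprD.
Qed.

(** Gives up the decay in [q] for a bound uniform in [q], as continuity in a parameter requires. *)
Lemma exp_bound_shiftW c C h q : 0 < c -> 0 <= q -> exp_bound c C h ->
  exp_bound c C (fun p => h (q + p)).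
Proof.
move=> c0 q0 hb p p0; apply: le_trans (hb _ (addr_ge0 q0 p0)) _.
rewrite ler_wpM2l ?(exp_bound_ge0 hb) // ler_expR lerN2 ler_pM2l //; lra.
Qed.

(** The bound and the continuity need each other: at every new coordinate the inner integral must be
    continuous to be integrated and dominated to be passed to the limit. The parameter space [T] is
    arbitrary because each step adds a coordinate to it. *)
Lemma rint_cont_bound m (c : R) : 0 < c ->
  (forall C (h : R -> R), continuous h -> exp_bound c C h -> `|rint m h| <= C * gmass c ^+ m) /\
  (forall (T : pseudoMetricType R) C (h : T * R -> R), continuous h ->
     (forall x, exp_bound c C (fun p => h (x, p))) ->
     continuous (fun x => rint m (fun p => h (x, p)))).
Proof.
move=> c0; elim: m => [|m [IHb IHc]]; split.
- move=> C h _ /(_ 0 (lexx _)) /=.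
  by rewrite mulr0 oppr0 expR0 expr0.
- by move=> T C h ch hb /=; cts.
- move=> C h ch hb /=; rewrite exprS mulrA (mulrAC _ (gmass c)).
  apply: intR_le => // [|v].
    apply: (IHc _ C (fun vp : R * R => h (vp.1 ^+ 2 + vp.2))); first by cts.
    by move=> v; exact: (exp_bound_shiftW c0 (sqr_ge0 v) hb).
  rewrite mulrAC; apply: IHb; first by cts.
  exact: (exp_bound_shift (sqr_ge0 v) hb).
- move=> T C h ch hb /=.
  apply: (@continuous_intR R T c (C * gmass c ^+ m)
    (fun xv : T * R => rint m (fun p => h (xv.1, xv.2 ^+ 2 + p)))) => // [|x v /=].
    apply: (IHc _ C (fun z : (T * R) * R => h (z.1.1, z.1.2 ^+ 2 + z.2))).
      by cts.
    by move=> [x v]; exact: (exp_bound_shiftW c0 (sqr_ge0 v) (hb x)).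
  rewrite mulrAC; apply: IHb; first by cts.
  exact: (exp_bound_shift (sqr_ge0 v) (hb x)).
Qed.

Lemma rint_le m (c C : R) (h : R -> R) : 0 < c -> continuous h -> exp_bound c C h ->
  `|rint m h| <= C * gmass c ^+ m.
Proof. by move=> c0; have [+ _] := rint_cont_bound m c0; apply. Qed.

Lemma continuous_rint m (T : pseudoMetricType R) (c C : R) (h : T * R -> R) : 0 < c ->
  continuous h -> (forall x, exp_bound c C (fun p => h (x, p))) ->
  continuous (fun x => rint m (fun p => h (x, p))).
Proof. by move=> c0; have [_] := rint_cont_bound m c0; apply. Qed.

Definition axial_bound (c C : R) (F : R * R -> R) :=
  forall s q, s ^+ 2 <= q -> `|F (s, q)| <= C * expR (- (c * q)).

(* [lint m F] is the integral over R^(m.+1) of [F (y_1, |y|^2)]. *)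
Definition lint m (F : R * R -> R) :=
  intR (fun s : R => rint m (fun p => F (s, s ^+ 2 + p))).

Lemma axial_bound_slice c C F s : axial_bound c C F ->
  exp_bound c (C * expR (- (c * s ^+ 2))) (fun p => F (s, s ^+ 2 + p)).
Proof.
move=> Fb p p0; rewrite -mulrA -expRD -opprD -mulrDr; apply: Fb.
by rewrite lerDl.
Qed.

Lemma axial_bound_ge0 c C F : axial_bound c C F -> 0 <= C.
Proof.
move=> /(_ 0 0); rewrite expr0n /= => /(_ (lexx _)) /(le_trans (normr_ge0 _)).
by rewrite pmulr_lge0 ?expR_gt0.
Qed.

Lemma axial_slice_gauss m c C (F : R * R -> R) : 0 < c -> continuous F -> axial_bound c C F ->
  continuous (fun s : R => rint m (fun p => F (s, s ^+ 2 + p))) /\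
  gauss_bound c (C * gmass c ^+ m) (fun s : R => rint m (fun p => F (s, s ^+ 2 + p))).
Proof.
move=> c0 cF Fb; split.
  apply: (@continuous_rint m _ c C (fun z : R * R => F (z.1, z.1 ^+ 2 + z.2))) => //.
    by cts.
  move=> s p p0 /=; apply: le_trans (axial_bound_slice s Fb p0) _.
  rewrite ler_wpM2r ?expR_ge0 // ler_piMr ?(axial_bound_ge0 Fb) //.
  by rewrite -expR0 ler_expR oppr_le0 mulr_ge0 ?sqr_ge0 // ltW.
move=> s; rewrite mulrAC; apply: rint_le => //; last exact: axial_bound_slice.
by cts.
Qed.

Lemma integrable_axial m c C (F : R * R -> R) : 0 < c -> continuous F -> axial_bound c C F ->
  mu.-integrable setT (EFin \o (fun s : R => rint m (fun p => F (s, s ^+ 2 + p)))).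
Proof.
move=> c0 cF Fb; have [? ?] := axial_slice_gauss m c0 cF Fb.
exact: integrable_bound c0 _ _.
Qed.

Lemma rintS_lint m h : rint m.+1 h = lint m (fun z => h z.2).
Proof. by []. Qed.

Lemma exp_axial c C h : exp_bound c C h -> axial_bound c C (fun z => h z.2).
Proof. by move=> hb s q sq /=; apply: hb; apply: le_trans sq; exact: sqr_ge0. Qed.

(** With [b = 0] it also serves as homogeneity. *)
Lemma rint_linear m (c C a b : R) (h1 h2 : R -> R) : 0 < c -> continuous h1 -> continuous h2 ->
  exp_bound c C h1 -> exp_bound c C h2 ->
  rint m (fun p => a * h1 p + b * h2 p) = a * rint m h1 + b * rint m h2.
Proof.
move=> c0; elim: m C h1 h2 => [//|m IH] C h1 h2 c1 c2 b1 b2.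
have cv (h : R -> R) : continuous h -> continuous (fun z : R * R => h z.2) by move=> ch; cts.
have i1 := integrable_axial m c0 (cv _ c1) (exp_axial b1).
have i2 := integrable_axial m c0 (cv _ c2) (exp_axial b2).
rewrite /= in i1 i2 *.
rewrite -!RintegralZl // -RintegralD //; last 2 first.
- exact: (integrableZl measurableT a i1).
- exact: (integrableZl measurableT b i2).
apply: eq_Rintegral => v _.
apply: (IH (C * expR (- (c * v ^+ 2))) (fun p => h1 (v ^+ 2 + p)) (fun p => h2 (v ^+ 2 + p))).
- by cts.
- by cts.
- exact: (exp_bound_shift (sqr_ge0 v) b1).
- exact: (exp_bound_shift (sqr_ge0 v) b2).
Qed.

Lemma lint_linear m (c C a b : R) (F1 F2 : R * R -> R) : 0 < c -> continuous F1 -> continuous F2 ->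
  axial_bound c C F1 -> axial_bound c C F2 ->
  lint m (fun z => a * F1 z + b * F2 z) = a * lint m F1 + b * lint m F2.
Proof.
move=> c0 c1 c2 b1 b2.
have i1 := integrable_axial m c0 c1 b1.
have i2 := integrable_axial m c0 c2 b2.
rewrite /lint -!RintegralZl // -RintegralD //; last 2 first.
- exact: (integrableZl measurableT a i1).
- exact: (integrableZl measurableT b i2).
apply: eq_Rintegral => s _.
apply: (rint_linear _ _ _ c0) (axial_bound_slice s b1) (axial_bound_slice s b2).
  by cts.
by cts.
Qed.

Lemma lint_le m (c C : R) (F : R * R -> R) : 0 < c -> continuous F -> axial_bound c C F ->
  `|lint m F| <= C * gmass c ^+ m.+1.
Proof.
move=> c0 cF Fb; have [? ?] := axial_slice_gauss m c0 cF Fb.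
by rewrite exprSr mulrA; apply: intR_le.
Qed.

Lemma eq_lint m F1 F2 : (forall s q, s ^+ 2 <= q -> F1 (s, q) = F2 (s, q)) ->
  lint m F1 = lint m F2.
Proof.
move=> E; apply: eq_Rintegral => s _; apply: eq_rint => p p0; apply: E.
by rewrite lerDl.
Qed.

Lemma continuous_lint m (T : pseudoMetricType R) (c C : R) (F : T * (R * R) -> R) :
  0 < c -> continuous F -> (forall x, axial_bound c C (fun z => F (x, z))) ->
  continuous (fun x => lint m (fun z => F (x, z))).
Proof.
move=> c0 cF Fb.
apply: (@continuous_intR R T c (C * gmass c ^+ m)
  (fun z : T * R => rint m (fun p => F (z.1, (z.2, z.2 ^+ 2 + p))))) => // [|x].
  apply: (@continuous_rint m _ c C
    (fun z : (T * R) * R => F (z.1.1, (z.1.2, z.1.2 ^+ 2 + z.2)))) => //.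
    by cts.
  move=> [x s] p p0 /=; apply: le_trans (Fb _ _ _ _) _; first by rewrite lerDl.
  rewrite ler_wpM2l ?(axial_bound_ge0 (Fb x)) // ler_expR lerN2 ler_pM2l //.
  by rewrite lerDr sqr_ge0.
have cFx : continuous (fun z => F (x, z)) by cts.
by have [] := axial_slice_gauss m c0 cFx (Fb x).
Qed.

Lemma rint_scale m (c C l : R) (h : R -> R) : 0 < c -> 0 < l -> continuous h -> exp_bound c C h ->
  rint m h = l ^+ m * rint m (fun p => h (l ^+ 2 * p)).
Proof.
move=> c0 l0; elim: m C h => [|m IH] C h ch hb; first by rewrite /= mulr0 mul1r.
have cv : continuous (fun z : R * R => h z.2) by cts.
have [cs gs] := axial_slice_gauss m c0 cv (exp_axial hb).
rewrite /= in cs gs *.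
rewrite (intR_affine 0 c0 l0 cs gs) exprS -mulrA; congr (_ * _).
have E (v : R) : rint m (fun p => h ((0 + l * v) ^+ 2 + p)) =
    l ^+ m * rint m (fun p => h (l ^+ 2 * (v ^+ 2 + p))).
  rewrite (IH (C * expR (- (c * (l * v) ^+ 2)))).
  - by congr (_ * _); apply: eq_rint => p _; rewrite add0r exprMn mulrDr.
  - by cts.
  - by rewrite add0r; exact: (exp_bound_shift (sqr_ge0 (l * v)) hb).
under eq_Rintegral do rewrite E.
rewrite RintegralZl //.
have l2 : 0 < l ^+ 2 by rewrite exprn_gt0.
have cv' : continuous (fun z : R * R => h (l ^+ 2 * z.2)) by cts.
apply: (@integrable_axial m (c * l ^+ 2) C (fun z : R * R => h (l ^+ 2 * z.2))) => //.
  by rewrite mulr_gt0.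
move=> s q sq /=; rewrite -mulrA; apply: hb.
by apply: mulr_ge0; [exact: ltW|exact: le_trans (sqr_ge0 s) sq].
Qed.

Lemma rint_expN m : rint m (fun p => expR (- p)) = Num.sqrt pi ^+ m.
Proof.
elim: m => [|m IH] /=; first by rewrite oppr0 expR0.
have E (v : R) : rint m (fun p => expR (- (v ^+ 2 + p))) = expR (- v ^+ 2) * Num.sqrt pi ^+ m.
  transitivity (rint m (fun p => expR (- v ^+ 2) * expR (- p) + 0 * expR (- p))).
    by apply: eq_rint => p _; rewrite mul0r addr0 opprD expRD.
  rewrite (@rint_linear m 1 1) ?mul0r ?addr0 ?IH //; try by cts.
  - by move=> p p0; rewrite !mul1r ger0_norm ?expR_ge0.
  - by move=> p p0; rewrite !mul1r ger0_norm ?expR_ge0.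
under eq_Rintegral do rewrite E.
by rewrite RintegralZr ?exprS ?intR_gauss1 //; exact: integrableT_gauss.
Qed.

(** Substitutes in the first coordinate only, along which the translation by [a] takes place;
    [rint_scale] then treats the others. *)
Lemma intR_scale_axial m (c C a b : R) (F : R * R -> R) : 0 < c -> 0 < b ->
  continuous F -> axial_bound c C F ->
  lint m F = b * intR (fun s => rint m (fun p => F (a + b * s, (a + b * s) ^+ 2 + p))).
Proof.
move=> c0 b0 cF Fb; have [? ?] := axial_slice_gauss m c0 cF Fb.
exact: intR_affine c0 b0 _ _.
Qed.

Lemma iint_radial m (h : R -> R) :
  iint (fun v : 'rV[R]_m => h (\sum_(i < m) v ord0 i ^+ 2)) = rint m h.
Proof.
elim: m h => [|m IH] h; first by rewrite /= big_ord0.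
rewrite [LHS]/=; apply: eq_Rintegral => s _.
rewrite -[RHS]/(rint m (fun p => h (s ^+ 2 + p))) -IH; congr iint; apply/funext => v.
rewrite (@big_split_ord _ _ _ 1 m) big_ord1 /=; congr (h (_ + _)).
  by rewrite (@row_mxEl _ 1 1 m) mxE eqxx mulr1n.
by apply: eq_bigr => i _; rewrite (@row_mxEr _ 1 1 m).
Qed.

Lemma iint_axial m (F : R * R -> R) :
  iint (fun y : 'rV[R]_m.+1 => F (y ord0 ord0, \sum_(i < m.+1) y ord0 i ^+ 2)) = lint m F.
Proof.
rewrite [LHS]/=; apply: eq_Rintegral => s _.
rewrite -[RHS]/(rint m (fun p => F (s, s ^+ 2 + p))) -iint_radial; congr iint; apply/funext => v.
have E : row_mx s%:M v ord0 (ord0 : 'I_m.+1) = s.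
  transitivity ((row_mx (s%:M : 'rV[R]_1) v : 'rV_(1 + m)) ord0 (lshift m ord0)); last first.
    by rewrite (@row_mxEl _ 1 1 m) mxE eqxx mulr1n.
  by congr (fun_of_matrix _ _ _); apply/val_inj.
rewrite E; congr (F (_, _)).
rewrite (@big_split_ord _ _ _ 1 m) big_ord1 /=; congr (_ + _).
  by rewrite (@row_mxEl _ 1 1 m) mxE eqxx mulr1n.
by apply: eq_bigr => i _; rewrite (@row_mxEr _ 1 1 m).
Qed.

End RadialIntegrals.

(** * Primitives of decaying functions and differentiation of radial integrals *)

Section Primitive.
Variable R : realType.
Local Notation mu := (@lebesgue_measure R).
Local Notation intR := (Rintegral (@lebesgue_measure R) setT).

Lemma ler_expR_mul (e x : R) : 0 < e -> x <= e^-1 * expR (e * x).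
Proof.
move=> e0; rewrite -ler_pdivrMl ?invr_gt0 // invrK.
by apply: le_trans (expR_ge1Dx _); rewrite lerDr.
Qed.

Lemma primitive_exists (B : R) (h : R -> R) : continuous h ->
  (forall q, `|h q| <= B) -> (forall q, q <= 0 -> `|h q| <= B * expR (- (1 * q ^+ 2))) ->
  exists H : R -> R, forall x : R, is_derive x 1 H (h x).
Proof.
move=> ch hB hN.
have B0 : 0 <= B by apply: le_trans (hB 0).
exists (fun x => Rintegral mu [set` Interval -oo%O (BRight x)] h) => x.
pose u : R := `|x| + 1.
have xu : x < u by have := ler_norm x; rewrite /u; lra.
have u0 : 0 <= u by rewrite addr_ge0.
have ih : mu.-integrable [set` Interval -oo%O (BRight u)] (EFin \o h).
  (* On q <= u this dominates [h]: by the assumed decay if q <= 0, and because q^2 <= u^2 if 0 < q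
     <= u. *)
  pose g (q : R) := B * expR (u ^+ 2) * expR (- (1 * q ^+ 2)).
  have ig : mu.-integrable [set` Interval -oo%O (BRight u)] (EFin \o g).
    apply: (@integrableS _ _ _ mu setT) => //.
    apply: (@integrable_bound R 1 (B * expR (u ^+ 2))) => //; first by rewrite /g; cts.
    by move=> q; rewrite ger0_norm // !mulr_ge0 ?expR_ge0.
  apply: le_integrable ig => //.
    by apply: measurable_funTS; exact: continuous_measurable_EFin.
  move=> q /=; rewrite in_itv /= => qu; rewrite lee_fin.
  rewrite [leRHS]ger0_norm; last by rewrite !mulr_ge0 ?expR_ge0.
  rewrite /g; have [q0|q0] := leP q 0.
    apply: le_trans (hN _ q0) _; rewrite ler_wpM2r ?expR_ge0 // ler_peMr //.
    by rewrite -expR0 ler_expR sqr_ge0.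
  apply: le_trans (hB q) _; rewrite -mulrA -expRD ler_peMr // -[leLHS]expR0 ler_expR.
  rewrite mul1r subr_ge0 ler_sqr ?nnegrE //; exact: ltW.
have [dF F'] := continuous_FTC1 xu ih (ltNyr x) (ch x).
by apply: DeriveDef; rewrite -?derive1E.
Qed.

Lemma is_derive_le_mono (u du : R -> R) : (forall x : R, is_derive x 1 u (du x)) ->
  (forall x, 0 <= du x) -> {homo u : x y / x <= y}.
Proof.
move=> ud d0 x y xy.
have [|c _ E] := @MVT_segment R u du x y xy (fun z _ => ud z).
  by apply: continuous_subspaceT => z; exact: (is_derive_continuous (ud z)).
by rewrite -subr_ge0 E mulr_ge0 // subr_ge0.
Qed.

(** Unlike [exp_bound], this controls negative arguments too, where it may grow: derivatives in [q]
    are taken on the whole line. *)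
Definition full_bound (c C : R) (h : R -> R) := forall q, `|h q| <= C * expR (- (c * q)).

Lemma tail_primitive (c B : R) (h : R -> R) : 0 < c -> continuous h -> exp_bound c B h ->
  exists Phi h' : R -> R, [/\ continuous h', (forall q, 0 <= q -> h' q = h q),
    full_bound c B h', (forall q : R, is_derive q 1 Phi (- h' q)) &
    full_bound c (B / c) Phi].
Proof.
move=> c0 ch hb; have B0 := exp_bound_ge0 hb.
pose pos (q : R) := (q + `|q|) / 2; pose neg (q : R) := (q - `|q|) / 2.
have pos_ge0 q : 0 <= pos q.
  by rewrite /pos; have := ler_norm (- q); rewrite normrN; lra.
pose h' q := h (pos q) * expR (- neg q ^+ 2).
have ch' : continuous h' by rewrite /h' /pos /neg; cts.
have h'E q : 0 <= q -> h' q = h q.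
  move=> q0; rewrite /h' /pos /neg ger0_norm // subrr mul0r expr0n oppr0 expR0 mulr1.
  by congr h; lra.
have hB q : 0 <= q -> `|h q| <= B.
  move=> q0; apply: le_trans (hb _ q0) _; rewrite ler_piMr // -expR0 ler_expR.
  by rewrite oppr_le0 mulr_ge0 // ltW.
have h'N q : q <= 0 -> `|h' q| <= B * expR (- (1 * q ^+ 2)).
  move=> q0; rewrite /h' normrM (ger0_norm (expR_ge0 _)) /neg (ler0_norm q0).
  have -> : (q - - q) / 2 = q by lra.
  by rewrite mul1r ler_wpM2r ?expR_ge0 // hB.
have h'B q : `|h' q| <= B.
  rewrite /h' normrM (ger0_norm (expR_ge0 _)) -[leRHS]mulr1 ler_pM //; first exact: hB.
  by rewrite -expR0 ler_expR oppr_le0 sqr_ge0.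
have h'b : full_bound c B h'.
  move=> q; have [q0|q0] := leP 0 q; first by rewrite h'E //; exact: hb.
  apply: le_trans (h'B q) _; rewrite ler_peMr // -expR0 ler_expR oppr_ge0.
  by rewrite mulr_ge0_le0 // ltW.
have [H dH] := primitive_exists ch' h'B h'N.
pose e (q : R) := B / c * expR (- (c * q)).
have de (q : R) : is_derive q 1 e (- B * expR (- (c * q))).
  by rewrite /e; dv; field; rewrite gt_eqF.
(* [e] is the tail integral of the majorant, so [u] is nondecreasing, [v] is nonincreasing and u <=
   v. Any number between them, such as L = sup u, satisfies |L - H| <= e, and is thus the limit of
   [H] at +oo. *)
pose u q := H q - e q; pose v q := H q + e q.
have mu_ : {homo u : x y / x <= y}.
  apply: (@is_derive_le_mono _ (fun q => h' q - (- B * expR (- (c * q))))).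
  by move=> x; have := h'b x; rewrite ler_norml => /andP[]; lra.
have mv : {homo (fun q => - v q) : x y / x <= y}.
  apply: (@is_derive_le_mono _ (fun q => - (h' q + (- B * expR (- (c * q)))))).
  by move=> x; have := h'b x; rewrite ler_norml => /andP[]; lra.
have e0 q : 0 <= e q by rewrite /e mulr_ge0 ?expR_ge0 ?divr_ge0 // ltW.
have uv q q' : u q <= v q'.
  have [qq|qq] := leP q q'.
    by have := mu_ _ _ qq; have := e0 q'; rewrite /u /v; lra.
  by have := mv _ _ (ltW qq); have := e0 q; rewrite /u /v; lra.
pose L := sup (range u).
have uL q : u q <= L.
  apply: ub_le_sup; last by exists q.
  by exists (v 0) => _ [x _ <-].
have Lv q : L <= v q.
  apply: ge_sup; first by exists (u 0), 0.
  by move=> _ [x _ <-].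
exists (fun q => L - H q), h'; split => //.
  by move=> q; dv; ring.
move=> q; rewrite -/(e q) ler_norml; have := uL q; have := Lv q; rewrite /u /v; lra.
Qed.

Lemma full_exp_bound c C (h : R -> R) q : full_bound c C h ->
  exp_bound c (C * expR (- (c * q))) (fun p => h (q + p)).
Proof. by move=> hb p _; apply: le_trans (hb _) _; rewrite mulrDr opprD expRD mulrA. Qed.

Lemma full_gauss_bound c C (h : R -> R) q : full_bound c C h ->
  gauss_bound c (C * expR (- (c * q))) (fun v => h (q + v ^+ 2)).
Proof. by move=> hb v; apply: le_trans (hb _) _; rewrite mulrDr opprD expRD mulrA. Qed.

Lemma full_bound_ge0 c C (h : R -> R) : full_bound c C h -> 0 <= C.
Proof.
by move=> /(_ 0) /(le_trans (normr_ge0 _)); rewrite pmulr_lge0 ?expR_gt0.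
Qed.

Lemma derive_intR_sqr (c C : R) (g gd : R -> R) : 0 < c -> continuous gd ->
  (forall q : R, is_derive q 1 g (gd q)) -> full_bound c C g -> full_bound c C gd ->
  forall q : R, is_derive q 1 (fun q => intR (fun v => g (q + v ^+ 2)))
    (intR (fun v => gd (q + v ^+ 2))).
Proof.
move=> c0 cgd dg gb gdb q; have C0 := full_bound_ge0 gb.
have cg : continuous g by move=> x; exact: (is_derive_continuous (dg x)).
pose f (x v : R) := g (x + v ^+ 2).
have df (x v : R) : is_derive x 1 (f ^~ v) (gd (x + v ^+ 2)) by rewrite /f; dv; ring.
(* Majorant on (q - 1, q + 1), taken at the left end, where exp(- c x) is largest. *)
pose G (v : R) := C * expR (- (c * (q - 1))) * expR (- (c * v ^+ 2)).
have G0 v : 0 <= G v by rewrite !mulr_ge0 ?expR_ge0.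
have Iq : `]q - 1, q + 1[%classic q by rewrite /= in_itv /=; lra.
have iG : mu.-integrable setT (EFin \o G).
  apply: (@integrable_bound R c (C * expR (- (c * (q - 1))))) => // [|v].
    by rewrite /G; cts.
  by rewrite ger0_norm.
have intf x : `]q - 1, q + 1[%classic x -> mu.-integrable setT (EFin \o f x).
  move=> _; apply: integrable_bound c0 _ (full_gauss_bound x gb).
  by cts.
have der x v : `]q - 1, q + 1[%classic x -> setT v -> derivable (f ^~ v) x 1.
  by move=> _ _; apply: ex_derive.
have dE x v : partial1of2 f x v = gd (x + v ^+ 2) by rewrite partial1of2E derive_val.
have Gub x v : `]q - 1, q + 1[%classic x -> setT v -> `|partial1of2 f x v| <= G v.
  rewrite /= in_itv /= => /andP[qx _] _; rewrite dE.
  apply: le_trans (full_gauss_bound x gdb v) _; rewrite ler_wpM2r ?expR_ge0 //.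
  by rewrite ler_wpM2l // ler_expR lerN2 ler_pM2l // ltW.
apply: DeriveDef.
  exact: (derivable_under_integral measurableT Iq intf der G0 iG Gub).
rewrite -derive1E (differentiation_under_integral measurableT Iq intf der G0 iG Gub).
by apply: eq_Rintegral => v _; rewrite dE.
Qed.

Lemma continuous_rint_shift m (c C : R) (g : R -> R) : 0 < c -> continuous g ->
  full_bound c C g -> continuous (fun q : R => rint m (fun p => g (q + p))).
Proof.
move=> c0 cg gb.
(* The bound on g(q + p) grows as q tends to -oo; the factor exp(c q) makes it uniform in q and is
   divided out in front of the integral. *)
have E : (fun q : R => rint m (fun p => g (q + p))) =
    (fun q : R => expR (- (c * q)) * rint m (fun p => expR (c * q) * g (q + p))).
  apply/funext => q; have cgq : continuous (fun p => g (q + p)) by cts.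
  have := @rint_linear R m c (C * expR (- (c * q))) (expR (c * q)) 0
    (fun p => g (q + p)) (fun p => g (q + p)) c0 cgq cgq
    (full_exp_bound q gb) (full_exp_bound q gb).
  under eq_rint do rewrite mul0r addr0.
  by rewrite mul0r addr0 => ->; rewrite mulrA -expRD addNr expR0 mul1r.
rewrite E => q; apply: ctsM; first by cts.
apply: (@continuous_rint R m _ c C (fun z : R * R => expR (c * z.1) * g (z.1 + z.2))) => //.
  by cts.
move=> x p p0; rewrite /= normrM (ger0_norm (expR_ge0 _)).
apply: le_trans (ler_wpM2l (expR_ge0 _) (gb _)) _.
by rewrite mulrCA -expRD (_ : _ + _ = - (c * p)) //; ring.
Qed.

Lemma full_bound_rint m (c C : R) (g : R -> R) : 0 < c -> continuous g ->
  full_bound c C g -> full_bound c (C * gmass c ^+ m) (fun q => rint m (fun p => g (q + p))).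
Proof.
move=> c0 cg gb q; rewrite mulrAC; apply: rint_le => //; first by cts.
exact: full_exp_bound.
Qed.

Lemma derive_rint m (c C : R) (g gd : R -> R) : 0 < c -> continuous gd ->
  (forall q : R, is_derive q 1 g (gd q)) -> full_bound c C g -> full_bound c C gd ->
  forall q : R, is_derive q 1 (fun q => rint m (fun p => g (q + p)))
    (rint m (fun p => gd (q + p))).
Proof.
move=> c0 cgd dg gb gdb.
have cg : continuous g by move=> x; exact: (is_derive_continuous (dg x)).
elim: m => [|m IH] q; first by rewrite /=; dv; ring.
have sh (f : R -> R) x : rint m.+1 (fun p => f (x + p)) =
    intR (fun v => (fun y => rint m (fun p => f (y + p))) (x + v ^+ 2)).
  by apply: eq_Rintegral => v _; apply: eq_rint => p _; rewrite addrA.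
under eq_fun do rewrite sh.
rewrite sh; apply: (derive_intR_sqr c0 _ IH (full_bound_rint m c0 cg gb)
  (full_bound_rint m c0 cgd gdb)).
exact: continuous_rint_shift gdb.
Qed.

(** A quarter of the rate absorbs 1 + s^2; another quarter absorbs exp(a s) by completing the
    square, at the price a^2 / c; half is left. *)
Lemma growth_gauss (a c : R) : 0 < c -> exists2 K, 0 <= K &
  forall s, (1 + s ^+ 2) * expR (a * s) * expR (- (c * s ^+ 2)) <=
    K * expR (- (c / 2 * s ^+ 2)).
Proof.
move=> c0; exists ((1 + (c / 4)^-1) * expR (a ^+ 2 / c)).
  by rewrite mulr_ge0 ?expR_ge0 // addr_ge0 // invr_ge0 divr_ge0 // ltW.
move=> s; have c4 : 0 < c / 4 by rewrite divr_gt0.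
have h1 : 1 + s ^+ 2 <= (1 + (c / 4)^-1) * expR (c / 4 * s ^+ 2).
  rewrite mulrDl mul1r lerD //; last exact: ler_expR_mul.
  by rewrite -[leLHS]expR0 ler_expR mulr_ge0 ?sqr_ge0 // ltW.
have h2 : a * s - c * s ^+ 2 <= a ^+ 2 / c + - (c / 2 * s ^+ 2) - c / 4 * s ^+ 2.
  suff : 0 <= (a - c / 2 * s) ^+ 2 / c.
    have -> : (a - c / 2 * s) ^+ 2 / c = a ^+ 2 / c - a * s + c / 4 * s ^+ 2.
      by field; rewrite gt_eqF.
    by lra.
  by rewrite divr_ge0 ?sqr_ge0 // ltW.
rewrite -mulrA -expRD; apply: le_trans (ler_pM _ _ h1 (_ : _ <= expR _)) _.
- by rewrite addr_ge0 // sqr_ge0.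
- exact: expR_ge0.
- by rewrite ler_expR; exact: h2.
by rewrite -[leLHS]mulrA -[leRHS]mulrA -!expRD (addrC (c / 4 * _)) subrK.
Qed.

Lemma gauss_bound_growth (a c : R) : 0 < c -> exists2 K, 0 <= K &
  forall (C w : R) (f P : R -> R), gauss_bound c C f ->
    (forall s, `|P s| <= w * (1 + s ^+ 2)) ->
    gauss_bound (c / 2) (C * w * K) (fun s => P s * expR (a * s) * f s).
Proof.
move=> c0; have [K K0 HK] := growth_gauss a c0; exists K => // C w f P fb Pb s.
have C0 : 0 <= C by have := le_trans (normr_ge0 _) (fb 0); rewrite pmulr_lge0 ?expR_gt0.
have w0 : 0 <= w by have := le_trans (normr_ge0 _) (Pb 0); rewrite expr0n addr0 mulr1.
rewrite !normrM (ger0_norm (expR_ge0 _)).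
apply: (@le_trans _ _ (w * (1 + s ^+ 2) * expR (a * s) * (C * expR (- (c * s ^+ 2))))).
  apply: ler_pM (fb s); rewrite ?mulr_ge0 ?expR_ge0 //.
  by rewrite ler_wpM2r ?expR_ge0.
have -> : w * (1 + s ^+ 2) * expR (a * s) * (C * expR (- (c * s ^+ 2))) =
  C * w * ((1 + s ^+ 2) * expR (a * s) * expR (- (c * s ^+ 2))) by ring.
by rewrite -[leRHS]mulrA ler_wpM2l ?mulr_ge0.
Qed.

End Primitive.

(** * Integration by parts and the moment identity behind the heat equation *)

Section MomentIdentity.
Variable R : realType.
Local Notation mu := (@lebesgue_measure R).
Local Notation intR := (Rintegral (@lebesgue_measure R) setT).

Lemma gauss_boundW (c C D : R) f : C <= D -> gauss_bound c C f -> gauss_bound c D f.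
Proof. by move=> CD fb s; apply: le_trans (fb s) _; rewrite ler_wpM2r ?expR_ge0. Qed.

Lemma gauss_boundB (c C D : R) f g : gauss_bound c C f -> gauss_bound c D g ->
  gauss_bound c (C + D) (fun s => f s - g s).
Proof.
by move=> fb gb s; rewrite mulrDl; apply: le_trans (ler_normB _ _) _; rewrite lerD.
Qed.

(** The difference of the two integrands is the derivative of P(s) exp(a s) Phi(q + s^2), whose
    integral over the line vanishes. *)
Lemma intR_by_parts (a c C w q : R) (P Pd Phi g : R -> R) : 0 < c ->
  continuous Pd -> (forall s : R, is_derive s 1 P (Pd s)) ->
  (forall s, `|P s| <= w * (1 + s ^+ 2)) ->
  (forall s, `|Pd s + a * P s| <= w * (1 + s ^+ 2)) ->
  (forall s, `|2 * s * P s| <= w * (1 + s ^+ 2)) ->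
  continuous g -> (forall s : R, is_derive s 1 Phi (- g s)) ->
  full_bound c C g -> full_bound c C Phi ->
  intR (fun s => (Pd s + a * P s) * expR (a * s) * Phi (q + s ^+ 2)) =
  intR (fun s => (2 * s * P s) * expR (a * s) * g (q + s ^+ 2)).
Proof.
move=> c0 cPd dP Pb Pdb sPb cg dPhi gb Phib.
have cP : continuous P by move=> x; exact: (is_derive_continuous (dP x)).
have cPhi : continuous Phi by move=> x; exact: (is_derive_continuous (dPhi x)).
have [K K0 HK] := gauss_bound_growth a c0.
set A := fun s => _ * Phi _; set B := fun s => _ * g _.
pose F s := P s * expR (a * s) * Phi (q + s ^+ 2).
pose D := C * expR (- (c * q)) * w * K.
have Ab : gauss_bound (c / 2) D A by exact: HK _ _ _ _ (full_gauss_bound q Phib) Pdb.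
have Bb : gauss_bound (c / 2) D B by exact: HK _ _ _ _ (full_gauss_bound q gb) sPb.
have Fb : gauss_bound (c / 2) D F by exact: HK _ _ _ _ (full_gauss_bound q Phib) Pb.
have c2 : 0 < c / 2 by rewrite divr_gt0.
have cA : continuous A by rewrite /A; cts.
have cB : continuous B by rewrite /B; cts.
have D0 : 0 <= D.
  by have := le_trans (normr_ge0 _) (Fb 0); rewrite pmulr_lge0 ?expR_gt0.
apply/eqP; rewrite -subr_eq0; apply/eqP.
have iA := integrable_bound c2 cA Ab; have iB := integrable_bound c2 cB Bb.
rewrite -RintegralB //.
apply: (@intR_derive_eq0 R (c / 2) (D + D) F (fun s => A s - B s)) => //.
- move=> s; rewrite /F /A /B; dv; ring.
- by cts.
- by apply: gauss_boundW Fb; lra.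
- exact: gauss_boundB.
Qed.

Lemma mul_expR_half (c p : R) : 0 < c ->
  p * expR (- (c * p)) <= (c / 2)^-1 * expR (- (c / 2 * p)).
Proof.
move=> c0; have c2 : 0 < c / 2 by rewrite divr_gt0.
have -> : - (c * p) = - (c / 2 * p) + - (c / 2 * p) by lra.
rewrite expRD mulrA ler_wpM2r ?expR_ge0 //.
apply: le_trans (ler_wpM2r (expR_ge0 _) (ler_expR_mul p c2)) _.
by rewrite -[leLHS]mulrA -expRD subrr expR0 mulr1.
Qed.

(** Both functions get the same rate and the same constant, the form that [rint_linear] asks for. *)
Lemma exp_bound_mulid (c C : R) h : 0 < c -> exp_bound c C h ->
  exp_bound (c / 2) (C * (1 + (c / 2)^-1)) h /\
  exp_bound (c / 2) (C * (1 + (c / 2)^-1)) (fun p => p * h p).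
Proof.
move=> c0 hb; have C0 := exp_bound_ge0 hb.
have c2 : 0 <= (c / 2)^-1 by rewrite invr_ge0 divr_ge0 // ltW.
split=> p p0.
  apply: le_trans (hb _ p0) _; rewrite -mulrA ler_wpM2l // -[leLHS]mul1r.
  apply: ler_pM; rewrite ?expR_ge0 ?lerDl // ler_expR lerN2 ler_wpM2r //; lra.
rewrite normrM (ger0_norm p0); apply: le_trans (ler_wpM2l p0 (hb _ p0)) _.
rewrite mulrCA -mulrA ler_wpM2l //; apply: le_trans (mul_expR_half _ c0) _.
by rewrite ler_wpM2r ?expR_ge0 // lerDr.
Qed.

Lemma rint_shiftZ m (c C b q : R) (f : R -> R) : 0 < c -> continuous f ->
  full_bound c C f -> rint m (fun p => b * f (q + p)) = b * rint m (fun p => f (q + p)).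
Proof.
move=> c0 cf fb; have cfq : continuous (fun p : R => f (q + p)) by cts.
have := rint_linear m b 0 c0 cfq cfq (full_exp_bound q fb) (full_exp_bound q fb).
by rewrite mul0r addr0 => <-; apply: eq_rint => p _; rewrite mul0r addr0.
Qed.

Lemma derive_rintN m (c C : R) (Phi h : R -> R) : 0 < c -> continuous h ->
  (forall q : R, is_derive q 1 Phi (- h q)) -> full_bound c C h -> full_bound c C Phi ->
  forall y : R, is_derive y 1 (fun q => rint m (fun p => Phi (q + p)))
    (- rint m (fun p => h (y + p))).
Proof.
move=> c0 ch dPhi hb Phib y.
have cNh : continuous (fun y : R => - h y) by cts.
have hNb : full_bound c C (fun y => - h y) by move=> x; rewrite normrN.
apply: dv_eq (derive_rint m c0 cNh dPhi Phib hNb y) _.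
rewrite -mulN1r -(rint_shiftZ m (-1) y c0 ch hb).
by apply: eq_rint => p _; rewrite mulN1r.
Qed.

(* Integration by parts in each of the m variables: [v_j h(q + |v|^2)] is
   [- 1/2 d/dv_j Phi(q + |v|^2)]. *)
Lemma rint_moment m (c C : R) (Phi h : R -> R) : 0 < c -> continuous h ->
  (forall q : R, is_derive q 1 Phi (- h q)) -> full_bound c C h -> full_bound c C Phi ->
  forall q, rint m (fun p => p * h (q + p)) = m%:R / 2 * rint m (fun p => Phi (q + p)).
Proof.
move=> c0 ch dPhi hb Phib.
have cPhi : continuous Phi by move=> x; exact: (is_derive_continuous (dPhi x)).
elim: m => [|m IH] q; first by rewrite /= !mul0r.
pose gh y := rint m (fun p => h (y + p)).
pose gP y := rint m (fun p => Phi (y + p)).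
have c2 : 0 < c / 2 by rewrite divr_gt0.
have ghb : full_bound c (C * gmass c ^+ m) gh by exact: full_bound_rint.
have gPb : full_bound c (C * gmass c ^+ m) gP by exact: full_bound_rint.
have cgh : continuous gh by exact: continuous_rint_shift hb.
have cgP : continuous gP by exact: continuous_rint_shift Phib.
have dgP (y : R) : is_derive y 1 gP (- gh y) by exact: derive_rintN hb Phib y.
(* One coordinate v is split off: in v^2 + p, the induction hypothesis covers the part p. *)
have E v : rint m (fun p => (v ^+ 2 + p) * h (q + (v ^+ 2 + p))) =
    v ^+ 2 * gh (q + v ^+ 2) + m%:R / 2 * gP (q + v ^+ 2).
  rewrite -IH.
  have [b1 b2] := exp_bound_mulid c0 (full_exp_bound (q + v ^+ 2) hb).
  have c1 : continuous (fun p : R => h (q + v ^+ 2 + p)) by cts.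
  have c3 : continuous (fun p : R => p * h (q + v ^+ 2 + p)) by cts.
  have := rint_linear m (v ^+ 2) 1 c2 c1 c3 b1 b2; rewrite mul1r => <-.
  by apply: eq_rint => p _; rewrite mul1r mulrDl addrA.
transitivity (intR (fun v => v ^+ 2 * gh (q + v ^+ 2) + m%:R / 2 * gP (q + v ^+ 2))).
  by apply: eq_Rintegral => v _; rewrite -E.
(* Integration by parts with P(s) = s and a = 0: the coordinate v contributes the missing 1 / 2. *)
have IBP : intR (fun v => gP (q + v ^+ 2)) = intR (fun v => 2 * (v ^+ 2 * gh (q + v ^+ 2))).
  have := @intR_by_parts 0 c (C * gmass c ^+ m) 2 q (fun s => s) (fun=> 1) gP gh c0.
  move=> /(_ _ _ _ _ _ cgh dgP ghb gPb) H.
  transitivity (intR (fun v => (1 + 0 * v) * expR (0 * v) * gP (q + v ^+ 2))).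
    by apply: eq_Rintegral => v _; rewrite !mul0r addr0 expR0 !mul1r.
  rewrite H => [||s|s|s].
  - by apply: eq_Rintegral => v _; rewrite mul0r expR0; ring.
  - by cts.
  - by rewrite ler_norml; apply/andP; have := sqr_ge0 (s - 1); have := sqr_ge0 (s + 1); nra.
  - by rewrite mul0r addr0 normr1; have := sqr_ge0 s; lra.
  - by rewrite ler_norml; apply/andP; have := sqr_ge0 s; lra.
have iv : mu.-integrable setT (EFin \o (fun v => v ^+ 2 * gh (q + v ^+ 2))).
  have [K K0 HK] := gauss_bound_growth 0 c0.
  apply: integrable_bound c2 _ (_ : gauss_bound _ (C * gmass c ^+ m * expR (- (c * q)) * 1 * K) _).
    by cts.
  have {}HK := HK _ 1 _ (fun v => v ^+ 2) (full_gauss_bound q ghb).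
  move=> v; have := HK _ v; rewrite mul0r expR0 mulr1; apply => s.
  by rewrite ger0_norm ?sqr_ge0 //; lra.
have iP : mu.-integrable setT (EFin \o (fun v => gP (q + v ^+ 2))).
  by apply: integrable_bound c0 _ (full_gauss_bound q gPb); cts.
rewrite RintegralD //; last exact: (integrableZl measurableT (m%:R / 2) iP).
rewrite RintegralZl //; move: IBP; rewrite RintegralZl // => IBP.
have -> : intR (fun v => v ^+ 2 * gh (q + v ^+ 2)) = 1 / 2 * intR (fun v => gP (q + v ^+ 2)).
  by rewrite IBP; lra.
have -> : rint m.+1 (fun p => Phi (q + p)) = intR (fun v => gP (q + v ^+ 2)).
  by apply: eq_Rintegral => v _; apply: eq_rint => p _; rewrite addrA.
by rewrite -[m.+1]addn1 natrD; lra.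
Qed.

(* Radial form of the heat equation in dimension m.+1: both sides are
   [m / 2 * a] times the integral of [e^{a s} Phi(|y|^2)], where [Phi' = - h]. *)
Lemma lint_moment m (a c C : R) (h : R -> R) : 0 < c -> continuous h -> exp_bound c C h ->
  a * lint m (fun z => (z.2 - z.1 ^+ 2) * expR (a * z.1) * h z.2) =
  m%:R * lint m (fun z => z.1 * expR (a * z.1) * h z.2) /\
  (a = 0 -> lint m (fun z => z.1 * expR (a * z.1) * h z.2) = 0).
Proof.
move=> c0 ch hb.
have [Phi [h' [ch' h'E h'b dPhi Phib]]] := tail_primitive c0 ch hb.
have cPhi : continuous Phi by move=> x; exact: (is_derive_continuous (dPhi x)).
pose D := C * (1 + c^-1).
have C0 := exp_bound_ge0 hb; have ci0 : 0 < c^-1 by rewrite invr_gt0.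
have hD : full_bound c D h'.
  by move=> q; apply: le_trans (h'b q) _; rewrite ler_wpM2r ?expR_ge0 // /D ler_peMr // lerDl ltW.
have PD : full_bound c D Phi.
  by move=> q; apply: le_trans (Phib q) _; rewrite ler_wpM2r ?expR_ge0 // /D ler_wpM2l // lerDr.
pose gh y := rint m (fun p => h' (y + p)).
pose gP y := rint m (fun p => Phi (y + p)).
have ghb : full_bound c (D * gmass c ^+ m) gh by exact: full_bound_rint.
have gPb : full_bound c (D * gmass c ^+ m) gP by exact: full_bound_rint.
have cgh : continuous gh by exact: continuous_rint_shift hD.
have cgP : continuous gP by exact: continuous_rint_shift PD.
have dgP (y : R) : is_derive y 1 gP (- gh y) by exact: derive_rintN hD PD y.
(* In a slice of fixed s, q - s^2 is the squared norm of the other m coordinates, so [rint_moment]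
   applies. *)
have E1 : lint m (fun z => (z.2 - z.1 ^+ 2) * expR (a * z.1) * h z.2) =
    m%:R / 2 * intR (fun s => expR (a * s) * gP (0 + s ^+ 2)).
  have [K K0 HK] := gauss_bound_growth a c0.
  have iP : mu.-integrable setT (EFin \o (fun s => expR (a * s) * gP (0 + s ^+ 2))).
    have c2 : 0 < c / 2 by rewrite divr_gt0.
    apply: (integrable_bound c2 _ (_ : gauss_bound _ (D * gmass c ^+ m * expR (- (c * 0)) * 1 * K) _)).
      by cts.
    have {}HK := HK _ 1 _ (fun=> 1) (full_gauss_bound 0 gPb).
    move=> v; have := HK _ v; rewrite mul1r; apply => s.
    by rewrite normr1; have := sqr_ge0 s; lra.
  rewrite -RintegralZl //; apply: eq_Rintegral => s _.
  rewrite /gP add0r mulrCA -(rint_moment m c0 ch' dPhi hD PD) /=.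
  transitivity (rint m (fun p => p * (expR (a * s) * h' (s ^+ 2 + p)))).
    apply: eq_rint => p p0; rewrite h'E ?addr_ge0 ?sqr_ge0 //; ring.
  have [b1 b2] := exp_bound_mulid c0 (full_exp_bound (s ^+ 2) hD).
  have ch2 : continuous (fun p : R => p * h' (s ^+ 2 + p)) by cts.
  have c2 : 0 < c / 2 by rewrite divr_gt0.
  have := rint_linear m (expR (a * s)) 0 c2 ch2 ch2 b2 b2.
  rewrite mul0r addr0 => <-; apply: eq_rint => p _; ring.
have E2 : lint m (fun z => z.1 * expR (a * z.1) * h z.2) =
    intR (fun s => s * expR (a * s) * gh (0 + s ^+ 2)).
  apply: eq_Rintegral => s _; rewrite add0r /gh -(rint_shiftZ _ _ _ c0 ch' hD).
  by apply: eq_rint => p p0; rewrite h'E // addr_ge0 // sqr_ge0.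
(* Integration by parts with P = 1 trades the factor [a] for 2 s. *)
have IBP : a * intR (fun s => expR (a * s) * gP (0 + s ^+ 2)) =
    2 * intR (fun s => s * expR (a * s) * gh (0 + s ^+ 2)).
  have [K K0 HK] := gauss_bound_growth a c0.
  have c2 : 0 < c / 2 by rewrite divr_gt0.
  have i1 : mu.-integrable setT (EFin \o (fun s => expR (a * s) * gP (0 + s ^+ 2))).
    apply: (integrable_bound c2 _ (_ : gauss_bound _ (D * gmass c ^+ m * expR (- (c * 0)) * 1 * K) _)).
      by cts.
    have {}HK := HK _ 1 _ (fun=> 1) (full_gauss_bound 0 gPb).
    move=> v; have := HK _ v; rewrite mul1r; apply => s.
    by rewrite normr1; have := sqr_ge0 s; lra.
  have i2 : mu.-integrable setT (EFin \o (fun s => s * expR (a * s) * gh (0 + s ^+ 2))).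
    apply: (integrable_bound c2 _ (HK _ 1 _ (fun s => s) (full_gauss_bound 0 ghb) _)).
      by cts.
    move=> s; rewrite mul1r ler_norml; apply/andP.
    by have := sqr_ge0 (s - 1); have := sqr_ge0 (s + 1); nra.
  rewrite -!RintegralZl //.
  pose w := 2 + `|a|.
  have wE s : w * (1 + s ^+ 2) = 2 + 2 * s ^+ 2 + `|a| * (1 + s ^+ 2) by rewrite /w; ring.
  have a2 s : `|a| <= `|a| * (1 + s ^+ 2) by rewrite ler_peMr // lerDl sqr_ge0.
  have := @intR_by_parts a c (D * gmass c ^+ m) w 0 (fun=> 1) (fun=> 0) gP gh c0.
  move=> /(_ _ _ _ _ _ cgh dgP ghb gPb) H.
  transitivity (intR (fun s => (0 + a * 1) * expR (a * s) * gP (0 + s ^+ 2))).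
    by apply: eq_Rintegral => s _; ring.
  rewrite H => [||s|s|s].
  - by apply: eq_Rintegral => s _; ring.
  - by cts.
  - by rewrite normr1 wE; have := a2 s; have := sqr_ge0 s; have := normr_ge0 a; lra.
  - by rewrite add0r mulr1 wE; have := a2 s; have := sqr_ge0 s; lra.
  - rewrite mulr1 wE ler_norml; apply/andP; have := a2 s; have := normr_ge0 a.
    by have := sqr_ge0 (s - 1); have := sqr_ge0 (s + 1); nra.
rewrite E1 E2; split; first by rewrite mulrCA IBP; lra.
(* When a = 0 and m = 0 the first identity reads 0 = 0, so the vanishing is drawn from [IBP]
   instead. *)
by move=> a0; move: IBP; rewrite {1}a0 mul0r; lra.
Qed.

End MomentIdentity.

(** * Heat evolution of radial data *)

Section ExponentialFamily.
Variable R : realType.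

Lemma near_pair_ball (T U : pseudoMetricType R) (p : T * U) (e : R) : 0 < e ->
  \forall z \near p, ball p.1 e z.1 /\ ball p.2 e z.2.
Proof.
move=> e0; exists (ball p.1 e, ball p.2 e); first by split; exact: nbhsx_ballx.
by move=> z [].
Qed.

(** The inequality 1 + D <= exp D, used at D and at - D, gives D <= exp D - 1 <= D exp D. Hence the
    remainder lies between 0 and D (exp D - 1), and the sign of D decides which side bounds this
    product. *)
Lemma expR_taylor2 (D : R) : `|expR D - 1 - D| <= D ^+ 2 * expR `|D|.
Proof.
have h1 : 0 <= expR D - 1 - D by have := expR_ge1Dx D; lra.
have h2 : expR D - 1 <= D * expR D.
  have : expR D * (1 - D) <= expR D * expR (- D).
    by rewrite ler_wpM2l ?expR_ge0 //; have := expR_ge1Dx (- D).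
  by rewrite -expRD subrr expR0; lra.
have h3 : expR D - 1 - D <= D * (expR D - 1) by lra.
rewrite ger0_norm //; apply: le_trans h3 _; have [D0|D0] := leP 0 D.
  by rewrite expr2 -mulrA ler_wpM2l // (ger0_norm D0).
have : D * (expR D - 1) <= D * D by rewrite ler_nM2l //; lra.
move=> /le_trans; apply; rewrite -expr2 ler_peMr ?sqr_ge0 //.
by rewrite -[leLHS]expR0 ler_expR.
Qed.

Lemma is_derive_quadratic (C eta l x : R) (f : R -> R) : 0 < eta ->
  (forall h, `|h| <= eta -> `|f (x + h) - f x - h * l| <= C * h ^+ 2) ->
  is_derive x 1 f l.
Proof.
move=> eta0 H.
have C0 : 0 <= C.
  have := H eta; rewrite gtr0_norm // => /(_ (lexx _)) /(le_trans (normr_ge0 _)).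
  by rewrite pmulr_lge0 // exprn_gt0.
have L : h^-1 *: (f (h *: 1 + x) - f x) @[h --> (0 : R)^'] --> l.
  apply/cvgrPdist_le => e e0; near=> h.
  have h0 : h != 0 by near: h; exact: nbhs_dnbhs_neq.
  have -> : l - h^-1 *: (f (h *: 1 + x) - f x) = - (h^-1 * (f (x + h) - f x - h * l)).
    rewrite /GRing.scale /= mulr1 (addrC h) !mulrBr mulKf //; ring.
  rewrite normrN normrM normfV; apply: (@le_trans _ _ (`|h|^-1 * (C * h ^+ 2))).
    rewrite ler_wpM2l ?invr_ge0 //; apply: H; near: h; exact: dnbhs0_le.
  have -> : `|h|^-1 * (C * h ^+ 2) = C * `|h|.
    by rewrite -(real_normK (num_real h)) mulrCA expr2 mulKf // normr_eq0.
  apply: (@le_trans _ _ ((C + 1) * `|h|)); first by rewrite ler_wpM2r // lerDl.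
  rewrite -ler_pdivlMl ?ltr_wpDl //; near: h; apply: dnbhs0_le.
  by rewrite mulr_gt0 // invr_gt0 ltr_wpDl.
by apply: DeriveDef; [apply: cvgP L|exact: cvg_lim L].
Unshelve. all: end_near. Qed.

Variables (m : nat) (B : R) (G : R -> R).
Hypothesis cG : continuous G.
Hypothesis GB : forall q, 0 <= q -> `|G q| <= B.

(* Subexponential growth on the range [s ^+ 2 <= q] of the pairs [(y_1, |y|^2)]. *)
Definition slow (P : R * R -> R) := continuous P /\
  forall e, 0 < e -> exists2 C, 0 <= C &
    forall s q, s ^+ 2 <= q -> `|P (s, q)| <= C * expR (e * q).

Lemma slow_cst (c : R) : slow (fun=> c).
Proof.
split; first by cts.
move=> e e0; exists `|c| => // s q sq; rewrite ler_peMr // -[leLHS]expR0 ler_expR.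
by rewrite mulr_ge0 ?(ltW e0) // (le_trans (sqr_ge0 _) sq).
Qed.

Lemma slow_snd : slow (fun z => z.2).
Proof.
split; first by cts.
move=> e e0; exists e^-1 => [|s q sq /=]; first by rewrite invr_ge0 ltW.
by rewrite ger0_norm ?(le_trans (sqr_ge0 _) sq) //; exact: ler_expR_mul.
Qed.

Lemma ler_sqr_1D (s q : R) : s ^+ 2 <= q -> `|s| <= 1 + q.
Proof.
move=> sq; rewrite ler_norml; apply/andP.
by have := sqr_ge0 (s - 1); have := sqr_ge0 (s + 1); nra.
Qed.

Lemma slowD P Q : slow P -> slow Q -> slow (fun z => P z + Q z).
Proof.
move=> [cP hP] [cQ hQ]; split; first by cts.
move=> e e0; have [C C0 HC] := hP e e0; have [D D0 HD] := hQ e e0.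
exists (C + D) => [|s q sq]; first exact: addr_ge0.
by rewrite mulrDl (le_trans (ler_normD _ _)) // lerD // ?HC ?HD.
Qed.

Lemma slowM P Q : slow P -> slow Q -> slow (fun z => P z * Q z).
Proof.
move=> [cP hP] [cQ hQ]; split; first by cts.
move=> e e0; have e2 : 0 < e / 2 by rewrite divr_gt0.
have [C C0 HC] := hP _ e2; have [D D0 HD] := hQ _ e2.
exists (C * D) => [|s q sq]; first exact: mulr_ge0.
rewrite normrM; apply: le_trans (ler_pM _ _ (HC _ _ sq) (HD _ _ sq)) _ => //.
have -> : e * q = e / 2 * q + e / 2 * q by lra.
by rewrite expRD; lra.
Qed.

Lemma slow_fst : slow (fun z => z.1).
Proof.
split; first by cts.
move=> e e0; have [_ /(_ e e0) [C C0 HC]] := slowD (slow_cst 1) slow_snd.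
exists C => // s q sq /=; apply: le_trans (ler_sqr_1D sq) _.
by apply: le_trans (HC s q sq); exact: ler_norm.
Qed.

Definition kern (P : R * R -> R) (b a : R) (z : R * R) : R :=
  P z * expR (a * z.1 - b * z.2) * G z.2.

Definition moment P b a := lint m (kern P b a).

Lemma continuous_kern P b a : slow P -> continuous (kern P b a).
Proof. by case=> cP _; rewrite /kern; cts. Qed.

(** A quarter of [b] pays for a s: completing the square gives a s <= a^2 / b + b s^2 / 4, and s^2
    <= q. *)
Lemma exp_axial_le (a b s q : R) : 0 < b -> s ^+ 2 <= q ->
  expR (a * s - b * q) <= expR (a ^+ 2 / b) * expR (- (3 * b / 4 * q)).
Proof.
move=> b0 sq; rewrite -expRD ler_expR.
have : 0 <= (a - b / 2 * s) ^+ 2 / b by rewrite divr_ge0 ?sqr_ge0 // ltW.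
have -> : (a - b / 2 * s) ^+ 2 / b = a ^+ 2 / b - a * s + b / 4 * s ^+ 2.
  by field; rewrite gt_eqF.
have : b / 4 * s ^+ 2 <= b / 4 * q by rewrite ler_wpM2l // divr_ge0 // ltW.
lra.
Qed.

Lemma B_ge0 : 0 <= B.
Proof. exact: le_trans (normr_ge0 _) (GB (lexx 0)). Qed.

Lemma kern_bound P b a : 0 < b -> slow P ->
  exists2 C, 0 <= C & axial_bound (b / 4) C (kern P b a).
Proof.
move=> b0 [_ hP]; have b2 : 0 < b / 2 by rewrite divr_gt0.
(* Of the remaining rate 3 b / 4, the growth of [P] takes b / 2. *)
have [C C0 HC] := hP _ b2.
exists (C * expR (a ^+ 2 / b) * B) => [|s q sq].
  by rewrite !mulr_ge0 ?expR_ge0 ?B_ge0.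
have q0 := le_trans (sqr_ge0 _) sq.
rewrite /kern /= !normrM (ger0_norm (expR_ge0 _)) -mulrA.
apply: le_trans (ler_pM _ _ (HC _ _ sq)
  (ler_pM _ _ (exp_axial_le a b0 sq) (GB q0))) _; rewrite ?mulr_ge0 ?expR_ge0 //.
have -> : - (b / 4 * q) = b / 2 * q + - (3 * b / 4 * q) by lra.
by rewrite expRD; lra.
Qed.

Lemma axial_boundW c C D F : C <= D -> axial_bound c C F -> axial_bound (R:=R) c D F.
Proof. by move=> CD Fb s q sq; apply: le_trans (Fb s q sq) _; rewrite ler_wpM2r ?expR_ge0. Qed.

Lemma lint_linearW (c C D x y : R) (F1 F2 : R * R -> R) : 0 < c ->
  continuous F1 -> continuous F2 -> axial_bound c C F1 -> axial_bound c D F2 ->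
  lint m (fun z => x * F1 z + y * F2 z) = x * lint m F1 + y * lint m F2.
Proof.
move=> c0 c1 c2 b1 b2; apply: (@lint_linear _ m c (C + D) x y _ _ c0 c1 c2).
  by apply: axial_boundW b1; rewrite lerDl (axial_bound_ge0 b2).
by apply: axial_boundW b2; rewrite lerDr (axial_bound_ge0 b1).
Qed.

(** Moving from (b, a) to (b + x, a + y) multiplies the integrand by exp D with D = y s - x q, and
    the expansion 1 + D + O(D^2) is integrated term by term. All derivatives of moments and their
    joint continuity follow from this one estimate. *)
Lemma moment_expansion P (b a : R) : 0 < b -> slow P ->
  exists C eta, [/\ 0 <= C, 0 < eta & forall x y : R, `|x| + `|y| <= eta ->
    `|moment P (b + x) (a + y) - moment P b a
      - (y * moment (fun z => z.1 * P z) b a - x * moment (fun z => z.2 * P z) b a)|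
    <= C * (`|x| + `|y|) ^+ 2].
Proof.
(* Two factors exp(eta q) will appear, from the growth of [P] and from the remainder; 3 b / 4 - 2
   eta = b / 2 still exceeds the rate b / 4. *)
move=> b0 sP; pose eta : R := b / 8; have eta0 : 0 < eta by rewrite divr_gt0.
have b4 : 0 < b / 4 by rewrite divr_gt0.
(* The weight (1 + q)^2 is there because |y s - x q| <= (|x| + |y|) (1 + q). *)
have sQ : slow (fun z => P z * ((1 + z.2) * (1 + z.2))).
  by apply: slowM => //; apply: slowM; apply: slowD; (exact: slow_cst || exact: slow_snd).
have [_ /(_ _ eta0) [C C0 HC]] := sQ.
pose K : R := C * expR eta * expR (a ^+ 2 / b) * B.
exists (K * gmass (b / 4) ^+ m.+1), eta.
have K0 : 0 <= K by rewrite !mulr_ge0 ?expR_ge0 ?B_ge0.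
split => [||x y xy]; first by rewrite mulr_ge0 // exprn_ge0 // gmass_ge0.
  by [].
pose d : R := `|x| + `|y|; rewrite -/d.
have s1 : slow (fun z => z.1 * P z) by apply: slowM => //; exact: slow_fst.
have s2 : slow (fun z => z.2 * P z) by apply: slowM => //; exact: slow_snd.
pose Rm z := P z * expR (a * z.1 - b * z.2) * G z.2 *
   (expR (y * z.1 - x * z.2) - 1 - (y * z.1 - x * z.2)).
have cR : continuous Rm by case: sP => cP _; rewrite /Rm; cts.
have Rb : axial_bound (b / 4) (K * d ^+ 2) Rm.
  move=> s q sq; have q0 := le_trans (sqr_ge0 _) sq.
  have d0 : 0 <= d by rewrite addr_ge0.
  have D1 : `|y * s - x * q| <= d * (1 + q).
    apply: le_trans (ler_normB _ _) _; rewrite !normrM (ger0_norm q0) /d mulrDl addrC.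
    apply: lerD; first by rewrite ler_wpM2l // lerDr.
    by rewrite ler_wpM2l // ler_sqr_1D.
  have D2 : `|y * s - x * q| <= eta + eta * q.
    apply: le_trans D1 _.
    have : d * (1 + q) <= eta * (1 + q) by rewrite ler_wpM2r // addr_ge0.
    lra.
  have T : `|expR (y * s - x * q) - 1 - (y * s - x * q)| <=
      d ^+ 2 * ((1 + q) * (1 + q)) * (expR eta * expR (eta * q)).
    apply: le_trans (expR_taylor2 _) _; rewrite -expRD.
    apply: ler_pM; rewrite ?sqr_ge0 ?expR_ge0 ?ler_expR //.
    rewrite -(real_normK (num_real (y * s - x * q))).
    have -> : d ^+ 2 * ((1 + q) * (1 + q)) = (d * (1 + q)) ^+ 2 by ring.
    by rewrite ler_sqr ?nnegrE // mulr_ge0 // addr_ge0.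
  have {}HC := HC s q sq.
  have q1 : 0 <= (1 + q) * (1 + q) by rewrite mulr_ge0 // addr_ge0.
  rewrite normrM /= (ger0_norm q1) in HC.
  rewrite /Rm /= !normrM (ger0_norm (expR_ge0 _)).
  pose e1 := expR (a ^+ 2 / b) * expR (- (3 * b / 4 * q)).
  apply: (@le_trans _ _ (`|P (s, q)| * e1 * B *
     (d ^+ 2 * ((1 + q) * (1 + q)) * (expR eta * expR (eta * q))))).
    apply: ler_pM T; rewrite ?mulr_ge0 ?expR_ge0 //.
    apply: ler_pM; rewrite ?mulr_ge0 ?expR_ge0 ?GB //.
    by rewrite ler_wpM2l // exp_axial_le.
  have -> : `|P (s, q)| * e1 * B *
      (d ^+ 2 * ((1 + q) * (1 + q)) * (expR eta * expR (eta * q))) =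
    (`|P (s, q)| * ((1 + q) * (1 + q))) * (e1 * B * d ^+ 2 * expR eta * expR (eta * q)) by ring.
  apply: (@le_trans _ _ (C * expR (eta * q) *
      (e1 * B * d ^+ 2 * expR eta * expR (eta * q)))).
    by rewrite ler_wpM2r // !mulr_ge0 ?expR_ge0 ?B_ge0 ?sqr_ge0.
  have -> : C * expR (eta * q) * (e1 * B * d ^+ 2 * expR eta * expR (eta * q)) =
     K * d ^+ 2 * (expR (eta * q) * expR (eta * q) * expR (- (3 * b / 4 * q))).
    by rewrite /K /e1; ring.
  apply: ler_wpM2l; first by rewrite mulr_ge0 ?sqr_ge0.
  rewrite -!expRD ler_expR /eta.
  have : 0 <= b * q by rewrite mulr_ge0 // ltW.
  lra.
have [C0' _ kb] := kern_bound a b0 sP.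
have [C1 _ kb1] := kern_bound a b0 s1.
have [C2 _ kb2] := kern_bound a b0 s2.
have ck : continuous (kern P b a) by exact: continuous_kern.
have ck1 : continuous (kern (fun z => z.1 * P z) b a) by exact: continuous_kern.
have ck2 : continuous (kern (fun z => z.2 * P z) b a) by exact: continuous_kern.
pose k1 := kern (fun z => z.1 * P z) b a; pose k2 := kern (fun z => z.2 * P z) b a.
have [C3 c3 b3] : exists2 C3, continuous (fun z => y * k1 z + (- x) * k2 z) &
    axial_bound (b / 4) C3 (fun z => y * k1 z + (- x) * k2 z).
  exists (`|y| * C1 + `|x| * C2); first by cts.
  move=> s q sq; apply: le_trans (ler_normD _ _) _; rewrite (normrM y) (normrM (- x)) normrN mulrDl.
  rewrite -(mulrA `|y|) -(mulrA `|x|).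
  by apply: lerD; apply: ler_wpM2l => //; [exact: kb1|exact: kb2].
have [C4 c4 b4'] : exists2 C4, continuous (fun z => 1 * Rm z + 1 * (y * k1 z + (- x) * k2 z)) &
    axial_bound (b / 4) C4 (fun z => 1 * Rm z + 1 * (y * k1 z + (- x) * k2 z)).
  exists (K * d ^+ 2 + C3); first by cts.
  move=> s q sq; rewrite !mul1r; apply: le_trans (ler_normD _ _) _; rewrite mulrDl.
  by apply: lerD; [exact: Rb|exact: b3].
have -> : moment P (b + x) (a + y) =
    lint m (fun z => 1 * kern P b a z + 1 * (1 * Rm z + 1 * (y * k1 z + (- x) * k2 z))).
  apply: eq_lint => s q _; rewrite /Rm /k1 /k2 /kern /=.
  have -> : (a + y) * s - (b + x) * q = (a * s - b * q) + (y * s - x * q) by ring.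
  by rewrite expRD; ring.
rewrite (lint_linearW _ _ b4 ck c4 kb b4') (lint_linearW _ _ b4 cR c3 Rb b3).
rewrite (lint_linearW _ _ b4 ck1 ck2 kb1 kb2) !mul1r -/(moment P b a).
rewrite -/(moment (fun z => z.1 * P z) b a) -/(moment (fun z => z.2 * P z) b a).
set u1 := moment _ b a; set u2 := moment _ b a; set u3 := moment _ b a.
have -> : u1 + (lint m Rm + (y * u2 + - x * u3)) - u1 - (y * u2 - x * u3) = lint m Rm by ring.
by apply: le_trans (lint_le m b4 cR Rb) _; rewrite mulrAC.
Qed.

(** A line in the (b, a) plane covers both uses: r moves only a, while t, through b = 1 / (4 t),
    moves the point along a = 2 r b. *)
Lemma derive_moment P (b0 b1 a0 a1 t : R) : 0 < b0 + b1 * t -> slow P ->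
  is_derive t 1 (fun s => moment P (b0 + b1 * s) (a0 + a1 * s))
    (a1 * moment (fun z => z.1 * P z) (b0 + b1 * t) (a0 + a1 * t)
     - b1 * moment (fun z => z.2 * P z) (b0 + b1 * t) (a0 + a1 * t)).
Proof.
move=> bt sP; have [C [eta [C0 eta0 H]]] := moment_expansion (a0 + a1 * t) bt sP.
pose n : R := `|b1| + `|a1| + 1.
have n0 : 0 < n by rewrite ltr_wpDl // addr_ge0.
apply: (@is_derive_quadratic (C * n ^+ 2) (eta / n)) => [|h hn]; first exact: divr_gt0.
have hE : `|b1 * h| + `|a1 * h| <= n * `|h|.
  by rewrite !normrM -mulrDl ler_wpM2r // lerDl.
have := H (b1 * h) (a1 * h).
have -> : b0 + b1 * t + b1 * h = b0 + b1 * (t + h) by ring.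
have -> : a0 + a1 * t + a1 * h = a0 + a1 * (t + h) by ring.
set m1 := moment (fun z => z.1 * P z) _ _; set m2 := moment (fun z => z.2 * P z) _ _.
have -> : a1 * h * m1 - b1 * h * m2 = h * (a1 * m1 - b1 * m2) by ring.
have hb : `|b1 * h| + `|a1 * h| <= eta.
  by apply: le_trans hE _; rewrite mulrC -ler_pdivlMr.
move=> /(_ hb) /le_trans; apply.
rewrite -mulrA ler_wpM2l // -(real_normK (num_real h)) -exprMn.
by rewrite ler_sqr ?nnegrE // ?addr_ge0 // mulr_ge0 // ltW.
Qed.

Lemma continuous_moment P (b a : R) : 0 < b -> slow P ->
  continuous_at ((b, a) : R * R) (fun z : R * R => moment P z.1 z.2).
Proof.
move=> b0 sP; have [C [eta [C0 eta0 H]]] := moment_expansion a b0 sP.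
set M1 := moment (fun z => z.1 * P z) b a in H.
set M2 := moment (fun z => z.2 * P z) b a in H.
pose K : R := `|M1| + `|M2| + C * eta + 1.
have K0 : 0 < K by rewrite ltr_wpDl // addr_ge0 // ?addr_ge0 // mulr_ge0 // ltW.
apply/cvgrPdist_le => e e0.
have e1 : 0 < Num.min (eta / 2) (e / K / 2).
  by rewrite lt_min !divr_gt0.
near=> z.
have [z1 z2] : ball b (Num.min (eta / 2) (e / K / 2)) z.1 /\
    ball a (Num.min (eta / 2) (e / K / 2)) z.2.
  by near: z; exact: (@near_pair_ball R R (b, a) _ e1).
move: z1 z2; rewrite /ball /= (distrC b) (distrC a) !lt_min => /andP[x1 x2] /andP[y1 y2].
have := H (z.1 - b) (z.2 - a).
rewrite (addrC b) (addrC a) !subrK.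
set x := z.1 - b in x1 x2 *; set y := z.2 - a in y1 y2 *.
set d : R := `|x| + `|y|.
have d0 : 0 <= d by rewrite addr_ge0.
have d1 : d <= eta by rewrite /d /x /y; lra.
move=> /(_ d1) E.
have d2 : K * d <= e.
  rewrite mulrC -ler_pdivlMr // /d; lra.
rewrite distrC; apply: le_trans d2.
have h1 : `|y * M1 - x * M2| <= d * (`|M1| + `|M2|).
  apply: le_trans (ler_normB _ _) _; rewrite !normrM mulrDr lerD // ler_wpM2r //.
    by rewrite /d lerDr.
  by rewrite /d lerDl.
have h2 : C * d ^+ 2 <= C * eta * d by rewrite expr2 -!mulrA ler_wpM2l // ler_wpM2r.
rewrite -[_ - _](subrK (y * M1 - x * M2)).
apply: le_trans (ler_normD _ _) _.
apply: le_trans (lerD (le_trans E h2) h1) _; rewrite /K; lra.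
Unshelve. all: end_near. Qed.

End ExponentialFamily.

(** * Space and time derivatives of the weighted heat evolution *)

Section HeatEvolution.
Variables (R : realType) (m : nat) (g : R -> R) (B : R).
Local Notation intR := (Rintegral (@lebesgue_measure R) setT).
Let G (q : R) := g (Num.sqrt q).
Hypothesis cG : continuous G.
Hypothesis GB : forall q, 0 <= q -> `|G q| <= B.

Let k : R := m.+1%:R.
Definition heat_const (t : R) : R := (4 * pi * t) `^ (- (m.+1%:R / 2)).

(** The heat integral of the datum with the weight P(y_1, |y|^2), the factor exp(- r^2 / 4 t) being
    pulled out of the kernel; P = 1 gives [psi]. Derivatives in r and t bring in only the weights s
    P and q P, so the family is closed under them. *)
Definition heat_moment (P : R * R -> R) (t r : R) : R :=
  heat_const t * expR (- (r ^+ 2 * (4 * t)^-1)) * moment m G P (4 * t)^-1 (r / (2 * t)).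

Local Notation N := heat_moment.
Local Notation "'x1' P" := (fun z : R * R => z.1 * P z) (at level 10, P at level 9).
Local Notation "'x2' P" := (fun z : R * R => z.2 * P z) (at level 10, P at level 9).

Let eq_moment P (b b' a a' : R) : b = b' -> a = a' ->
  moment m G P b a = moment m G P b' a'.
Proof. by move=> -> ->. Qed.

Lemma pi4_gt0 (t : R) : 0 < t -> 0 < 4 * pi * t.
Proof. by move=> t0; rewrite !mulr_gt0 // pi_gt0. Qed.

Lemma derive_heat_const (t : R) : 0 < t ->
  is_derive t 1 heat_const (- (k * (2 * t)^-1) * heat_const t).
Proof.
move=> t0; have p0 := pi4_gt0 t0.
have d1 : is_derive t 1 (fun s : R => 4 * pi * s) (4 * pi) by dv; ring.
have h : is_derive t 1 heat_const _ := dv_comp d1 (is_derive1_powR (- (k / 2)) p0).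
apply: dv_eq h _; rewrite powRD ?(gt_eqF p0) ?implybT // powR_inv1 ?ltW //.
rewrite -/(heat_const t); move: (heat_const t) (pi : R) (pi_gt0 R) => c p p_gt0.
by field; rewrite (gt_eqF t0) (gt_eqF p_gt0).
Qed.

Lemma derive_heat_moment_r P (t r : R) : 0 < t -> slow P ->
  is_derive r 1 (heat_moment P t) ((2 * t)^-1 * (N (x1 P) t r - r * N P t r)).
Proof.
move=> t0 sP; pose b := (4 * t)^-1.
have b0 : 0 < b + 0 * r by rewrite mul0r addr0 invr_gt0 mulr_gt0.
have dm : is_derive r 1 (fun s => moment m G P b (s / (2 * t)))
    ((2 * t)^-1 * moment m G (x1 P) b (r / (2 * t))).
  have -> : (fun s => moment m G P b (s / (2 * t))) =
      (fun s => moment m G P (b + 0 * s) (0 + (2 * t)^-1 * s)).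
    by apply/funext => s; apply: eq_moment; ring.
  apply: dv_eq (derive_moment m cG GB _ _ b0 sP) _.
  have -> : b + 0 * r = b by ring.
  have -> : 0 + (2 * t)^-1 * r = r / (2 * t) by ring.
  by rewrite mul0r subr0.
have e1 : is_derive r 1 (fun r : R => heat_const t * expR (- (r ^+ 2 * b)))
    (heat_const t * (expR (- (r ^+ 2 * b)) * (- (2 * r * b)))).
  by dv; ring.
apply: dv_eq (dvM e1 dm) _; rewrite /heat_moment -/b.
have -> : 2 * r * b = r * (2 * t)^-1 by rewrite /b; field; rewrite gt_eqF.
move: (_^-1) (heat_const t) (expR _) (moment _ _ _ _ _) (moment _ _ P _ _) => *; ring.
Qed.

Lemma derive_heat_moment_t P (t r : R) : 0 < t -> slow P ->
  is_derive t 1 (fun s => heat_moment P s r)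
    (- (k * (2 * t)^-1) * N P t r +
     (2 * t)^-1 ^+ 2 * (r ^+ 2 * N P t r - 2 * r * N (x1 P) t r + N (x2 P) t r)).
Proof.
move=> t0 sP; pose b := (4 * t)^-1.
have b0 : 0 < b by rewrite invr_gt0 mulr_gt0.
have bE : 2 * r * b = r / (2 * t) by rewrite /b; field; rewrite gt_eqF.
(* In the variable b = 1 / (4 t) both exponents are linear, since r / (2 t) = 2 r b; the chain rule
   then returns to t. *)
pose F (b : R) := expR (- (r ^+ 2 * b)) * moment m G P b (2 * r * b).
have b0' : 0 < 0 + 1 * b by rewrite mul1r add0r.
have dm : is_derive b 1 (fun b => moment m G P b (2 * r * b))
    (2 * r * moment m G (x1 P) b (2 * r * b) - moment m G (x2 P) b (2 * r * b)).
  have -> : (fun b => moment m G P b (2 * r * b)) =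
      (fun b => moment m G P (0 + 1 * b) (0 + 2 * r * b)).
    by apply/funext => s; apply: eq_moment; ring.
  apply: dv_eq (derive_moment m cG GB _ _ b0' sP) _.
  have -> : 0 + 1 * b = b by ring.
  have -> : 0 + 2 * r * b = 2 * r * b by ring.
  by rewrite mul1r.
have dF : is_derive b 1 F (expR (- (r ^+ 2 * b)) *
    (2 * r * moment m G (x1 P) b (2 * r * b) - moment m G (x2 P) b (2 * r * b)
     - r ^+ 2 * moment m G P b (2 * r * b))).
  have e1 : is_derive b 1 (fun b : R => expR (- (r ^+ 2 * b)))
     (expR (- (r ^+ 2 * b)) * (- r ^+ 2)) by dv; ring.
  apply: dv_eq (dvM e1 dm) _.
  move: (expR _) (moment _ _ _ _ _) (moment _ _ (x1 P) _ _) (moment _ _ P _ _) => *; ring.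
have db : is_derive t 1 (fun s : R => (4 * s)^-1) (- (4 / (4 * t) ^+ 2)).
  have d4 : is_derive t 1 (fun s : R => 4 * s) 4 by dv; ring.
  by apply: dv_eq (dvV _ d4) _ => //; rewrite gt_eqF // mulr_gt0.
have E : (fun s => heat_moment P s r) = (fun s => heat_const s * F (4 * s)^-1).
  apply/funext => s; rewrite /heat_moment /F.
  have -> : r / (2 * s) = 2 * r * (4 * s)^-1.
    by rewrite !invfM; move: (s^-1) => i; field.
  by rewrite mulrA.
rewrite E; apply: dv_eq (dvM (derive_heat_const t0) (dv_comp db dF)) _.
rewrite /F -/b bE /heat_moment -/b.
move: (heat_const t) (expR _) (moment _ _ _ _ _) (moment _ _ (x1 P) _ _) (moment _ _ P _ _) => *.
by field; rewrite gt_eqF.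
Qed.

Lemma continuous_heat_moment P (t r : R) : 0 < t -> slow P ->
  continuous_at ((t, r) : R * R) (fun z : R * R => heat_moment P z.1 z.2).
Proof.
move=> t0 sP; have b0 : 0 < (4 * t)^-1 by rewrite invr_gt0 mulr_gt0.
have cc : continuous_at ((t, r) : R * R) (fun z : R * R => heat_const z.1).
  apply: (@cts_comp _ _ _ heat_const fst) => /=; first by cts.
  exact: (is_derive_continuous (derive_heat_const t0)).
have c4 : continuous_at ((t, r) : R * R) (fun z : R * R => (4 * z.1)^-1).
  by apply: ctsV => /=; [rewrite gt_eqF // mulr_gt0|cts].
have c2 : continuous_at ((t, r) : R * R) (fun z : R * R => (2 * z.1)^-1).
  by apply: ctsV => /=; [rewrite gt_eqF // mulr_gt0|cts].
have cm : continuous_at ((t, r) : R * R)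
    (fun z : R * R => moment m G P (4 * z.1)^-1 (z.2 / (2 * z.1))).
  apply: (@cts_comp _ _ _ (fun z : R * R => moment m G P z.1 z.2)
    (fun z : R * R => ((4 * z.1)^-1, z.2 / (2 * z.1)))) => /=; first by cts.
  exact: (@continuous_moment R m B G cG GB P _ (r / (2 * t)) b0 sP).
by rewrite /heat_moment; cts.
Qed.

Definition P1 : R * R -> R := fun=> 1.

Lemma slow1 : slow P1. Proof. exact: slow_cst. Qed.
Lemma slow_x1 P : slow P -> slow (x1 P).
Proof. by move=> sP; apply: slowM => //; exact: slow_fst. Qed.
Lemma slow_x2 P : slow P -> slow (x2 P).
Proof. by move=> sP; apply: slowM => //; exact: slow_snd. Qed.

(** [lint_moment] at a = r / (2 t), with exp(- b q) put into the datum. The first identity becomes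
    the heat equation, the second the vanishing of the radial derivative at r = 0. *)
Lemma heat_moment_identity (t r : R) : 0 < t ->
  r * (2 * t)^-1 * (N (x2 P1) t r - N (x1 (x1 P1)) t r) = m%:R * N (x1 P1) t r /\
  N (x1 P1) t 0 = 0.
Proof.
move=> t0; set b := (4 * t)^-1; have b0 : 0 < b by rewrite invr_gt0 mulr_gt0.
pose h q := expR (- (b * q)) * G q.
have ch : continuous h by rewrite /h; cts.
have hb : exp_bound b B h.
  by move=> q q0; rewrite /h normrM (ger0_norm (expR_ge0 _)) mulrC ler_wpM2r ?expR_ge0 // GB.
have E1 a : moment m G (x1 P1) b a = lint m (fun z => z.1 * expR (a * z.1) * h z.2).
  by apply: eq_lint => s q _; rewrite /kern /h /P1 /= mulr1 expRD; ring.
have E2 a : moment m G (x2 P1) b a - moment m G (x1 (x1 P1)) b a =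
    lint m (fun z => (z.2 - z.1 ^+ 2) * expR (a * z.1) * h z.2).
  have s1 := slow_x2 slow1; have s2 := slow_x1 (slow_x1 slow1).
  have [C1 _ k1] := kern_bound GB a b0 s1; have [C2 _ k2] := kern_bound GB a b0 s2.
  have b4 : 0 < b / 4 by rewrite divr_gt0.
  have := lint_linearW m 1 (-1) b4 (continuous_kern cG s1) (continuous_kern cG s2) k1 k2.
  rewrite mul1r mulN1r => <-.
  by apply: eq_lint => s q _; rewrite /kern /h /P1 /= !mulr1 expRD; ring.
split.
  have [H _] := lint_moment m (r / (2 * t)) b0 ch hb.
  rewrite -E1 -E2 in H; rewrite /heat_moment -/b.
  set c := heat_const t * _; set u := r / _ in H *.
  by rewrite -mulrBr mulrCA H; ring.
have [_ /(_ erefl) H] := lint_moment m 0 b0 ch hb.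
by rewrite /heat_moment -/b mul0r E1 H mulr0.
Qed.

Lemma enorm_sqr n (x : 'rV[R]_n) : enorm x ^+ 2 = \sum_(i < n) x ord0 i ^+ 2.
Proof. by rewrite /enorm sqr_sqrtr // sumr_ge0 // => i _; exact: sqr_ge0. Qed.

Lemma enorm_ge0 n (x : 'rV[R]_n) : 0 <= enorm x.
Proof. exact: sqrtr_ge0. Qed.

Lemma enorm_omega (r : R) (y : 'rV[R]_m.+1) :
  enorm (r *: omega R m.+1 - y) ^+ 2 =
  r ^+ 2 - 2 * r * y ord0 ord0 + \sum_(i < m.+1) y ord0 i ^+ 2.
Proof.
rewrite enorm_sqr !big_ord_recl !mxE /=.
rewrite (eq_bigr (fun i : 'I_m => y ord0 (lift ord0 i) ^+ 2)) => [|i _]; first by ring.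
by rewrite !mxE /= mulr0 sub0r sqrrN.
Qed.

Lemma psi_heat_moment (t r : R) : 0 < t -> psi m.+1 g t r = heat_moment P1 t r.
Proof.
move=> t0; have b0 : 0 < (4 * t)^-1 by rewrite invr_gt0 mulr_gt0.
rewrite /psi /heat_moment -[RHS]mulrA; congr (_ * _).
pose F := kern G P1 (4 * t)^-1 (r / (2 * t)).
have [C _ FC] := kern_bound GB (r / (2 * t)) b0 slow1.
have b4 : 0 < (4 * t)^-1 / 4 by rewrite divr_gt0.
have cF : continuous F by exact: continuous_kern slow1.
have := lint_linearW m (expR (- (r ^+ 2 * (4 * t)^-1))) 0 b4 cF cF FC FC.
rewrite mul0r addr0 => <-; rewrite -iint_axial; congr iint; apply/funext => y.
rewrite enorm_omega /F /kern /P1 /= mul0r addr0 mul1r mulrA -expRD; congr (expR _ * _).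
by field; rewrite gt_eqF.
Qed.

End HeatEvolution.

(** * Radial profiles of class C^{1,2} *)

Section RadialC12.
Variable R : realType.

(** The profile is given for all real r, so that derivatives at r = 0 are two-sided; [rc_r0] is what
    makes Psi t |x| differentiable at the origin. *)
Record radial_C12 (Psi pt pr prr : R -> R -> R) : Prop := RadialC12 {
  rc_dt : forall t r : R, 0 < t -> is_derive t 1 (Psi ^~ r) (pt t r);
  rc_dr : forall t r : R, 0 < t -> is_derive r 1 (Psi t) (pr t r);
  rc_drr : forall t r : R, 0 < t -> is_derive r 1 (pr t) (prr t r);
  rc_r0 : forall t : R, 0 < t -> pr t 0 = 0;
  rc_c : forall t r : R, 0 < t -> continuous_at ((t, r) : R * R) (fun z : R * R => Psi z.1 z.2);
  rc_ct : forall t r : R, 0 < t -> continuous_at ((t, r) : R * R) (fun z : R * R => pt z.1 z.2);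
  rc_cr : forall t r : R, 0 < t -> continuous_at ((t, r) : R * R) (fun z : R * R => pr z.1 z.2);
  rc_crr : forall t r : R, 0 < t -> continuous_at ((t, r) : R * R) (fun z : R * R => prr z.1 z.2) }.

Lemma near_gt0 (t : R) : 0 < t -> \forall s \near t, 0 < s.
Proof. exact: lt_nbhsr. Qed.

Lemma is_derive_near (f h : R -> R) (x l : R) :
  (\forall y \near x, f y = h y) -> is_derive x 1 h l -> is_derive x 1 f l.
Proof.
move=> fh dh; apply: near_eq_is_derive dh.
by apply: filterS fh => y ->.
Qed.

Lemma continuous_at_near (T : topologicalType) (f h : T -> R) (x : T) :
  (\forall y \near x, f y = h y) -> continuous_at x h -> continuous_at x f.
Proof.
move=> fh ch; rewrite /continuous_at (nbhs_singleton fh).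
by apply: cvg_trans ch; apply: near_eq_cvg; apply: filterS fh => y ->.
Qed.

Lemma near_fst_gt0 (T : topologicalType) (t : R) (x : T) : 0 < t ->
  \forall z \near (t, x), 0 < z.1.
Proof.
move=> t0; exists ([set s | 0 < s], setT); last by move=> z [].
by split; [exact: near_gt0|exact: filterT].
Qed.

(** The last identity is the radial heat equation in dimension m + 1, multiplied by r so as to make
    sense at r = 0. *)
Lemma psi_radial_C12 (m : nat) (g : R -> R) (B : R) :
  continuous (fun q => g (Num.sqrt q)) -> (forall r, 0 <= r -> `|g r| <= B) ->
  exists pt pr prr, radial_C12 (psi m.+1 g) pt pr prr /\
    forall t r, 0 < t -> r * (pt t r - prr t r) = m%:R * pr t r.
Proof.
move=> cG gB; have GB q : 0 <= q -> `|g (Num.sqrt q)| <= B by move=> _; apply: gB; exact: sqrtr_ge0.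
pose N P := heat_moment m g P.
pose p1 : R * R -> R := fun z => z.1 * @P1 R z.
pose p11 : R * R -> R := fun z => z.1 * p1 z.
pose p2 : R * R -> R := fun z => z.2 * @P1 R z.
have s0 := @slow1 R; have s1 : slow p1 by exact: slow_x1.
have s11 : slow p11 by exact: slow_x1.
have s2 : slow p2 by exact: slow_x2.
pose pr (t r : R) : R := (2 * t)^-1 * (N p1 t r - r * N (@P1 R) t r).
pose prr (t r : R) : R := (2 * t)^-1 * ((2 * t)^-1 * (N p11 t r - r * N p1 t r)
    - N (@P1 R) t r - r * pr t r).
pose pt (t r : R) : R := - (m.+1%:R * (2 * t)^-1) * N (@P1 R) t r +
     (2 * t)^-1 ^+ 2 * (r ^+ 2 * N (@P1 R) t r - 2 * r * N p1 t r + N p2 t r).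
have dr P (t r : R) : slow P -> 0 < t -> is_derive r 1 (N P t)
    ((2 * t)^-1 * (N (fun z => z.1 * P z) t r - r * N P t r)).
  by move=> sP t0; exact: (derive_heat_moment_r m cG GB _ t0 sP).
have cN P (t r : R) : slow P -> 0 < t -> continuous_at ((t, r) : R * R) (fun z : R * R => N P z.1 z.2).
  by move=> sP t0; exact: (@continuous_heat_moment R m g B cG GB P t r t0 sP).
have c2 (t r : R) : 0 < t -> continuous_at ((t, r) : R * R) (fun z : R * R => (2 * z.1)^-1).
  by move=> t0; apply: ctsV => /=; [rewrite gt_eqF // mulr_gt0|cts].
have cpr (t r : R) : 0 < t -> continuous_at ((t, r) : R * R) (fun z : R * R => pr z.1 z.2).
  move=> t0; have ? := c2 t r t0; have ? := cN _ t r s0 t0; have ? := cN _ t r s1 t0.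
  by rewrite /pr; cts.
exists pt, pr, prr; split; last first.
  move=> t r t0; have [H _] := heat_moment_identity m cG GB r t0.
  rewrite -/p1 -/p11 -/p2 -!/(N _) in H.
  rewrite /pt /prr /pr -[m.+1]addn1 natrD.
  move: H; move: (N p2 t r) (N p11 t r) (N p1 t r) (N (@P1 R) t r) ((2 * t)^-1) (m%:R : R).
  move=> n2 n11 n1 n0 u mr H.
  have -> : r * (- ((mr + 1) * u) * n0 + u ^+ 2 * (r ^+ 2 * n0 - 2 * r * n1 + n2) -
      u * (u * (n11 - r * n1) - n0 - r * (u * (n1 - r * n0)))) =
      u * (r * u * (n2 - n11)) - mr * u * r * n0 by ring.
  by rewrite H; ring.
split=> [t r t0|t r t0|t r t0|t t0|t r t0|t r t0|t r t0|t r t0].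
- apply: is_derive_near (derive_heat_moment_t m cG GB r t0 s0).
  by apply: filterS (near_gt0 t0) => s s0'; exact: (psi_heat_moment m cG GB).
- have -> : psi m.+1 g t = N (@P1 R) t.
    by apply/funext => s; exact: (psi_heat_moment m cG GB).
  exact: dr.
- have d0 := dr _ t r s0 t0; have d1 := dr _ t r s1 t0.
  rewrite {1}/pr; dv; rewrite /prr /pr -/p1 -/p11; ring.
- have [_ H] := heat_moment_identity m cG GB 0 t0.
  by rewrite /pr mul0r subr0 /N H mulr0.
- apply: continuous_at_near (cN _ t r s0 t0).
  by apply: filterS (near_fst_gt0 r t0) => s s0'; exact: (psi_heat_moment m cG GB).
- have ? := c2 t r t0; have ? := cN _ t r s0 t0; have ? := cN _ t r s1 t0.
  by have ? := cN _ t r s2 t0; rewrite /pt; cts.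
- exact: cpr.
- have ? := c2 t r t0; have ? := cN _ t r s0 t0; have ? := cN _ t r s1 t0.
  by have ? := cN _ t r s11 t0; have ? := cpr t r t0; rewrite /prr; cts.
Qed.

End RadialC12.

(** * Continuity of the solution up to the initial time *)

Section InitialTrace.
Variables (R : realType) (m : nat) (g : R -> R) (B : R).
Local Notation intR := (Rintegral (@lebesgue_measure R) setT).
Let G (q : R) := g (Num.sqrt q).
Hypothesis cG : continuous G.
Hypothesis gB : forall r, 0 <= r -> `|g r| <= B.

Let GB q : 0 <= q -> `|G q| <= B.
Proof. by move=> _; apply: gB; exact: sqrtr_ge0. Qed.

(* The kernel after the substitution [y = r omega + l z], with [l = 2 sqrt t]. *)
Definition scaled_kernel (p : (R * R) * (R * R)) : R :=
  expR (- p.2.2) *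
  G ((p.1.2 + p.1.1 * p.2.1) ^+ 2 + p.1.1 ^+ 2 * (p.2.2 - p.2.1 ^+ 2)).

Lemma continuous_scaled_kernel : continuous scaled_kernel.
Proof. by rewrite /scaled_kernel; cts. Qed.

Lemma scaled_kernel_bound p : axial_bound 1 B (fun z => scaled_kernel (p, z)).
Proof.
move=> s q sq; rewrite /scaled_kernel /= normrM (ger0_norm (expR_ge0 _)) mul1r mulrC.
by rewrite ler_wpM2r ?expR_ge0 // GB // addr_ge0 ?sqr_ge0 // mulr_ge0 ?sqr_ge0 // subr_ge0.
Qed.

Lemma psi_scaled (t r : R) : 0 < t -> psi m.+1 g t r =
  (Num.sqrt pi ^+ m.+1)^-1 * lint m (fun z => scaled_kernel ((2 * Num.sqrt t, r), z)).
Proof.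
move=> t0; set l := 2 * Num.sqrt t.
have l0 : 0 < l by rewrite mulr_gt0 // sqrtr_gt0.
have l2 : l ^+ 2 = 4 * t by rewrite /l exprMn sqr_sqrtr ?ltW //; ring.
have b0 : 0 < (4 * t)^-1 by rewrite invr_gt0 mulr_gt0.
rewrite (psi_heat_moment m cG GB r t0) /heat_moment.
set F := kern G (@P1 R) (4 * t)^-1 (r / (2 * t)).
have [C _ FC] := kern_bound GB (r / (2 * t)) b0 (slow1 R).
have b4 : 0 < (4 * t)^-1 / 4 by rewrite divr_gt0.
have cF : continuous F by exact: continuous_kern (slow1 R).
(* With k = m + 1, (4 pi t)^(-k/2) is pi^(-k/2) l^(-k); the Jacobian l^k of the substitution cancels
   the second factor. *)
have cE : heat_const m t = (Num.sqrt pi ^+ m.+1)^-1 * (l ^+ m.+1)^-1.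
  have p4 := ltW (pi4_gt0 t0).
  rewrite /heat_const powRN (mulrC m.+1%:R) powRrM powR12_sqrt // powR_mulrn ?sqrtr_ge0 //.
  have -> : 4 * pi * t = (Num.sqrt pi * l) ^+ 2.
    by rewrite exprMn l2 sqr_sqrtr ?pi_ge0 // mulrA (mulrC pi).
  by rewrite sqrtr_sqr ger0_norm ?exprMn ?invfM // mulr_ge0 ?sqrtr_ge0 // ltW.
have lE : lint m F = l ^+ m.+1 * (expR (r ^+ 2 * (4 * t)^-1) *
    lint m (fun z => scaled_kernel ((l, r), z))).
  rewrite (intR_scale_axial m r b4 l0 cF FC) exprS -mulrA; congr (_ * _).
  have cS : continuous (fun z : R * R => scaled_kernel ((l, r), z)).
    by have cK := continuous_scaled_kernel; cts.
  have iS := integrable_axial m ltr01 cS (scaled_kernel_bound (l, r)).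
  rewrite mulrA -RintegralZl //; apply: eq_Rintegral => s _.
  have cFs : continuous (fun p : R => F (r + l * s, (r + l * s) ^+ 2 + p)) by cts.
  rewrite (rint_scale m b4 l0 cFs (axial_bound_slice (r + l * s) FC)).
  rewrite -[RHS]mulrA; congr (_ * _).
  have cs : continuous (fun p : R => scaled_kernel ((l, r), (s, s ^+ 2 + p))).
    by have cK := continuous_scaled_kernel; cts.
  have bs := axial_bound_slice s (scaled_kernel_bound (l, r)).
  have := rint_linear m (expR (r ^+ 2 * (4 * t)^-1)) 0 ltr01 cs cs bs bs.
  rewrite mul0r addr0 => <-; apply: eq_rint => p p0.
  rewrite mul0r addr0 /F /kern /scaled_kernel /P1 /= mul1r mulrA -expRD l2.
  have -> : s ^+ 2 + p - s ^+ 2 = p by ring.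
  congr (expR _ * _).
  have -> : (r + l * s) ^+ 2 = r ^+ 2 + 2 * r * l * s + 4 * t * s ^+ 2 by rewrite -l2; ring.
  by field; rewrite gt_eqF.
rewrite -[moment _ _ _ _ _]/(lint m F) lE cE.
set L := lint m _; set e := expR _; set e' := expR _.
have ee : e * e' = 1 by rewrite /e /e' -expRD addNr expR0.
have ln : l ^+ m.+1 != 0 by rewrite expf_neq0 // gt_eqF.
set x := _^-1.
have -> : x * (l ^+ m.+1)^-1 * e * (l ^+ m.+1 * (e' * L)) =
   x * ((l ^+ m.+1)^-1 * l ^+ m.+1) * (e * e') * L by ring.
by rewrite mulVf // ee !mulr1.
Qed.

(** The rescaled integral makes sense at l = 0, where its kernel is exp(- |z|^2) g(r), with integral
    pi^(k/2) g(r) for k = m + 1. Since [Num.sqrt] is 0 on negative numbers, the same formula is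
    continuous on the whole plane. *)
Lemma psi_extension : exists V : R * R -> R, [/\ continuous V,
  forall t r, 0 < t -> V (t, r) = psi m.+1 g t r,
  forall r, 0 <= r -> V (0, r) = g r &
  exists M, forall z, `|V z| <= M].
Proof.
pose c : R := (Num.sqrt pi ^+ m.+1)^-1.
pose L (p : R * R) := lint m (fun z => scaled_kernel (p, z)).
have cL : continuous L.
  exact: continuous_lint ltr01 continuous_scaled_kernel scaled_kernel_bound.
have cK := continuous_scaled_kernel.
have spi : Num.sqrt (pi : R) != 0 by rewrite gt_eqF // sqrtr_gt0 pi_gt0.
exists (fun z => c * L (2 * Num.sqrt z.1, z.2)); split.
- by cts.
- by move=> t r t0; rewrite psi_scaled.
- move=> r r0; rewrite /L /= sqrtr0 mulr0.
  have -> : lint m (fun z => scaled_kernel ((0, r), z)) =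
      rint m.+1 (fun p => g r * expR (- p) + 0 * expR (- p)).
    rewrite rintS_lint; apply: eq_lint => s q _; rewrite /scaled_kernel /=.
    by rewrite mul0r addr0 expr0n mul0r addr0 /G sqrtr_sqr ger0_norm // mul0r addr0 mulrC.
  have cE : continuous (fun p : R => expR (- p)) by cts.
  have bE : exp_bound 1 1 (fun p : R => expR (- p)).
    by move=> p p0; rewrite !mul1r ger0_norm ?expR_ge0.
  rewrite (rint_linear _ _ _ ltr01 cE cE bE bE) mul0r addr0 rint_expN /c mulrCA mulVf ?mulr1 //.
  by rewrite expf_neq0.
- exists (`|c| * (B * gmass 1 ^+ m.+1)) => z; rewrite normrM ler_wpM2l //.
  by apply: lint_le; [exact: ltr01|cts|exact: scaled_kernel_bound].
Qed.

End InitialTrace.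

(** * Sums of the largest eigenvalues *)

Section Spectral.
Local Open Scope sesquilinear_scope.
Variables (R : realType) (n : nat).
Local Notation C := (R[i]).
Local Notation toC := (real_complex R).

Lemma sym_unitary_diag (B : 'M[R]_n) : B^T = B ->
  exists2 P : 'M[C]_n, P \is unitarymx &
    exists d : 'rV[R]_n, map_mx toC B = P^t* *m diag_mx (map_mx toC d) *m P.
Proof.
move=> Bsym; set A := map_mx toC B.
have Areal : A \is a mxOver Num.real.
  by apply/mxOverP => i j; rewrite mxE complex_real.
have Asym : A \is symmetricmx.
  by apply/is_hermitianmxP; rewrite expr0 scale1r; apply/matrixP => i j; rewrite !mxE -{1}Bsym mxE.
have Aherm := realsym_hermsym Asym Areal.
have /orthomx_spectralP AE := hermitian_normalmx Aherm.
have dreal := hermitian_spectral_diag_real Aherm.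
exists (spectralmx A); first exact: spectral_unitarymx.
exists (map_mx (@Re R) (spectral_diag A)).
have -> : map_mx toC (map_mx (@Re R) (spectral_diag A)) = spectral_diag A.
  by apply/matrixP => i j; rewrite !mxE RRe_real //; apply/mxOverP.
by rewrite {1}AE invmx_unitary // spectral_unitarymx.
Qed.

Lemma char_poly_unitary_diag (B : 'M[R]_n) (P : 'M[C]_n) (d : 'rV[R]_n) :
  P \is unitarymx -> map_mx toC B = P^t* *m diag_mx (map_mx toC d) *m P ->
  char_poly B = \prod_(i < n) ('X - (d ord0 i)%:P).
Proof.
move=> Pu BE; apply: (map_poly_inj toC); rewrite map_char_poly BE rmorph_prod /=.
set D := diag_mx _; have PP : P^t* *m P = 1%:M.
  by have := mulVmx (unitarymx_unit Pu); rewrite invmx_unitary.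
have E : char_poly_mx (P^t* *m D *m P) =
    map_mx polyC (P^t*) *m char_poly_mx D *m map_mx polyC P.
  rewrite /char_poly_mx mulmxBr mulmxBl !map_mxM; congr (_ - _).
  by rewrite mul_mx_scalar -scalemxAl -map_mxM PP map_mx1 scalemx1.
rewrite /char_poly E !det_mulmx mulrAC -det_mulmx -map_mxM PP map_mx1 det1 mul1r.
rewrite -/(char_poly D) char_poly_trig; last first.
  by apply: diag_mx_is_trig.
by apply: eq_bigr => i _; rewrite !mxE eqxx mulr1n rmorphB /= map_polyX map_polyC.
Qed.

(** For w = x + i y, the cross terms x M y^T and y M x^T are equal by symmetry and enter with
    opposite signs. *)
Lemma hermitian_form_real (M : 'M[R]_n) (w : 'rV[C]_n) : M^T = M ->
  let x := map_mx (@Re R) w in let y := map_mx (@Im R) w in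
  (w *m map_mx toC M *m w^t*) ord0 ord0 =
  toC ((x *m M *m x^T) ord0 ord0 + (y *m M *m y^T) ord0 ord0).
Proof.
move=> Msym x y; set X := map_mx toC x; set Y := map_mx toC y.
have wE : w = X + 'i *: Y.
  by apply/matrixP => i j; rewrite !mxE {1}[w i j]complexE.
have conjR (r : R) : (toC r)^* = toC r by rewrite conj_Creal // complex_real.
have wc : w^t* = X^T - 'i *: Y^T.
  apply/matrixP => i j; rewrite !mxE {1}[w j i]complexE.
  by rewrite rmorphD rmorphM /= conjCi mulNr !conjR.
have cross : (Y *m map_mx toC M *m X^T) ord0 ord0 = (X *m map_mx toC M *m Y^T) ord0 ord0.
  have MT : (map_mx toC M)^T = map_mx toC M by rewrite map_trmx Msym.
  have -> : Y *m map_mx toC M *m X^T = (X *m map_mx toC M *m Y^T)^T.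
    by rewrite !trmx_mul trmxK MT mulmxA.
  by rewrite mxE.
rewrite wc {1}wE !mulmxDl !mulmxDr mulmxN -!scalemxAl mulmxN -!scalemxAr.
have real_form (a : 'rV[R]_n) :
    (map_mx toC a *m map_mx toC M *m (map_mx toC a)^T) ord0 ord0 =
    toC ((a *m M *m a^T) ord0 ord0).
  by rewrite map_trmx -!map_mxM mxE.
rewrite [RHS]rmorphD -[X in _ = X + _]real_form -[X in _ = _ + X]real_form -/X -/Y.
rewrite scalerN scalerA -expr2 sqrCi scaleN1r opprK.
set p := X *m _ *m X^T; set q := X *m _ *m Y^T in cross *.
set r := Y *m _ *m X^T in cross *; set s := Y *m _ *m Y^T.
by clearbody p q r s; rewrite !mxE cross addrA subrK.
Qed.

Definition qform (M : 'M[R]_n) (x : 'rV[R]_n) : R := (x *m M *m x^T) ord0 ord0.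

(* An orthonormal eigenbasis of R[i]^n, split into real and imaginary parts. *)
Lemma sym_spectral_data (B : 'M[R]_n) (v : 'rV[R]_n) : B^T = B -> qform 1%:M v = 1 ->
  exists d c : 'I_n -> R,
    [/\ char_poly B = \prod_(i < n) ('X - (d i)%:P),
       forall i, 0 <= c i, \sum_(i < n) c i = 1,
       \sum_(i < n) d i * c i = qform B v &
       forall i, exists x y : 'rV[R]_n,
         [/\ qform 1%:M x + qform 1%:M y = 1,
           qform B x + qform B y = d i &
           qform (v^T *m v) x + qform (v^T *m v) y = c i]].
Proof.
move=> Bsym v1; have [P Pu [d BE]] := sym_unitary_diag Bsym.
pose V := map_mx toC v; pose y := V *m P^t*.
have PP : P *m P^t* = 1%:M by exact/unitarymxP.
have PP' : P^t* *m P = 1%:M.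
  by have := mulVmx (unitarymx_unit Pu); rewrite invmx_unitary.
have Vc : V^t* = V^T.
  by apply/matrixP => i j; rewrite !mxE conj_Creal // complex_real.
have yc : y^t* = P *m V^T.
  by rewrite /y trmx_mul map_mxM /= trmxCK Vc.
(* Squared moduli of the coordinates of the unit vector [v] in the eigenbasis, hence weights of
   total 1. *)
pose c (i : 'I_n) : R := Re (y ord0 i * (y ord0 i)^*).
have cE i : toC (c i) = y ord0 i * (y ord0 i)^*.
  by rewrite /c RRe_real // ger0_real // mul_conjC_ge0.
have rf (M : 'M[R]_n) : toC (qform M v) = (V *m map_mx toC M *m V^T) ord0 ord0.
  by rewrite /qform /V map_trmx -!map_mxM [in RHS]mxE.
exists (fun i => d ord0 i), c; split.
- exact: char_poly_unitary_diag Pu BE.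
- by move=> i; rewrite -(lecR 0) cE mul_conjC_ge0.
- apply: (@complexI R); rewrite rmorph_sum /= -v1 rf map_mx1 mulmx1.
  have -> : V *m V^T = y *m y^t* by rewrite yc /y mulmxA -(mulmxA V) PP' mulmx1.
  by rewrite mxE; apply: eq_bigr => i _; rewrite cE !mxE.
- apply: (@complexI R); rewrite rmorph_sum /= rf BE.
  have -> : V *m (P^t* *m diag_mx (map_mx toC d) *m P) *m V^T =
      y *m diag_mx (map_mx toC d) *m y^t* by rewrite yc /y !mulmxA.
  rewrite mxE; apply: eq_bigr => i _; rewrite rmorphM /= cE mul_mx_diag !mxE.
  by rewrite mulrA (mulrC (toC _)).
- move=> i; pose u := row i P.
  exists (map_mx (@Re R) u), (map_mx (@Im R) u).
  have F (M : 'M[R]_n) : M^T = M ->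
      toC (qform M (map_mx (@Re R) u) + qform M (map_mx (@Im R) u)) =
      (P *m map_mx toC M *m P^t*) i i.
    move=> Ms; rewrite -(hermitian_form_real u Ms) /u.
    have -> : (row i P)^t* = col i (P^t*).
      by apply/matrixP => a b; rewrite !mxE.
    rewrite -row_mul [LHS]mxE [RHS]mxE; apply: eq_bigr => a _; congr (_ * _).
      by rewrite [LHS]mxE.
    by rewrite [LHS]mxE.
  split; apply: (@complexI R); rewrite F.
  - by rewrite map_mx1 mulmx1 PP mxE eqxx.
  - by rewrite trmx1.
  - by rewrite BE !mulmxA PP mul1mx -mulmxA PP mulmx1 mxE eqxx mulr1n mxE.
  - by [].
  - rewrite map_mxM -map_trmx -/V.
    have -> : P *m (V^T *m V) *m P^t* = y^t* *m y by rewrite yc /y !mulmxA.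
    by rewrite mxE big_ord1 cE !mxE mulrC.
  - by rewrite trmx_mul trmxK.
Qed.

End Spectral.

(** * Bounds on the sum of the k largest eigenvalues *)

Section KyFan.
Variables (R : realType) (n : nat).
Implicit Types (B : 'M[R]_n) (v : 'rV[R]_n).

(** [sorted_eigenvalues] is a choice, but a determined one: the linear factors of a polynomial are
    unique up to order, and only one ordering is sorted. *)
Lemma sorted_eigenvaluesE B (d : 'I_n -> R) :
  char_poly B = \prod_(i < n) ('X - (d i)%:P) ->
  sorted_eigenvalues B = sort <=%R [seq d i | i <- enum 'I_n].
Proof.
move=> Bd; set s := sort _ _.
have ss : is_sorted_spectrum B s.
  split; first by rewrite size_sort size_map size_enum_ord.
    by apply: sort_sorted; exact: le_total.
  rewrite Bd (perm_big [seq d i | i <- enum 'I_n]) /=; last by rewrite perm_sort.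
  by rewrite big_map big_enum.
rewrite /sorted_eigenvalues; case: pselect => [h|]; last by case; exists s.
case: (cid h) => /= s' [_ s'sorted s'B]; case: ss => _ ssorted sB.
have /prod_XsubC_eq perm : \prod_(a <- s') ('X - a%:P) = \prod_(a <- s) ('X - a%:P).
  by rewrite -s'B -sB.
by apply: (@sorted_eq _ <=%R) => //; [exact: le_trans|exact: le_anti].
Qed.

Lemma qform_rank1 v : qform (v^T *m v) v = qform 1%:M v ^+ 2.
Proof.
rewrite /qform mulmx1 !mulmxA -mulmxA mxE big_ord1 expr2.
by congr (_ * _).
Qed.

Variables (k : nat) (B : 'M[R]_n) (v : 'rV[R]_n) (p q : R).
Hypotheses (k0 : (0 < k)%N) (kn : (k <= n)%N) (Bsym : B^T = B) (v1 : qform 1%:M v = 1).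
Hypothesis pq : p <= q.

(** Every eigenvalue is at least p, and the largest is at least the mean of all of them with the
    weights c_i, which is the value of the form [B] at [v], hence at least q. *)
Lemma Pkplus_ge :
  (forall x, p * qform 1%:M x + (q - p) * qform (v^T *m v) x <= qform B x) ->
  q + (k.-1)%:R * p <= Pkplus k B.
Proof.
move=> H; have [d [c [Bd c0 c1 dc dE]]] := sym_spectral_data Bsym v1.
have dp i : p <= d i.
  have [x [y [xy1 <- cE]]] := dE i; have := lerD (H x) (H y); apply: le_trans.
  have : 0 <= (q - p) * c i by rewrite mulr_ge0 // subr_ge0.
  by rewrite -cE mulrDr; have := congr1 ( *%R p) xy1; rewrite mulrDr; lra.
have qdc : q <= \sum_(i < n) d i * c i.
  by rewrite dc; apply: le_trans (H v); rewrite qform_rank1 v1; lra.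
rewrite /Pkplus (sorted_eigenvaluesE Bd).
set s := sort _ _.
have sn : size s = n by rewrite size_sort size_map size_enum_ord.
have sp i : (i < n)%N -> p <= nth 0 s i.
  move=> i_n; have : nth 0 s i \in s by rewrite mem_nth // sn.
  by rewrite mem_sort => /mapP[j _ ->].
have n0 : (0 < n)%N by exact: leq_trans kn.
have dmax i : d i <= nth 0 s n.-1.
  have : d i \in s by rewrite mem_sort map_f // mem_enum.
  move=> /(nthP 0)[j jn <-]; rewrite sn in jn.
  apply: (sorted_leq_nth le_trans lexx 0 (sort_sorted le_total _)).
  - by rewrite inE -/s sn.
  - by rewrite inE -/s sn prednK.
  - by rewrite -ltnS prednK.
have qmax : q <= nth 0 s n.-1.
  apply: le_trans qdc _; rewrite -[leRHS]mulr1 -c1 mulr_sumr.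
  by apply: ler_sum => i _; rewrite ler_wpM2r.
have -> : \sum_(n - k <= i < n) nth 0 s i =
    \sum_(n - k <= i < n.-1) nth 0 s i + nth 0 s n.-1.
  have h : (n - k <= n.-1)%N by lia.
  by have := @big_nat_recr _ _ +%R n.-1 (n - k) (nth 0 s) h; rewrite prednK.
rewrite addrC lerD //.
have -> : (k.-1)%:R * p = \sum_(n - k <= i < n.-1) p.
  by rewrite sumr_const_nat mulr_natl; congr (_ *+ _); lia.
by apply: ler_sum_nat => i /andP[_ i1]; apply: sp; lia.
Qed.

(** Each eigenvalue is at most p + (q - p) c_i, where the weights c_i >= 0 have sum 1; so any k of
    them add up to at most k p + (q - p). *)
Lemma Pkplus_le :
  (forall x, qform B x <= p * qform 1%:M x + (q - p) * qform (v^T *m v) x) ->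
  Pkplus k B <= q + (k.-1)%:R * p.
Proof.
move=> H; have [d [c [Bd c0 c1 _ dE]]] := sym_spectral_data Bsym v1.
have dg i : d i <= p + (q - p) * c i.
  have [x [y [xy1 <- cE]]] := dE i; apply: le_trans (lerD (H x) (H y)) _.
  by rewrite -cE mulrDr; have := congr1 ( *%R p) xy1; rewrite mulrDr; lra.
rewrite /Pkplus (sorted_eigenvaluesE Bd) sort_map.
set t := sort _ _.
have tn : size t = n by rewrite size_sort size_enum_ord.
have i0 : 'I_n by exists 0; exact: leq_trans kn.
have sumT (f : 'I_n -> R) : \sum_(0 <= i < n) f (nth i0 t i) = \sum_(i < n) f i.
  have <- : \sum_(j <- t) f j = \sum_(0 <= i < n) f (nth i0 t i).
    by rewrite (big_nth i0) tn.
  by rewrite (perm_big (enum 'I_n)) /= ?big_enum // perm_sort.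
have -> : \sum_(n - k <= i < n) nth 0 (map d t) i = \sum_(n - k <= i < n) d (nth i0 t i).
  by apply: eq_big_nat => i /andP[_ i_n]; rewrite (nth_map i0) ?tn.
apply: (@le_trans _ _ (\sum_(n - k <= i < n) (p + (q - p) * c (nth i0 t i)))).
  exact: ler_sum_nat.
rewrite big_split /= sumr_const_nat -mulr_sumr subKn // -(mulr_natl p).
have : \sum_(n - k <= i < n) c (nth i0 t i) <= 1.
  have := sumT c; rewrite c1 => <-.
  rewrite [leRHS](@big_cat_nat _ _ _ (n - k)) ?leq_subr //= lerDr.
  by rewrite sumr_ge0.
have qp : 0 <= q - p by rewrite subr_ge0.
move=> /(ler_wpM2l qp).
have -> : k%:R * p = p + (k.-1)%:R * p.
  by rewrite -{1}(prednK k0) -addn1 natrD mulrDl mul1r addrC.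
lra.
Qed.

End KyFan.

(** * Second order calculus *)

Section Calculus.
Variable R : realType.

Lemma is_derive_eps (f : R -> R) (x l : R) :
  (forall e, 0 < e -> \forall h \near (0 : R), `|f (x + h) - f x - h * l| <= e * `|h|) ->
  is_derive x 1 f l.
Proof.
move=> H.
have L : h^-1 *: (f (h *: 1 + x) - f x) @[h --> (0 : R)^'] --> l.
  apply/cvgrPdist_le => e e0; near=> h.
  have h0 : h != 0 by near: h; exact: nbhs_dnbhs_neq.
  have -> : l - h^-1 *: (f (h *: 1 + x) - f x) = - (h^-1 * (f (x + h) - f x - h * l)).
    rewrite /GRing.scale /= mulr1 (addrC h) !mulrBr mulKf //; ring.
  rewrite normrN normrM normfV ler_pdivrMl ?normr_gt0 // [leRHS]mulrC.
  by near: h; apply: nbhs_dnbhs; exact: H.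
by apply: DeriveDef; [apply: cvgP L|exact: cvg_lim L].
Unshelve. all: end_near. Qed.

Lemma is_derive_epsP (f : R -> R) (x l : R) : is_derive x 1 f l ->
  forall e, 0 < e -> \forall h \near (0 : R), `|f (x + h) - f x - h * l| <= e * `|h|.
Proof.
move=> df e e0.
have L : h^-1 *: (f (h *: 1 + x) - f x) @[h --> (0 : R)^'] --> l.
  by case: df => dx <-; exact: dx.
have /cvgrPdist_le /(_ _ e0) := L; rewrite near_withinE; apply: filterS => h Hh.
have [->|h0] := eqVneq h 0; first by rewrite addr0 subrr mul0r subr0 normr0 mulr0.
have := Hh h0.
have -> : l - h^-1 *: (f (h *: 1 + x) - f x) = - (h^-1 * (f (x + h) - f x - h * l)).
  rewrite /GRing.scale /= mulr1 (addrC h) !mulrBr mulKf //; ring.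
by rewrite normrN normrM normfV ler_pdivrMl ?normr_gt0 // [leRHS]mulrC.
Qed.

Lemma MVT_sym (f df : R -> R) (a : R) : (forall x : R, is_derive x 1 f (df x)) ->
  exists2 c, `|c| <= `|a| & f a - f 0 = a * df c.
Proof.
move=> Hf; have cf : continuous f by move=> x; exact: (is_derive_continuous (Hf x)).
have [a0|a0] := leP 0 a.
  have [|c] := @MVT_segment R f df 0 a a0 (fun x _ => Hf x); first exact: continuous_subspaceT.
  rewrite in_itv /= => /andP[c0 ca] ->; exists c; last by rewrite subr0 mulrC.
  by rewrite !ger0_norm // (le_trans c0).
have [|c] := @MVT_segment R f df a 0 (ltW a0) (fun x _ => Hf x); first exact: continuous_subspaceT.
rewrite in_itv /= => /andP[ac c0] E; exists c; first by rewrite !ler0_norm ?lerN2 // ltW.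
by rewrite -opprB E; ring.
Qed.

Lemma near_add0 (x : R) (P : R -> Prop) : (\forall y \near x, P y) ->
  \forall h \near (0 : R), P (x + h).
Proof.
have c : continuous_at (0 : R) (fun h : R => x + h) by cts.
by rewrite /continuous_at addr0 in c; exact: c.
Qed.

Lemma local_max_derive (u : R -> R) (x l : R) : is_derive x 1 u l ->
  (\forall y \near x, u y <= u x) -> l = 0.
Proof.
move=> du umax.
apply/eqP; apply: contraT => l0.
have e0 : 0 < `|l| / 2 by rewrite divr_gt0 // normr_gt0.
have /nbhs_ballP[d /= d0 Hd] : \forall h \near (0 : R),
    u (x + h) <= u x /\ `|u (x + h) - u x - h * l| <= `|l| / 2 * `|h|.
  by apply: filterI; [exact: near_add0 umax|exact: is_derive_epsP].
pose h := Num.sg l * (d / 2).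
have hd : `|h| = d / 2.
  by rewrite normrM normr_sg l0 mul1r gtr0_norm // divr_gt0.
have [|N1 N2] := Hd h.
  by rewrite /ball /= sub0r normrN hd; lra.
move: N2; rewrite hd ler_norml => /andP[N2 _].
have : h * l = d / 2 * `|l| by rewrite /h mulrAC -normrEsg mulrC.
have : 0 < d * `|l| by rewrite mulr_gt0 // normr_gt0.
lra.
Qed.

(** If [l] were positive, [du], which vanishes at [x], would be positive just to the right of it,
    and [u] would increase there. *)
Lemma local_max_derive2 (u du : R -> R) (x l : R) : (forall y : R, is_derive y 1 u (du y)) ->
  is_derive x 1 du l -> (\forall y \near x, u y <= u x) -> l <= 0.
Proof.
move=> Hu Hdu umax; have du0 := local_max_derive (Hu x) umax.
rewrite leNgt; apply/negP => l0.
have e0 : 0 < l / 2 by rewrite divr_gt0.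
have /nbhs_ballP[d /= d0 Hd] : \forall h \near (0 : R),
    u (x + h) <= u x /\ `|du (x + h) - du x - h * l| <= l / 2 * `|h|.
  by apply: filterI; [exact: near_add0 umax|exact: is_derive_epsP].
have cu : continuous u by move=> y; exact: (is_derive_continuous (Hu y)).
have xd : x < x + d / 2 by rewrite ltrDl divr_gt0.
have [|c] := @MVT R u du x (x + d / 2) xd (fun y _ => Hu y); first exact: continuous_subspaceT.
rewrite in_itv /= => /andP[xc cd] E.
have [|N1 _] := Hd (d / 2); first by rewrite /ball /= sub0r normrN gtr0_norm ?divr_gt0 //; lra.
have [|_] := Hd (c - x).
  by rewrite /ball /= sub0r normrN gtr0_norm; lra.
rewrite (addrC x) subrK du0 subr0 (gtr0_norm (_ : 0 < c - x)); last lra.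
rewrite ler_norml => /andP[N2 _].
have : 0 < l / 2 * (c - x) by rewrite mulr_gt0 // subr_gt0.
have dE : x + d / 2 - x = d / 2 by ring.
have : 0 <= - du c * (d / 2) by rewrite mulNr -[X in _ * X]dE -E; lra.
rewrite pmulr_lge0; lra.
Qed.

Lemma is_derive_line n (F : 'rV[R]_n -> R) (x v : 'rV[R]_n) (t l : R) :
  is_derive (x + t *: v) v F l <-> is_derive t 1 (fun s : R => F (x + s *: v)) l.
Proof.
have E : (fun h : R => h^-1 *: ((fun s : R => F (x + s *: v)) (h *: 1 + t) - F (x + t *: v))) =
   (fun h : R => h^-1 *: (F (h *: v + (x + t *: v)) - F (x + t *: v))).
  apply/funext => h; congr (_ *: (F _ - _)).
  by rewrite scalerDl addrCA; congr (_ *: _ + _); rewrite -[RHS]mulr1.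
split=> -[d1 d2]; apply: DeriveDef.
- by move: d1; rewrite /derivable E.
- by rewrite -d2 /derive E.
- by move: d1; rewrite /derivable E.
- by rewrite -d2 /derive E.
Qed.

Lemma add_ebasisE n (x : 'rV[R]_n) (a : R) (k i : 'I_n) :
  (x + a *: ebasis R k) ord0 i = x ord0 i + a * (i == k)%:R.
Proof. by rewrite !mxE. Qed.

Definition C1 n (F : 'rV[R]_n -> R) :=
  (forall x i, derivable F x (ebasis R i)) /\ (forall i, continuous (partial i F)).

Lemma partial_line n (F : 'rV[R]_n -> R) i (x : 'rV[R]_n) (t : R) : C1 F ->
  is_derive t 1 (fun s : R => F (x + s *: ebasis R i)) (partial i F (x + t *: ebasis R i)).
Proof. by move=> [dF _]; apply/is_derive_line; apply: DeriveDef; [exact: dF|]. Qed.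

Lemma rV_ball n (x y : 'rV[R]_n) (d : R) : 0 < d ->
  (forall i, `|x ord0 i - y ord0 i| < d) -> ball x d y.
Proof. by move=> d0 H; split=> // i j; rewrite (ord1 i); exact: H. Qed.

(** The coordinates of the increment are switched on one at a time, with the mean value theorem
    along each axis; the intermediate points stay in the sup norm ball around [y]. *)
Lemma C1_expansion n (F : 'rV[R]_n -> R) (y w : 'rV[R]_n) (d e : R) : C1 F -> 0 < d ->
  (forall z, ball y d z -> forall i, `|partial i F y - partial i F z| <= e) ->
  (forall i, `|w ord0 i| < d) ->
  `|F (y + w) - F y - \sum_(i < n) w ord0 i * partial i F y| <= e * \sum_(i < n) `|w ord0 i|.
Proof.
move=> CF d0 He wd.
pose tr (j : nat) : 'rV[R]_n := \row_i (if (i < j)%N then w ord0 i else 0).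
suff H j : (j <= n)%N -> `|F (y + tr j) - F y - \sum_(i < n | (i < j)%N) w ord0 i * partial i F y|
    <= e * \sum_(i < n | (i < j)%N) `|w ord0 i|.
  have := H n (leqnn n).
  have -> : tr n = w by apply/rowP => i; rewrite mxE ltn_ord.
  have sumn (f : 'I_n -> R) : \sum_(i < n | (i < n)%N) f i = \sum_(i < n) f i.
    by apply: eq_bigl => i; rewrite ltn_ord.
  by rewrite !sumn.
elim: j => [_|j IH jn].
  have -> : tr 0%N = 0 by apply/rowP => i; rewrite !mxE.
  by rewrite addr0 !big_pred0 // subrr subr0 mulr0 normr0.
have {}IH := IH (ltnW jn); pose k := Ordinal jn.
have sumS (f : 'I_n -> R) : \sum_(i < n | (i < j.+1)%N) f i = f k + \sum_(i < n | (i < j)%N) f i.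
  rewrite (bigD1 k) /=; last exact: ltnSn.
  congr (_ + _); apply: eq_bigl => i.
  by rewrite -(inj_eq val_inj) /= ltnS ltn_neqAle andbC.
have trS : tr j.+1 = tr j + w ord0 k *: ebasis R k.
  apply/rowP => i; rewrite add_ebasisE !mxE ltnS leq_eqVlt.
  have [->|ik] := eqVneq i k; first by rewrite /= eqxx ltnn add0r mulr1.
  have -> : (i == j :> nat) = false by apply: contraNF ik => /eqP ij; apply/eqP/val_inj.
  by rewrite mulr0 addr0.
have [c ck E] := @MVT_sym (fun s => F (y + tr j + s *: ebasis R k)) _ (w ord0 k)
  (fun s => partial_line k (y + tr j) s CF).
rewrite scale0r addr0 -addrA -trS in E.
have zb : ball y d (y + tr j + c *: ebasis R k).
  apply: rV_ball => // i; rewrite add_ebasisE !mxE.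
  have -> : forall a b : R, a - (a + b + c * (i == k)%:R) = - (b + c * (i == k)%:R).
    by move=> a b; ring.
  rewrite normrN; have [->|ik] := eqVneq i k.
    by rewrite ltnn add0r mulr1; apply: le_lt_trans ck (wd k).
  by rewrite mulr0 addr0; case: ifP => // _; rewrite normr0.
have {}He := He _ zb k.
rewrite !sumS mulrDr.
have -> : F (y + tr j.+1) - F y - (w ord0 k * partial k F y
      + \sum_(i < n | (i < j)%N) w ord0 i * partial i F y) =
  (F (y + tr j.+1) - F (y + tr j) - w ord0 k * partial k F y) +
  (F (y + tr j) - F y - \sum_(i < n | (i < j)%N) w ord0 i * partial i F y) by ring.
apply: le_trans (ler_normD _ _) (lerD _ IH).
rewrite E -mulrBr normrM mulrC ler_wpM2r // distrC; exact: He.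
Qed.

Lemma C1_line n (F : 'rV[R]_n -> R) (x v : 'rV[R]_n) (t : R) : C1 F ->
  is_derive t 1 (fun s : R => F (x + s *: v))
    (\sum_(i < n) v ord0 i * partial i F (x + t *: v)).
Proof.
move=> CF; apply: is_derive_eps => e e0; set y : 'rV[R]_n := x + t *: v.
pose S := 1 + \sum_(i < n) `|v ord0 i|.
have S0 : 0 < S by rewrite ltr_pwDl // sumr_ge0.
have eS : 0 < e / S by rewrite divr_gt0.
have /nbhs_ballP[d /= d0 Hd] : \forall z \near y, forall i, `|partial i F y - partial i F z| <= e / S.
  apply: (@filter_forall _ _ (fun i z => `|partial i F y - partial i F z| <= e / S) (nbhs y)) => i.
  by have /cvgrPdist_le := CF.2 i y; exact.
have dS : 0 < d / S by rewrite divr_gt0.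
near=> h.
have -> : x + (t + h) *: v = y + h *: v by rewrite scalerDl addrA.
have hd i : `|(h *: v) ord0 i| < d.
  rewrite mxE normrM; apply: (@le_lt_trans _ _ (`|h| * S)).
    rewrite ler_wpM2l // /S (bigD1 i) //= addrCA lerDl addr_ge0 // sumr_ge0 //.
  rewrite -ltr_pdivlMr //; near: h; exact: (@nbhs0_lt _ R^o).
have := C1_expansion CF d0 Hd hd.
have -> : \sum_(i < n) (h *: v) ord0 i * partial i F y = h * \sum_(i < n) v ord0 i * partial i F y.
  by rewrite mulr_sumr; apply: eq_bigr => i _; rewrite mxE mulrA.
move=> /le_trans; apply.
have -> : \sum_(i < n) `|(h *: v) ord0 i| = `|h| * \sum_(i < n) `|v ord0 i|.
  by rewrite mulr_sumr; apply: eq_bigr => i _; rewrite mxE normrM.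
rewrite mulrCA mulrC ler_wpM2r // mulrAC ler_pdivrMr // ler_wpM2l ?ltW //.
by rewrite /S ltrDr.
Unshelve. all: end_near. Qed.

Definition C2 n (F : 'rV[R]_n -> R) := C1 F /\ forall i, C1 (partial i F).

(** The mean value theorem along e_i, then along e_j. The left side is unchanged when (i, s) and (j,
    t) are exchanged, which is what [schwarz] exploits. *)
Lemma double_difference n (F : 'rV[R]_n -> R) (i j : 'I_n) (x : 'rV[R]_n) (s t : R) : C2 F ->
  exists c d : R, [/\ `|c| <= `|s|, `|d| <= `|t| &
    F (x + t *: ebasis R j + s *: ebasis R i) - F (x + s *: ebasis R i)
      - (F (x + t *: ebasis R j) - F x) =
    s * t * partial j (partial i F) (x + c *: ebasis R i + d *: ebasis R j)].
Proof.
move=> [CF CCF].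
pose g (s : R) := F (x + t *: ebasis R j + s *: ebasis R i) - F (x + s *: ebasis R i).
pose dg (s : R) := partial i F (x + t *: ebasis R j + s *: ebasis R i)
  - partial i F (x + s *: ebasis R i).
have Hg (u : R) : is_derive u 1 g (dg u).
  by apply: is_deriveB; exact: partial_line.
have [c cs Ec] := MVT_sym s Hg.
have [d dt Ed] := @MVT_sym (fun u => partial i F (x + c *: ebasis R i + u *: ebasis R j)) _ t
  (fun u => partial_line j (x + c *: ebasis R i) u (CCF i)).
exists c, d; split => //; move: Ec; rewrite /g scale0r !addr0 => ->.
by rewrite -mulrA -Ed scale0r addr0 /dg (addrAC x).
Qed.

Lemma schwarz n (F : 'rV[R]_n -> R) (i j : 'I_n) (x : 'rV[R]_n) : C2 F ->
  partial i (partial j F) x = partial j (partial i F) x.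
Proof.
move=> CF; apply/eqP; rewrite -subr_eq0 -normr_le0; apply/ler_addgt0Pr => e e0.
rewrite add0r; have e2 : 0 < e / 2 by rewrite divr_gt0.
have /nbhs_ballP[d /= d0 Hd] : \forall z \near x,
    `|partial i (partial j F) x - partial i (partial j F) z| <= e / 2 /\
    `|partial j (partial i F) x - partial j (partial i F) z| <= e / 2.
  by apply: filterI; [have /cvgrPdist_le := (CF.2 j).2 i x; exact
    |have /cvgrPdist_le := (CF.2 i).2 j x; exact].
(* Two displacements of size at most d / 3 stay in the ball of radius d even along the same axis. *)
pose h := d / 3; have h0 : 0 < h by rewrite divr_gt0.
have inb (a b : R) (k l : 'I_n) : `|a| <= `|h| -> `|b| <= `|h| ->
    ball x d (x + a *: ebasis R k + b *: ebasis R l).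
  rewrite (gtr0_norm h0) => ah bh; apply: rV_ball => // m; rewrite !add_ebasisE.
  set u := (_ == _)%:R; set w := (_ == _)%:R.
  have u1 : `|u| <= 1 :> R by rewrite /u normr_nat lern1 leq_b1.
  have w1 : `|w| <= 1 :> R by rewrite /w normr_nat lern1 leq_b1.
  have -> : x ord0 m - (x ord0 m + a * u + b * w) = - (a * u + b * w) by ring.
  rewrite normrN; apply: le_lt_trans (ler_normD _ _) _; rewrite !normrM.
  have : `|a| * `|u| <= h * 1 by rewrite ler_pM.
  have : `|b| * `|w| <= h * 1 by rewrite ler_pM.
  by rewrite /h; lra.
have [c [c' [ch c'h E1]]] := double_difference i j x h h CF.
have [a [a' [ah a'h E2]]] := double_difference j i x h h CF.
have E : partial j (partial i F) (x + c *: ebasis R i + c' *: ebasis R j) =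
    partial i (partial j F) (x + a *: ebasis R j + a' *: ebasis R i).
  apply: (mulfI (_ : h * h != 0)); first by rewrite mulf_neq0 ?gt_eqF.
  have swap (p q r s : R) : p - q - (r - s) = p - r - (q - s) by ring.
  by apply: etrans (esym E1) (etrans _ E2); rewrite (addrAC x (h *: ebasis R j)); exact: swap.
have [_ H1] := Hd _ (inb _ _ i j ch c'h); have [H2 _] := Hd _ (inb _ _ j i ah a'h).
have near2 (A B Y Z : R) : `|A - Z| <= e / 2 -> `|B - Y| <= e / 2 -> Y = Z -> `|A - B| <= e.
  move=> AZ BY YZ; have -> : A - B = (A - Z) - (B - Y) by rewrite YZ opprB addrA subrK.
  by apply: le_trans (ler_normB _ _) _; rewrite [leRHS]splitr lerD.
exact: near2 H2 H1 E.
Qed.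

Lemma hessian_sym n (F : 'rV[R]_n -> R) (x : 'rV[R]_n) : C2 F ->
  (hessian F x)^T = hessian F x.
Proof. by move=> CF; apply/matrixP => i j; rewrite !mxE schwarz. Qed.

Lemma C2_line2 n (F : 'rV[R]_n -> R) (x v : 'rV[R]_n) (t : R) : C2 F ->
  is_derive t 1 (fun s : R => \sum_(i < n) v ord0 i * partial i F (x + s *: v))
    (qform (hessian F (x + t *: v)) v).
Proof.
move=> [CF CCF].
have E : qform (hessian F (x + t *: v)) v =
    \sum_(i < n) v ord0 i * \sum_(j < n) v ord0 j * partial j (partial i F) (x + t *: v).
  rewrite /qform mxE; apply: eq_bigr => i _; rewrite [X in _ * X]mxE mulrC mxE.
  by congr (_ * _); apply: eq_bigr => j _; rewrite mxE.
rewrite E.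
have -> : (fun s : R => \sum_(i < n) v ord0 i * partial i F (x + s *: v)) =
    \sum_(i < n) (fun s : R => v ord0 i * partial i F (x + s *: v)).
  by apply/funext => s; rewrite fct_sumE.
apply: is_derive_sum => i; have d := C1_line x v t (CCF i).
by dv; ring.
Qed.

Lemma continuous_pairr n (t : R) : continuous (fun y : 'rV[R]_n => (t, y)).
Proof. by move=> y; apply: (@cvg_pair _ _ _ (nbhs y) (nbhs t) (nbhs y)); [exact: cvg_cst|exact: cvg_id]. Qed.

Lemma C12_C2 n (phi : R -> 'rV[R]_n -> R) (t : R) : C12 phi -> 0 < t -> C2 (phi t).
Proof.
move=> Cphi t0; split; [split|move=> i; split].
- by move=> x i; have [[_ + _] _] := Cphi t x t0; apply.
- move=> i x; have [_ [_ _ c _]] := Cphi t x t0.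
  exact: (continuous_comp (@continuous_pairr n t x) (c i)).
- by move=> x j; have [[_ _ +] _] := Cphi t x t0; apply.
- move=> j x; have [_ [_ _ _ c]] := Cphi t x t0.
  exact: (continuous_comp (@continuous_pairr n t x) (c j i)).
Qed.

(** W - phi is restricted to the time axis and to the lines x + s v, where the one-variable
    conditions at a maximum apply. Exchanging [W] and [phi] covers a minimum. *)
Lemma touching n (W phi : R -> 'rV[R]_n -> R) (t : R) (x : 'rV[R]_n) :
  C12 W -> C12 phi -> 0 < t ->
  (\forall p \near (t, x), W p.1 p.2 - phi p.1 p.2 <= W t x - phi t x) ->
  dt W t x = dt phi t x /\
  forall v, qform (hessian (W t) x) v <= qform (hessian (phi t) x) v.
Proof.
move=> CW Cphi t0 Wmax; split.
  have d (f : R -> 'rV[R]_n -> R) : C12 f -> is_derive t 1 (fun s : R => f s x) (dt f t x).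
    by move=> Cf; have [[df _ _] _] := Cf t x t0; apply: DeriveDef.
  have c : (s, x) @[s --> t] --> (t, x).
    by apply: (@cvg_pair _ _ _ (nbhs t) (nbhs t) (nbhs x)); [exact: cvg_id|exact: cvg_cst].
  apply/eqP; rewrite -subr_eq0; apply/eqP.
  by apply: (local_max_derive (is_deriveB (d _ CW) (d _ Cphi))); exact: (c _ Wmax).
move=> v; rewrite -subr_le0.
have x0 : x + 0 *: v = x by rewrite scale0r addr0.
have CW2 := C12_C2 CW t0; have Cphi2 := C12_C2 Cphi t0.
have c : (t, x + s *: v) @[s --> (0 : R)] --> (t, x).
  apply: (@cvg_pair _ _ _ (nbhs (0 : R)) (nbhs t) (nbhs x)); first exact: cvg_cst.
  rewrite -{2}x0.
  by apply: cvgD; [exact: cvg_cst|apply: cvgZr_tmp; exact: cvg_id].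
apply: (local_max_derive2 (fun s => is_deriveB (C1_line x v s CW2.1) (C1_line x v s Cphi2.1))).
  by rewrite -[in X in X - _]x0 -[in X in _ - X]x0; apply: is_deriveB; exact: C2_line2.
have := c _ Wmax; rewrite !fctE x0; exact.
Qed.

End Calculus.

(** * Radial functions *)

Section EuclideanNorm.
Variables (R : realType) (n : nat).
Implicit Types (x : 'rV[R]_n) (i j : 'I_n).

Lemma continuous_enorm : continuous (@enorm R n).
Proof.
move=> x; apply: (@cts_sqrt _ _ (fun y : 'rV[R]_n => \sum_(i < n) y ord0 i ^+ 2)).
apply: cts_sum => i; apply: (@ctsX _ _ (fun y : 'rV[R]_n => y ord0 i)).
exact: coord_continuous.
Qed.

Lemma coord_le_enorm x i : `|x ord0 i| <= enorm x.
Proof.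
rewrite -sqrtr_sqr ler_wsqrtr // (bigD1 i) //= lerDl sumr_ge0 // => j _.
exact: sqr_ge0.
Qed.

Lemma enorm_eq0 x : (enorm x == 0) = (x == 0).
Proof.
apply/eqP/eqP => [x0|->].
  by apply/rowP => i; apply/eqP; rewrite mxE -normr_le0 -x0 coord_le_enorm.
by rewrite /enorm big1 ?sqrtr0 // => i _; rewrite mxE expr0n.
Qed.

Lemma enorm_add_ebasis x (s : R) i :
  enorm (x + s *: ebasis R i) = Num.sqrt (enorm x ^+ 2 + 2 * s * x ord0 i + s ^+ 2).
Proof.
congr Num.sqrt; rewrite enorm_sqr (bigD1 i) //= [in RHS](bigD1 i) //= add_ebasisE eqxx.
under eq_bigr => j ji do rewrite add_ebasisE (negbTE ji) mulr0 addr0.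
by rewrite mulr1; ring.
Qed.

Lemma is_derive_enorm x i : enorm x != 0 ->
  is_derive (0 : R) 1 (fun s : R => enorm (x + s *: ebasis R i)) (x ord0 i / enorm x).
Proof.
move=> x0.
have -> : (fun s : R => enorm (x + s *: ebasis R i)) =
    (fun s : R => Num.sqrt (enorm x ^+ 2 + 2 * s * x ord0 i + s ^+ 2)).
  by apply/funext => s; exact: enorm_add_ebasis.
have E : enorm x ^+ 2 + 2 * 0 * x ord0 i + 0 ^+ 2 = enorm x ^+ 2.
  by rewrite mulr0 mul0r expr0n !addr0.
apply: dv_eq (dv_sqrt _ (_ : is_derive (0 : R) 1 _ (2 * x ord0 i))) _.
- by rewrite E exprn_gt0 // lt_neqAle eq_sym x0 enorm_ge0.
- by dv; ring.
- by rewrite E sqrtr_sqr ger0_norm ?enorm_ge0 // invfM mulrACA divff // mul1r.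
Qed.

Lemma partial_of_line (F : 'rV[R]_n -> R) x i l :
  is_derive (0 : R) 1 (fun s : R => F (x + s *: ebasis R i)) l ->
  derivable F x (ebasis R i) /\ partial i F x = l.
Proof.
move=> /is_derive_line; rewrite scale0r addr0 => -[d1 d2].
by split.
Qed.

End EuclideanNorm.

Arguments rc_dt {R Psi pt pr prr} _ {t} r _.
Arguments rc_dr {R Psi pt pr prr} _ {t} r _.
Arguments rc_drr {R Psi pt pr prr} _ {t} r _.
Arguments rc_c {R Psi pt pr prr} _ {t} r _.
Arguments rc_ct {R Psi pt pr prr} _ {t} r _.
Arguments rc_cr {R Psi pt pr prr} _ {t} r _.
Arguments rc_crr {R Psi pt pr prr} _ {t} r _.

Section RadialFunctions.
Variable R : realType.
Variables (n : nat) (Psi pt pr prr : R -> R -> R).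
Hypothesis H : radial_C12 Psi pt pr prr.

(** pr / r, continued to r = 0 by its limit: the eigenvalue of the Hessian in the directions
    orthogonal to x. *)
Let q (t r : R) : R := if r == 0 then prr t 0 else pr t r / r.

Lemma near_neq0 (T : topologicalType) (f : T -> R) (x : T) : continuous_at x f ->
  f x != 0 -> \forall y \near x, f y != 0.
Proof. by move=> c; apply: cvgr_neq0. Qed.

Lemma mul_q t r : 0 < t -> r * q t r = pr t r.
Proof.
move=> t0; rewrite /q; have [->|r0] := eqVneq r 0; first by rewrite mul0r (rc_r0 H t0).
by rewrite mulrC divfK.
Qed.

Lemma continuous_q t r : 0 < t -> continuous_at ((t, r) : R * R) (fun z : R * R => q z.1 z.2).
Proof.
move=> t0; have [->|r0] := eqVneq r 0; last first.
  have c := rc_cr H r t0.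
  apply: (@continuous_at_near _ _ _ (fun z : R * R => pr z.1 z.2 * z.2^-1)).
    have : \forall z \near ((t, r) : R * R), z.2 != 0.
      have c2 : continuous_at ((t, r) : R * R) (fun z : R * R => z.2) by cts.
      exact: near_neq0 c2 r0.
    by apply: filterS => z z0; rewrite /q (negbTE z0).
  by apply: ctsM => //; apply: ctsV => //; cts.
rewrite /continuous_at /= /q eqxx; apply/cvgrPdist_le => e e0.
have /cvgrPdist_le /(_ _ e0) := rc_crr H 0 t0.
move=> /nbhs_ballP[d /= d0 Hd].
have [d1 d10 Hd1] : exists2 d1 : R, 0 < d1 & forall s, ball t d1 s -> 0 < s.
  by have /nbhs_ballP[d1 /= d10 Hd1] := near_gt0 t0; exists d1.
pose m := Num.min d d1; have m0 : 0 < m by rewrite lt_min d0.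
exists (ball t m, ball (0 : R) m); first by split; exact: nbhsx_ballx.
move=> [s {}r] [/= b1 b2].
have s0 : 0 < s by apply: Hd1; apply: le_ball b1; rewrite ge_min lexx orbT.
have b1' : ball t d s by apply: le_ball b1; rewrite ge_min lexx.
have b2' : ball (0 : R) d r by apply: le_ball b2; rewrite ge_min lexx.
case: eqVneq => [_|r0].
  by have := Hd (s, 0); apply; split => //=; exact: ballxx.
(* Since [pr s 0 = 0], the quotient pr / r is a value of [prr s] at some c with |c| <= |r|. *)
have [c cr E] := MVT_sym r (fun y => rc_drr H y s0).
rewrite (rc_r0 H s0) subr0 in E; rewrite E mulrC mulKf //.
have := Hd (s, c); apply; split => //=.
by move: b2'; rewrite /ball /= !sub0r !normrN; exact: le_lt_trans.
Qed.

Lemma continuous_radial (h : R -> R -> R) t (x : 'rV[R]_n) :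
  continuous_at ((t, enorm x) : R * R) (fun z : R * R => h z.1 z.2) ->
  continuous_at (t, x) (fun p : R * 'rV[R]_n => h p.1 (enorm p.2)).
Proof.
move=> ch.
apply: (@cts_comp _ _ _ (fun z : R * R => h z.1 z.2) (fun p : R * 'rV[R]_n => (p.1, enorm p.2))) => //.
have c := continuous_enorm (R := R) (n := n); cts.
Qed.

Let W (t : R) (x : 'rV[R]_n) := Psi t (enorm x).

Lemma radial_partial (t : R) (x : 'rV[R]_n) (i : 'I_n) : 0 < t ->
  derivable (W t) x (ebasis R i) /\ partial i (W t) x = q t (enorm x) * x ord0 i.
Proof.
move=> t0; apply: partial_of_line.
have [x0|x0] := eqVneq (enorm x) 0.
  (* The chain rule fails at the origin, but along an axis W is Psi t |s|, with derivative 0 because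
     [pr t 0 = 0]. *)
  have {x0} -> : x = 0 by apply/eqP; rewrite -enorm_eq0 x0.
  rewrite mxE mulr0; apply: is_derive_eps => e e0.
  have E (s : R) : W t (0 + s *: ebasis R i) = Psi t `|s|.
    rewrite /W enorm_add_ebasis (_ : enorm 0 = 0); last by apply/eqP; rewrite enorm_eq0.
    by rewrite mxE mulr0 expr0n !add0r sqrtr_sqr.
  have cp : continuous_at (0 : R) (pr t).
    exact: (is_derive_continuous (rc_drr H 0 t0)).
  have /cvgrPdist_le /(_ _ e0) := cp; rewrite (rc_r0 H t0) => /nbhs_ballP[d /= d0 Hd].
  apply/nbhs_ballP; exists d => //= s bs; rewrite !E add0r normr0 mulr0 subr0.
  have [c cs ->] := MVT_sym `|s| (fun y => rc_dr H y t0).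
  rewrite normrM normr_id mulrC ler_wpM2r //.
  have := Hd c; rewrite sub0r normrN; apply.
  by move: bs; rewrite /ball /= !sub0r !normrN; apply: le_lt_trans; rewrite normr_id in cs.
have d := is_derive_enorm i x0.
have d' : is_derive (enorm (x + 0 *: ebasis R i)) 1 (Psi t) (pr t (enorm x)).
  by rewrite scale0r addr0; apply: (rc_dr H _ t0).
by apply: dv_eq (dv_comp d d') _; rewrite -(mul_q _ t0); field.
Qed.

(** At x = 0 the rank one term vanishes for two reasons: x / |x| is 0 by the convention on division,
    and [prr - q] is 0. *)
Definition radial_hessian t (x : 'rV[R]_n) i j : R := q t (enorm x) * (i == j)%:R +
  (prr t (enorm x) - q t (enorm x)) * ((x ord0 i / enorm x) * (x ord0 j / enorm x)).

Lemma radial_partial2 (t : R) (x : 'rV[R]_n) (i j : 'I_n) : 0 < t ->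
  derivable (partial j (W t)) x (ebasis R i) /\
  partial i (partial j (W t)) x = radial_hessian t x i j.
Proof.
move=> t0; apply: partial_of_line.
have -> : (fun s : R => partial j (W t) (x + s *: ebasis R i)) =
  (fun s : R => q t (enorm (x + s *: ebasis R i)) * (x ord0 j + s * (i == j)%:R)).
  by apply/funext => s; rewrite (radial_partial _ j t0).2 add_ebasisE eq_sym.
have [x0|x0] := eqVneq (enorm x) 0.
  have {x0} -> : x = 0 by apply/eqP; rewrite -enorm_eq0 x0.
  have e00 : enorm (0 : 'rV[R]_n) = 0 by apply/eqP; rewrite enorm_eq0.
  rewrite /radial_hessian !mxE !mul0r mulr0 addr0 e00.
  apply: is_derive_eps => e e0.
  have E (s : R) : enorm (0 + s *: ebasis R i) = `|s|.
    by rewrite enorm_add_ebasis e00 mxE mulr0 expr0n !add0r sqrtr_sqr.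
  have cq : continuous_at (0 : R) (fun s : R => q t `|s|).
    apply: (@cts_comp _ _ _ (fun z : R * R => q z.1 z.2) (fun s : R => (t, `|s|))); first by cts.
    by rewrite normr0; exact: continuous_q.
  have /cvgrPdist_le /(_ _ e0) := cq; apply: filterS => s; rewrite normr0 => Hs.
  rewrite !E !add0r normr0 mul0r mulr0 subr0.
  have -> : q t `|s| * (s * (i == j)%:R) - s * (q t 0 * (i == j)%:R) =
     - (q t 0 - q t `|s|) * s * (i == j)%:R by ring.
  rewrite !normrM normrN -[leRHS]mulr1 ler_pM // ?mulr_ge0 // ?normr_nat ?lern1 ?leq_b1 //.
  exact: ler_wpM2r.
have d := is_derive_enorm i x0.
have d' : is_derive (enorm (x + 0 *: ebasis R i)) 1 (q t)
    ((prr t (enorm x) - q t (enorm x)) / enorm x).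
  rewrite scale0r addr0; set r := enorm x in x0 *.
  apply: (@is_derive_near _ _ (fun r => pr t r * r^-1)).
    by apply: filterS (near_neq0 (@cts_id _ r) x0) => y y0; rewrite /q (negbTE y0).
  have dp := rc_drr H r t0.
  apply: dv_eq (dvM dp (@dvV _ (fun y : R => y) r 1 x0 (dv_id r))) _.
  by rewrite -(mul_q r t0); field.
have dl : is_derive (0 : R) 1 (fun s : R => x ord0 j + s * (i == j)%:R) (i == j)%:R.
  by dv; ring.
apply: dv_eq (dvM (dv_comp d d') dl) _.
by rewrite scale0r addr0 /radial_hessian; field.
Qed.

Lemma continuous_radial_hessian (t : R) (x : 'rV[R]_n) (i j : 'I_n) : 0 < t ->
  continuous_at (t, x) (fun p : R * 'rV[R]_n => radial_hessian p.1 p.2 i j).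
Proof.
move=> t0.
have cq : continuous_at (t, x) (fun p : R * 'rV[R]_n => q p.1 (enorm p.2)).
  by apply: (continuous_radial (h := q)); exact: continuous_q.
have cr : continuous_at (t, x) (fun p : R * 'rV[R]_n => prr p.1 (enorm p.2)).
  by apply: (continuous_radial (h := prr)); exact: (rc_crr H (enorm x) t0).
have cqr : continuous_at (t, x) (fun p : R * 'rV[R]_n => prr p.1 (enorm p.2) - q p.1 (enorm p.2)).
  by apply: ctsD => //; apply: ctsN.
apply: (@ctsD _ _ (fun p : R * 'rV[R]_n => q p.1 (enorm p.2) * (i == j)%:R)
  (fun p : R * 'rV[R]_n => (prr p.1 (enorm p.2) - q p.1 (enorm p.2)) *
  ((p.2 ord0 i / enorm p.2) * (p.2 ord0 j / enorm p.2)))).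
  by apply: ctsM => //; exact: cts_cst.
have [x0|x0] := eqVneq (enorm x) 0; last first.
  have ce : continuous_at (t, x) (fun p : R * 'rV[R]_n => enorm p.2).
    by apply: (@cts_comp _ _ _ (@enorm R n) snd); [exact: cvg_snd|exact: continuous_enorm].
  have cc k : continuous_at (t, x) (fun p : R * 'rV[R]_n => p.2 ord0 k).
    by apply: (@cts_comp _ _ _ (fun y : 'rV[R]_n => y ord0 k) snd);
      [exact: cvg_snd|exact: coord_continuous].
  have ci : continuous_at (t, x) (fun p : R * 'rV[R]_n => (enorm p.2)^-1) by exact: ctsV.
  by apply: ctsM => //; apply: ctsM; apply: ctsM.
(* x / |x| has no limit at the origin, but its coordinates are bounded by 1 and the coefficient
   [prr - q] tends to 0. *)
rewrite /continuous_at /= x0 invr0 !mulr0; apply/cvgrPdist_le => e e0.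
have /cvgrPdist_le /(_ _ e0) := cqr; apply: filterS => -[s y] /=.
rewrite x0 {1}/q eqxx subrr !sub0r !normrN => Hs.
have le1 k : `|y ord0 k / enorm y| <= 1.
  rewrite normrM normfV (ger0_norm (enorm_ge0 y)).
  have [->|y0] := eqVneq (enorm y) 0; first by rewrite invr0 mulr0.
  by rewrite ler_pdivrMr ?mul1r ?coord_le_enorm // lt_neqAle eq_sym y0 enorm_ge0.
rewrite normrM -[leRHS]mulr1 ler_pM // normrM -[leRHS]mulr1.
by apply: ler_pM => //; exact: le1.
Qed.

Lemma radial_dt (t : R) (x : 'rV[R]_n) : 0 < t -> dt W t x = pt t (enorm x).
Proof. by move=> t0; have [_ <-] := rc_dt H (enorm x) t0. Qed.

Lemma C12_radial : C12 W.
Proof.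
move=> t x t0; split; split.
- by have [] := rc_dt H (enorm x) t0.
- by move=> i; exact: (radial_partial x i t0).1.
- by move=> i j; exact: (radial_partial2 x i j t0).1.
- exact: (continuous_radial (rc_c H (enorm x) t0)).
- apply: continuous_at_near (continuous_radial (rc_ct H (enorm x) t0)).
  by apply: filterS (near_fst_gt0 x t0) => -[s y] /= s0; rewrite /joint /= radial_dt.
- move=> i.
  apply: (@continuous_at_near _ _ _ (fun p : R * 'rV[R]_n => q p.1 (enorm p.2) * p.2 ord0 i)).
    by apply: filterS (near_fst_gt0 x t0) => -[s y] /= s0; rewrite /joint /= (radial_partial y i s0).2.
  apply: ctsM; first by apply: (continuous_radial (h := q)); exact: continuous_q.
  by apply: (@cts_comp _ _ _ (fun y : 'rV[R]_n => y ord0 i) snd);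
      [exact: cvg_snd|exact: coord_continuous].
- move=> i j; apply: continuous_at_near (continuous_radial_hessian t0).
  by apply: filterS (near_fst_gt0 x t0) => -[s y] /= s0; rewrite /joint /= (radial_partial2 y i j s0).2.
Qed.

Lemma hessian_radial (t : R) (x : 'rV[R]_n) : (0 < n)%N -> 0 < t -> exists (v : 'rV[R]_n) (p : R),
  [/\ qform 1%:M v = 1, enorm x * p = pr t (enorm x), (enorm x = 0 -> p = prr t 0) &
    hessian (W t) x = p%:M + (prr t (enorm x) - p) *: (v^T *m v)].
Proof.
move=> n0 t0; have [x0|x0] := eqVneq (enorm x) 0.
  (* At the origin the Hessian is a multiple of the identity, so any unit vector serves as [v]. *)
  pose i0 := Ordinal n0; exists (ebasis R i0), (q t 0); split.
  - by rewrite /qform mulmx1 mxE (bigD1 i0) //= big1 ?addr0 => [|j ji];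
      rewrite !mxE ?eqxx ?(negbTE ji) ?mulr1 ?mulr0.
  - by rewrite x0 mul_q.
  - by rewrite /q eqxx.
  - apply/matrixP => i j; rewrite [LHS]mxE (radial_partial2 x i j t0).2 /radial_hessian x0.
    have -> : prr t 0 - q t 0 = 0 by rewrite /q eqxx subrr.
    by rewrite scale0r addr0 mul0r addr0 mxE mulr_natr.
exists ((enorm x)^-1 *: x), (q t (enorm x)); split.
- rewrite /qform mulmx1 mxE.
  under eq_bigr => i _ do rewrite !mxE -expr2 exprMn.
  by rewrite -mulr_sumr -enorm_sqr exprVn mulVf // expf_eq0.
- exact: mul_q.
- by move=> E; rewrite E eqxx in x0.
- apply/matrixP => i j; rewrite [LHS]mxE (radial_partial2 x i j t0).2 /radial_hessian.
  by rewrite !mxE big_ord1 !mxE mulr_natr; congr (_ + _); ring.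
Qed.

End RadialFunctions.

(** * Comparison *)

Section Penalization.
Variables (R : realType) (n : nat).

Lemma halfspace_max (f : R * 'rV[R]_n -> R) (M e : R) :
  {within [set p | 0 <= p.1], continuous f} -> 0 < e ->
  (forall t x, 0 <= t -> f (t, x) <= M - e * (enorm x ^+ 2 + t)) ->
  forall t1 x1, 0 <= t1 -> 0 < f (t1, x1) -> exists t0 x0,
    [/\ 0 <= t0, 0 < f (t0, x0) & forall t x, 0 <= t -> f (t, x) <= f (t0, x0)].
Proof.
move=> cf e0 fM t1 x1 t10 f1.
(* e T exceeds M, so f > 0 forces |x|^2 + t < T; and T >= 1 turns |x|^2 < T into |x| <= T. The
   positive values of f are thus confined to a compact box. *)
pose T := 1 + `|M| / e; have T1 : 1 <= T by rewrite lerDl divr_ge0 // ltW.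
have eT : M < e * T by rewrite mulrDr mulr1 mulrC divfK ?gt_eqF // ltr_pwDl // ler_norm.
pose K : set (R * 'rV[R]_n) := `[0, T]%classic `*`
    [set x : 'rV[R]_n | forall i, `[- T, T]%classic (x ord0 i)].
have inK t x : 0 <= t -> 0 < f (t, x) -> K (t, x).
  move=> t0 f0; have := lt_le_trans f0 (fM t x t0); rewrite subr_gt0 => lM.
  have lT : enorm x ^+ 2 + t < T by rewrite -(ltr_pM2l e0); exact: lt_trans eT.
  have x2 : 0 <= enorm x ^+ 2 by exact: sqr_ge0.
  split=> /=; first by rewrite in_itv /= t0 /=; lra.
  move=> i; rewrite in_itv /= -ler_norml; apply: le_trans (coord_le_enorm x i) _.
  rewrite leNgt; apply/negP => Tx.
  have : T * 1 <= enorm x * enorm x by rewrite ler_pM ?ltW // ?(le_lt_trans T1) //; lra.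
  by rewrite -expr2; lra.
have cK : compact K.
  apply: compact_setX; first exact: segment_compact.
  by apply: (@rV_compact R n (fun=> `[- T, T]%classic)) => i; exact: segment_compact.
have K0 : K !=set0 by exists (t1, x1); exact: inK.
have fK : {within K, continuous f}.
  by apply: continuous_subspaceW cf => -[t x] [/=]; rewrite in_itv /= => /andP[].
have [[t0 x0] tx0 fmax] := compact_EVT_max K0 cK fK.
have le1 : f (t1, x1) <= f (t0, x0) by apply: fmax; rewrite inE; exact: inK.
exists t0, x0; split.
- by move: tx0; rewrite inE => -[/=]; rewrite in_itv /= => /andP[].
- exact: lt_le_trans le1.
- move=> t x t0'; have [fn|fp] := leP (f (t, x)) 0.
    by apply: le_trans fn (ltW (lt_le_trans f1 le1)).
  by apply: fmax; rewrite inE; exact: inK.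
Qed.

Lemma penalized_max (D : R * 'rV[R]_n -> R) (L M : R) :
  {within [set p | 0 <= p.1], continuous D} -> 1 <= L ->
  (forall t x, 0 <= t -> D (t, x) <= M) -> (forall x, D (0, x) <= 0) ->
  forall t1 x1, 0 < t1 -> 0 < D (t1, x1) -> exists (e t0 : R) (x0 : 'rV[R]_n),
  [/\ 0 < e, 0 < t0 &
    \forall p \near (t0, x0), D p - e * (enorm p.2 ^+ 2 + L * p.1) <=
      D (t0, x0) - e * (enorm x0 ^+ 2 + L * t0)].
Proof.
move=> cD L1 DM D0 t1 x1 t10 D1.
have L0 : 0 < L by exact: lt_le_trans L1.
pose P (p : R * 'rV[R]_n) := enorm p.2 ^+ 2 + L * p.1.
have P1 : 0 < P (t1, x1) by rewrite /P /= ltr_wpDl ?sqr_ge0 // mulr_gt0.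
(* With this [e] the penalty takes away exactly half of [D] at (t1, x1), so the penalized function
   is still positive there. *)
pose e := D (t1, x1) / (2 * P (t1, x1)).
have e0 : 0 < e by rewrite divr_gt0 // mulr_gt0.
pose f p := D p - e * P p.
have cP : continuous P.
  have c := continuous_enorm (R := R) (n := n); rewrite /P; cts.
have cf : {within [set p | 0 <= p.1], continuous f}.
  apply/subspace_continuousP => p p0; apply: cvgB; first by have /subspace_continuousP := cD; exact.
  apply: cvgM; first exact: cvg_cst.
  by apply: cvg_within_filter; exact: cP.
have fM t x : 0 <= t -> f (t, x) <= M - e * (enorm x ^+ 2 + t).
  move=> t0; apply: lerB; first exact: DM.
  by rewrite ler_pM2l // lerD2l /= ler_peMl.
have f1 : 0 < f (t1, x1).
  have -> : f (t1, x1) = D (t1, x1) / 2 by rewrite /f /e; field; rewrite gt_eqF.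
  by rewrite divr_gt0.
have [t0 [x0 [t00 f0 fmax]]] := halfspace_max cf e0 fM (ltW t10) f1.
(* At time 0, [D] is nonpositive and the penalty nonnegative, which excludes a positive value. *)
have {}t00 : 0 < t0.
  rewrite lt_neqAle t00 andbT; apply/eqP => E; move: f0; rewrite -E ltNge => /negP; apply.
  by rewrite subr_le0; apply: le_trans (D0 x0) _; rewrite mulr_ge0 ?(ltW e0) // /P /= mulr0 addr0 sqr_ge0.
exists e, t0, x0; split => //.
by apply: filterS (near_fst_gt0 x0 t00) => -[t x] /= t0'; apply: fmax; exact: ltW.
Qed.

End Penalization.

(** * Radial solutions with a source term *)

Section RadialSolutions.
Variables (R : realType) (m : nat).

Lemma continuous_slice (h : R -> R -> R) (t r : R) :
  continuous_at ((t, r) : R * R) (fun z : R * R => h z.1 z.2) -> continuous_at r (h t).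
Proof.
move=> c; apply: (@cts_comp _ _ _ (fun z : R * R => h z.1 z.2) (fun s : R => (t, s))) => //.
by cts.
Qed.

Lemma qform_rank1_perturbation n (p c : R) (v x : 'rV[R]_n) :
  qform (p%:M + c *: (v^T *m v)) x = p * qform 1%:M x + c * qform (v^T *m v) x.
Proof.
by rewrite /qform mulmxDr mulmxDl mxE -(scalemx1 _ p) -!scalemxAr -!scalemxAl !mxE.
Qed.

(* [W t x = Psi t |x|] solves [dt W = Pkplus m.+1 (hessian W) + c]. *)
Record radial_solution (c : R) (Psi pt pr prr : R -> R -> R) : Prop := RadialSolution {
  rs_C12 : radial_C12 Psi pt pr prr;
  rs_eq : forall t r : R, 0 < t -> r * (pt t r - prr t r - c) = m%:R * pr t r;
  rs_le : forall t r : R, 0 < t -> 0 < r -> pr t r <= r * prr t r }.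

Lemma radial_solution_hessian c Psi pt pr prr n t (x : 'rV[R]_n) :
  radial_solution c Psi pt pr prr -> (0 < n)%N -> 0 < t -> exists (v : 'rV[R]_n) (p : R),
  [/\ qform 1%:M v = 1, p <= prr t (enorm x),
    pt t (enorm x) = prr t (enorm x) + m%:R * p + c &
    hessian (fun y => Psi t (enorm y)) x = p%:M + (prr t (enorm x) - p) *: (v^T *m v)].
Proof.
move=> [H Heq Hle] n0 t0; have [v [p [v1 Ep p0 Eh]]] := hessian_radial H x n0 t0.
exists v, p; split => //.
  have [x0|x0] := eqVneq (enorm x) 0; first by rewrite x0 (p0 x0).
  have xp : 0 < enorm x by rewrite lt_neqAle eq_sym x0 enorm_ge0.
  by rewrite -(ler_pM2l xp) Ep; exact: Hle.
have [x0|x0] := eqVneq (enorm x) 0; last first.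
  have := Heq t (enorm x) t0; rewrite -Ep mulrCA => /(mulfI x0) <-; ring.
(* At the origin, compare the derivatives in [r] of both sides of [rs_eq]. *)
rewrite (p0 x0) x0.
have d1 : is_derive (0 : R) 1 (fun r : R => m%:R * pr t r) (m%:R * prr t 0).
  by have d := rc_drr H 0 t0; dv; ring.
have d2 : is_derive (0 : R) 1 (fun r : R => r * (pt t r - prr t r - c)) (pt t 0 - prr t 0 - c).
  apply: is_derive_eps => e e0.
  have ct := continuous_slice (rc_ct H 0 t0); have cr := continuous_slice (rc_crr H 0 t0).
  have cc : continuous_at (0 : R) (fun r : R => pt t r - prr t r - c) by cts.
  have /cvgrPdist_le /(_ _ e0) := cc; apply: filterS => h Hh.
  by rewrite add0r mul0r subr0 -mulrBr normrM mulrC ler_wpM2r // distrC.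
have E : (fun r : R => r * (pt t r - prr t r - c)) = (fun r : R => m%:R * pr t r).
  by apply/funext => r; exact: Heq.
rewrite E in d2; case: d1 d2 => _ <- [_ ->]; ring.
Qed.

Variables (c : R) (Psi pt pr prr : R -> R -> R) (n : nat).
Hypotheses (H : radial_solution c Psi pt pr prr) (mn : (m.+1 <= n)%N).
Let W (t : R) (x : 'rV[R]_n) := Psi t (enorm x).

(** [touching] puts the Hessian of [phi] above that of [W], to which [Pkplus_ge] applies. The choice
    phi = W is allowed and gives the inequality for [W] itself. *)
Lemma radial_solution_sub (phi : R -> 'rV[R]_n -> R) (t : R) (x : 'rV[R]_n) :
  C12 phi -> 0 < t ->
  (\forall p \near (t, x), W p.1 p.2 - phi p.1 p.2 <= W t x - phi t x) ->
  dt phi t x <= Pkplus m.+1 (hessian (phi t) x) + c.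
Proof.
move=> Cphi t0 Hmax.
have [Et Eq] := touching (C12_radial (rs_C12 H)) Cphi t0 Hmax.
have [v [p [v1 pq Ept Eh]]] := radial_solution_hessian x H (leq_trans (ltn0Sn m) mn) t0.
rewrite -Et (radial_dt (rs_C12 H) x t0) Ept lerD2r.
apply: (Pkplus_ge (ltn0Sn m) mn (hessian_sym x (C12_C2 Cphi t0)) v1 pq) => y.
by have := Eq y; rewrite Eh qform_rank1_perturbation.
Qed.

Lemma radial_solution_super (phi : R -> 'rV[R]_n -> R) (t : R) (x : 'rV[R]_n) :
  C12 phi -> 0 < t ->
  (\forall p \near (t, x), phi p.1 p.2 - W p.1 p.2 <= phi t x - W t x) ->
  Pkplus m.+1 (hessian (phi t) x) + c <= dt phi t x.
Proof.
move=> Cphi t0 Hmax.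
have [Et Eq] := touching Cphi (C12_radial (rs_C12 H)) t0 Hmax.
have [v [p [v1 pq Ept Eh]]] := radial_solution_hessian x H (leq_trans (ltn0Sn m) mn) t0.
rewrite Et (radial_dt (rs_C12 H) x t0) Ept lerD2r.
apply: (Pkplus_le (ltn0Sn m) mn (hessian_sym x (C12_C2 Cphi t0)) v1 pq) => y.
by have := Eq y; rewrite Eh qform_rank1_perturbation.
Qed.

End RadialSolutions.

(** The quadratic term adds 2 e to both prr and pr / r, so [rs_le] persists for either sign of e. It
    adds 2 (m + 1) e to the operator, and 2 m + 3 = 2 (m + 1) + 1 leaves the source e. *)
Lemma radial_solution_perturbed (R : realType) (m : nat) (Psi pt pr prr : R -> R -> R) (e : R) :
  radial_solution m 0 Psi pt pr prr ->
  radial_solution m e (fun t r => Psi t r + e * (r ^+ 2 + (2 * m%:R + 3) * t))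
    (fun t r => pt t r + e * (2 * m%:R + 3)) (fun t r => pr t r + e * (2 * r))
    (fun t r => prr t r + e * 2).
Proof.
move=> [H Heq Hle]; split; first split => t.
- by move=> r t0; have d := rc_dt H r t0; dv; ring.
- by move=> r t0; have d := rc_dr H r t0; dv; ring.
- by move=> r t0; have d := rc_drr H r t0; dv; ring.
- by move=> t0; rewrite (rc_r0 H t0) !mulr0 addr0.
- by move=> r t0; have d := rc_c H r t0; cts.
- by move=> r t0; have d := rc_ct H r t0; cts.
- by move=> r t0; have d := rc_cr H r t0; cts.
- by move=> r t0; have d := rc_crr H r t0; cts.
- by move=> t r t0; have := Heq t r t0; lra.
- by move=> t r t0 r0; have := Hle t r t0 r0; lra.
Qed.

(** [Num.sqrt] is 0 on negative numbers, so continuity of [g] on the half-line becomes continuity on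
    the whole line of the function of q = |y|^2 that the integrals use. *)
Lemma continuous_comp_sqrt (R : realType) (g : R -> R) :
  {within [set r : R | 0 <= r], continuous g} -> continuous (fun q : R => g (Num.sqrt q)).
Proof.
move=> /subspace_continuousP cg q.
have c : Num.sqrt y @[y --> q] --> within [set r : R | 0 <= r] (nbhs (Num.sqrt q)).
  move=> A wA; have := sqrt_continuous (wA : nbhs (Num.sqrt q) _).
  by move=> W; apply: (@filterS _ (nbhs q) _ _ _ _ W) => y Hy; exact: Hy (sqrtr_ge0 y).
exact: (cvg_comp Num.sqrt g c (cg (Num.sqrt q) (sqrtr_ge0 q))).
Qed.

Lemma psi_radial_solution (R : realType) (m : nat) (g : R -> R) (B : R) :
  continuous (fun q : R => g (Num.sqrt q)) -> (forall r, 0 <= r -> `|g r| <= B) ->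
  (forall t r : R, 0 < t -> 0 < r ->
     r^-1 * derive1 (fun s => psi m.+1 g t s) r <= derive1n 2 (fun s => psi m.+1 g t s) r) ->
  exists pt pr prr, radial_solution m 0 (psi m.+1 g) pt pr prr.
Proof.
move=> cg gB Hg; have [pt [pr [prr [H Heq]]]] := psi_radial_C12 m cg gB.
exists pt, pr, prr; split=> // [t r t0|t r t0 r0]; first by rewrite subr0 Heq.
have d1 : derive1 (psi m.+1 g t) = pr t.
  by apply/funext => s; rewrite derive1E; have [_ ->] := rc_dr H s t0.
have d2 : derive1 (pr t) r = prr t r by rewrite derive1E; have [_ ->] := rc_drr H r t0.
by have := Hg t r t0 r0; rewrite /= d1 d2 ler_pdivrMl.
Qed.

(** Continuity of [g] is what [cauchy_solution] forces by asking for continuity up to t = 0. [U] is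
    defined by cases because the formula of [psi] has no meaning at t = 0. Uniqueness is among
    bounded functions, which the quadratic penalty dominates at infinity. *)
Theorem mainTheorem2 (R : realType) (N k : nat) (g : R -> R) :
  (2 <= N)%N -> (1 <= k)%N -> (k < N)%N ->
  (exists M : R, forall r : R, 0 <= r -> `|g r| <= M) ->
  {within [set r : R | 0 <= r], continuous g} ->
  (forall t r : R, 0 < t -> 0 < r ->
     r^-1 * derive1 (fun s => psi k g t s) r <= derive1n 2 (fun s => psi k g t s) r) ->
  let U := fun (t : R) (x : 'rV[R]_N) =>
             if 0 < t then psi k g t (enorm x) else g (enorm x) in
  cauchy_solution k g U /\
  (forall u : R -> 'rV[R]_N -> R,
     cauchy_solution k g u ->
     (exists M : R, forall t x, 0 <= t -> `|u t x| <= M) ->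
     forall t x, 0 < t -> u t x = psi k g t (enorm x)).
Proof.
(* From here on k = m + 1: one axial and m transverse coordinates. *)
case: k => // m _ _ mN [B gB] /continuous_comp_sqrt cg Hg U.
have [pt [pr [prr S]]] := psi_radial_solution cg gB Hg.
have [V [cV Vpsi V0 [M VM]]] := psi_extension m cg gB.
pose VN (p : R * 'rV[R]_N) := V (p.1, enorm p.2).
have cVN : continuous VN by have c := continuous_enorm (R := R) (n := N); rewrite /VN; cts.
have nearU (t : R) (x : 'rV[R]_N) : 0 < t ->
    \forall p \near (t, x), VN p = psi m.+1 g p.1 (enorm p.2).
  by move=> t0; apply: filterS (near_fst_gt0 x t0) => p p0; exact: Vpsi.
split.
  split.
  (* For t >= 0, [U] coincides with [VN], which is continuous on the whole space. *)
  - apply: (subspace_eq_continuous (f := VN)); last exact: continuous_subspaceT.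
    move=> [t x]; rewrite inE => t0; change (VN (t, x) = U t x); rewrite /U /VN /=.
    have [t0'|t0'] := ltP 0 t; first exact: Vpsi.
    have -> : t = 0 by apply/le_anti; rewrite t0'; exact: t0.
    by rewrite V0 ?enorm_ge0.
  - by move=> x; rewrite /U ltxx.
  - move=> phi t x Cphi t0 Hmax; rewrite -[leRHS]addr0.
    apply: (radial_solution_sub S (ltnW mN) Cphi t0).
    apply: filterS2 (near_fst_gt0 x t0) Hmax => p p0.
    by rewrite /U p0 t0.
  - move=> phi t x Cphi t0 Hmin; rewrite -[leLHS]addr0.
    apply: (radial_solution_super S (ltnW mN) Cphi t0).
    apply: filterS2 (near_fst_gt0 x t0) Hmin => p p0.
    by rewrite /U p0 t0 -lerN2 !opprB.
move=> u [cu u0 usub usuper] [Mu uM] t1 x1 t10.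
have L1 : 1 <= 2 * m%:R + 3 :> R by have : 0 <= m%:R :> R by []; lra.
have VN0 x : VN (0, x) = u 0 x by rewrite u0 /VN V0 ?enorm_ge0.
have cVN' : {within [set p : R * 'rV[R]_N | 0 <= p.1], continuous VN} by exact: continuous_subspaceT.
apply/eqP; rewrite -(Vpsi _ _ t10) -[V _]/(VN (t1, x1)) eq_le; apply/andP; split; rewrite leNgt;
  apply/negP => lt1.
- pose D (p : R * 'rV[R]_N) := joint u p - VN p.
  have cD : {within [set p | 0 <= p.1], continuous D}.
    apply/subspace_continuousP => p p0.
    by apply: cvgB; [move: cu => /subspace_continuousP; exact|move: cVN' => /subspace_continuousP; exact].
  have DM t x : 0 <= t -> D (t, x) <= Mu + M.
    move=> t0; have := uM t x t0; have := VM (t, enorm x); rewrite !ler_norml /D /joint /VN /=; lra.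
  have D0 x : D (0, x) <= 0 by rewrite /D VN0 subrr.
  have D1 : 0 < D (t1, x1) by rewrite subr_gt0.
  have [e [t0 [x0 [e0 t00 Hmax]]]] := penalized_max cD L1 DM D0 t10 D1.
  have Se := radial_solution_perturbed e S.
  pose phi t (x : 'rV[R]_N) := psi m.+1 g t (enorm x) + e * (enorm x ^+ 2 + (2 * m%:R + 3) * t).
  have Cphi : C12 phi := C12_radial (rs_C12 Se).
  (* u - phi has a local maximum here, so [phi] is a test function for the subsolution [u]; this
     will contradict [H2], as e > 0. *)
  have H1 : dt phi t0 x0 <= Pkplus m.+1 (hessian (phi t0) x0).
    apply: usub => //; apply: filterS2 (nearU t0 x0 t00) Hmax => p pE.
    by rewrite /D pE /VN (Vpsi _ _ t00) /phi /joint /=; lra.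
  (* [phi] touches itself, the difference being identically zero. *)
  have H2 : Pkplus m.+1 (hessian (phi t0) x0) + e <= dt phi t0 x0.
    apply: (radial_solution_super Se (ltnW mN) Cphi t00).
    by apply: filterS (near_fst_gt0 x0 t00) => p _; rewrite !subrr.
  lra.
- pose D (p : R * 'rV[R]_N) := VN p - joint u p.
  have cD : {within [set p | 0 <= p.1], continuous D}.
    apply/subspace_continuousP => p p0.
    by apply: cvgB; [move: cVN' => /subspace_continuousP; exact|move: cu => /subspace_continuousP; exact].
  have DM t x : 0 <= t -> D (t, x) <= Mu + M.
    move=> t0; have := uM t x t0; have := VM (t, enorm x); rewrite !ler_norml /D /joint /VN /=; lra.
  have D0 x : D (0, x) <= 0 by rewrite /D VN0 subrr.
  have D1 : 0 < D (t1, x1) by rewrite subr_gt0.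
  have [e [t0 [x0 [e0 t00 Hmax]]]] := penalized_max cD L1 DM D0 t10 D1.
  (* Mirror case: the source is now - e, and the supersolution property of [u] is tested. *)
  have Se := radial_solution_perturbed (- e) S.
  pose phi t (x : 'rV[R]_N) := psi m.+1 g t (enorm x) + - e * (enorm x ^+ 2 + (2 * m%:R + 3) * t).
  have Cphi : C12 phi := C12_radial (rs_C12 Se).
  have H1 : Pkplus m.+1 (hessian (phi t0) x0) <= dt phi t0 x0.
    apply: usuper => //; apply: filterS2 (nearU t0 x0 t00) Hmax => p pE.
    by rewrite /D pE /VN (Vpsi _ _ t00) /phi /joint /=; lra.
  have H2 : dt phi t0 x0 <= Pkplus m.+1 (hessian (phi t0) x0) + - e.
    apply: (radial_solution_sub Se (ltnW mN) Cphi t00).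
    by apply: filterS (near_fst_gt0 x0 t00) => p _; rewrite !subrr.
  lra.
Qed.
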